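(* Let $\Gamma\subsetneq\mathrm{Sp}_n(\mathbb{R})$ be an arithmetic subgroup such that $M=\Gamma\backslash\mathbb{H}_n$ has finite volume. Then there is a positive real constant $c_n$ (depending only on $n$ and $\Gamma$) such that for every $Z\in\mathbb{H}_n$ and every $\kappa\geq n+1$, \[ S_\kappa^\Gamma(Z)\leq c_n\,\kappa^{n(n+1)/2}\sum_{\gamma\in\Gamma}\frac{1}{\prod_{j=1}^n\mathrm{ch}^\kappa\big(r_j^\gamma(Z)\big)}. \]
   Context: $\mathbb{H}_n$ is the Siegel upper half-space with the action $Z\mapsto(AZ+B)(CZ+D)^{-1}$; arithmetic means commensurable with $\mathrm{Sp}_n(\mathbb{Z})$. $S_\kappa^\Gamma(Z)=\sum_{j=1}^d\det(Y)^\kappa|f_j(Z)|^2$ for an orthonormal basis (Petersson inner product $\int_{\Gamma\backslash\mathbb{H}_n}\det(Y)^\kappa f\overline g\,d\mu_n$) of the space of Siegel cusp forms of weight $\kappa$ and degree $n$ for $\Gamma$. For $Z,W\in\mathbb{H}_n$ let $\rho_1,\dots,\rho_n$ be the eigenvalues of the cross-ratio matrix $\rho(Z,W)=(Z-W)(\overline Z-W)^{-1}(\overline Z-\overline W)(Z-\overline W)^{-1}$ and define $r_j(Z,W)$ by $\exp(2r_j(Z,W))=\frac{1+\sqrt{\rho_j}}{1-\sqrt{\rho_j}}$; set $r_j^\gamma(Z)=r_j(Z,\gamma Z)$. *)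

(* Defs.v *)
From HB Require Import structures.
From mathcomp Require Import all_boot all_order all_algebra.
From mathcomp Require Import complex.
From mathcomp Require Import all_classical all_reals all_analysis.

Set Implicit Arguments.
Unset Strict Implicit.
Unset Printing Implicit Defensive.

Import Order.TTheory GRing.Theory Num.Theory.
Import numFieldNormedType.Exports.

Local Open Scope classical_set_scope.
Local Open Scope ring_scope.

Section TupleMeasure.
Context d (T : measurableType d) (R : realType).
Context (mu : {sigma_finite_measure set T -> \bar R}).

Definition tuple_cons N (p : T * N.-tuple T) : N.+1.-tuple T :=
  [tuple of p.1 :: p.2].

Lemma measurable_tuple_cons N : measurable_fun setT (@tuple_cons N).
Proof. exact: (measurable_cons (f := fst) (g := snd)). Qed.

HB.instance Definition _ N :=
  isMeasurableFun.Build _ _ _ _ (@tuple_cons N) (@measurable_tuple_cons N).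

Section Step.
Context N (m : {sigma_finite_measure set (N.-tuple T) -> \bar R}).

Definition cons_measure : set (N.+1.-tuple T) -> \bar R :=
  pushforward (mu \x m)%E (@tuple_cons N).

Let cons_measure0 : cons_measure set0 = 0%E.
Proof. exact: measure0. Qed.

Let cons_measure_ge0 A : (0 <= cons_measure A)%E.
Proof. exact: measure_ge0. Qed.

Let cons_measure_semi_sigma_additive : semi_sigma_additive cons_measure.
Proof.
exact: (@measure_semi_sigma_additive _ _ _
  (pushforward (mu \x m)%E (@tuple_cons N))).
Qed.

HB.instance Definition _ := isMeasure.Build _ _ _ cons_measure
  cons_measure0 cons_measure_ge0 cons_measure_semi_sigma_additive.

Let cons_measure_sigma_finite : sigma_finite setT cons_measure.
Proof.
have /sigma_finiteP[F [FT ndF Foo]] := sigma_finiteT mu.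
have /sigma_finiteP[G [GT ndG Goo]] := sigma_finiteT m.
pose u (t : N.+1.-tuple T) : T * N.-tuple T := (thead t, [tuple of behead t]).
have u_meas : measurable_fun setT u.
  apply/measurable_fun_pair; first exact: measurable_tnth.
  exact: measurable_behead.
have uK p : u (tuple_cons p) = p.
  by case: p => x t; rewrite /u /tuple_cons /= theadE; congr pair; exact: val_inj.
exists (fun k => u @^-1` (F k `*` G k)).
  rewrite -preimage_bigcup; apply/esym/seteqP; split => // t _ /=.
  have [i _ Fi] : (\bigcup_k F k) (u t).1 by rewrite -FT.
  have [j _ Gj] : (\bigcup_k G k) (u t).2 by rewrite -GT.
  exists (maxn i j) => //; split.
  - by move: Fi; exact/subsetPset/ndF/leq_maxl.
  - by move: Gj; exact/subsetPset/ndG/leq_maxr.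
move=> k; have [mF Fk] := Foo k; have [mG Gk] := Goo k.
have mFG : measurable (F k `*` G k) by exact: measurableX.
split; first by rewrite -[X in measurable X]setTI; exact: u_meas.
rewrite /cons_measure /pushforward.
have -> : (@tuple_cons N) @^-1` (u @^-1` (F k `*` G k)) = F k `*` G k.
  by apply/seteqP; split => p; rewrite /preimage /mkset uK.
by rewrite product_measure1E// lte_mul_pinfty// ge0_fin_numE.
Qed.

HB.instance Definition _ := Measure_isSigmaFinite.Build _ _ _ cons_measure
  cons_measure_sigma_finite.

End Step.

(* N-fold product of mu *)
Fixpoint tuple_measure (N : nat) :
    {sigma_finite_measure set (N.-tuple T) -> \bar R} :=
  match N with
  | 0 => dirac ([tuple] : 0.-tuple T)
  | N'.+1 => cons_measure (tuple_measure N')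
  end.

End TupleMeasure.

Section Siegel.
Context (R : realType).
Local Notation C := R[i].
Local Notation T := (measurableTypeR R).

Definition cabs (z : C) : R := complex.Re `|z|.

Definition cosh (x : R) : R := (expR x + expR (- x)) / 2.

Section Degree.
Context (n : nat).
Implicit Types (Z W : 'M[C]_n) (g : 'M[R]_(n + n)) (G : set 'M[R]_(n + n)).

Definition posdef (Y : 'M[R]_n) : Prop :=
  Y^T = Y /\ forall v : 'cV[R]_n, v != 0 -> 0 < (v^T *m Y *m v) 0 0.

Definition possemidef (Y : 'M[R]_n) : Prop :=
  Y^T = Y /\ forall v : 'cV[R]_n, 0 <= (v^T *m Y *m v) 0 0.

Definition ImM Z : 'M[R]_n := map_mx (@complex.Im R) Z.

Definition siegel_space : set 'M[C]_n := [set Z | Z^T = Z /\ posdef (ImM Z)].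

Definition symplectic : set 'M[R]_(n + n) :=
  let J := block_mx 0 1%:M (- 1%:M) 0 in [set g | g^T *m J *m g = J].

Definition symplecticZ : set 'M[R]_(n + n) :=
  symplectic `&` [set g | forall i j, g i j \is a Num.int].

Definition toC (A : 'M[R]_n) : 'M[C]_n := map_mx (real_complex R) A.

Definition autfactor g Z : 'M[C]_n := toC (dlsubmx g) *m Z + toC (drsubmx g).

Definition siegel_act g Z : 'M[C]_n :=
  (toC (ulsubmx g) *m Z + toC (ursubmx g)) *m invmx (autfactor g Z).

Definition is_subgroup G : Prop :=
  [/\ G `<=` symplectic, G 1%:M,
      (forall g h, G g -> G h -> G (g *m h)) &
      (forall g, G g -> G (invmx g))].

Definition finite_index (H G : set 'M[R]_(n + n)) : Prop :=
  H `<=` G /\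
  exists s : seq 'M[R]_(n + n),
    forall g, G g -> exists2 x, x \in s & G x /\ H (invmx x *m g).

(* commensurable with Sp_n(Z) *)
Definition arithmetic_subgroup G : Prop :=
  [/\ is_subgroup G, finite_index (G `&` symplecticZ) G &
      finite_index (G `&` symplecticZ) symplecticZ].

(* Symmetric matrices are coordinatized by their n(n+1)/2 entries on or above
   the diagonal, the entry (i, j) with i <= j having index j(j+1)/2 + i. *)
Definition sym_index (i j : nat) : nat :=
  ((maxn i j * (maxn i j).+1)./2 + minn i j)%N.

Local Notation coords :=
  (((n * n.+1)./2).-tuple T * ((n * n.+1)./2).-tuple T)%type.

Definition siegel_pt (p : coords) : 'M[C]_n :=
  \matrix_(i, j) Complex (nth 0 p.1 (sym_index i j)) (nth 0 p.2 (sym_index i j)).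

(* d mu_n = det(Y)^-(n+1) \prod_(j <= k) dx_jk dy_jk *)
Definition siegel_integral (F : set 'M[C]_n) (h : 'M[C]_n -> R) : \bar R :=
  let leb := tuple_measure (@lebesgue_measure R) (n * n.+1)./2 in
  (\int[leb \x leb]_(p in [set p : coords | F (siegel_pt p)])
     (h (siegel_pt p) / (\det (ImM (siegel_pt p))) ^+ n.+1)%:E)%E.

(* A strict fundamental domain: F is a Borel section of the projection onto
   G \ siegel_space, so integrals over the quotient are integrals over F. *)
Definition fundamental_domain G (F : set 'M[C]_n) : Prop :=
  [/\ F `<=` siegel_space,
      measurable [set p : coords | F (siegel_pt p)] &
      forall Z, siegel_space Z ->
        exists! W, F W /\ exists2 g, G g & W = siegel_act g Z].

Definition finite_covolume G : Prop :=
  exists2 F, fundamental_domain G F &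
    (siegel_integral F (fun=> 1%R) < +oo)%E.

(* f is only meaningful on symmetric matrices, so it is precomposed with the
   linear projection onto them; differentiability is over the field C. *)
Definition symmetrize (K : numFieldType) (W : 'M[K]_n) : 'M[K]_n :=
  2^-1 *: (W + W^T).

Definition holomorphic_on (K : numFieldType) (D : set 'M[K]_n)
    (f : 'M[K]_n -> K) : Prop :=
  forall Z : 'M[K]_n, D Z -> differentiable (fun W : 'M[K]_n => f (symmetrize W) : K^o) Z.

Definition slash (k : nat) (f : 'M[C]_n -> C) g Z : C :=
  (\det (autfactor g Z)) ^- k * f (siegel_act g Z).

(* The matrix with it at (l, l), zeros elsewhere in row and column l, and Z1
   in the remaining rows and columns. *)
Definition cusp_mx (l : 'I_n) (Z1 : 'M[C]_n.-1) (t : R) : 'M[C]_n :=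
  \matrix_(i, j)
    match unlift l i, unlift l j with
    | Some i', Some j' => Z1 i' j'
    | None, None => Complex 0 t
    | _, _ => 0
    end.

End Degree.

Record siegel_modular_form n (G : set 'M[R]_(n + n)) (k : nat)
    (f : 'M[C]_n -> C) : Prop := SiegelModularForm {
  smf_holomorphic :
    @holomorphic_on n (C : numFieldType) (@siegel_space n) f;
  smf_modular : forall g Z, G g -> siegel_space Z ->
    f (siegel_act g Z) = (\det (autfactor g Z)) ^+ k * f Z;
  smf_bounded : forall g, @symplecticZ n g -> forall Y0, posdef Y0 ->
    exists M : R, forall Z, siegel_space Z -> possemidef (ImM Z - Y0) ->
      cabs (slash k f g Z) <= M
}.

(* The Siegel operator annihilates the form at every cusp.  The distinguished
   index l is usually the last one; all choices are conjugate under
   permutation matrices, which are in Sp_n(Z). *)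
Record siegel_cusp_form n (G : set 'M[R]_(n + n)) (k : nat)
    (f : 'M[C]_n -> C) : Prop := SiegelCuspForm {
  scf_modular : siegel_modular_form G k f;
  scf_cuspidal : forall g, @symplecticZ n g ->
    forall (l : 'I_n) (Z1 : 'M[C]_n.-1), siegel_space Z1 ->
      cabs (slash k f g (cusp_mx l Z1 t)) @[t --> +oo%R] --> (0 : R)
}.

Definition petersson n (F : set 'M[C]_n) (k : nat) (f h : 'M[C]_n -> C) : C :=
  let u Z := f Z * Num.conj (h Z) in
  Complex
    (fine (siegel_integral F (fun Z => \det (ImM Z) ^+ k * complex.Re (u Z))))
    (fine (siegel_integral F (fun Z => \det (ImM Z) ^+ k * complex.Im (u Z)))).

Record orthonormal_basis n (G : set 'M[R]_(n + n)) (F : set 'M[C]_n) (k : nat)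
    (d : nat) (f : 'I_d -> 'M[C]_n -> C) : Prop := OrthonormalBasis {
  onb_cusp : forall j, siegel_cusp_form G k (f j);
  onb_orthonormal : forall i j, petersson F k (f i) (f j) = (i == j)%:R;
  onb_span : forall h, siegel_cusp_form G k h ->
    exists c : 'I_d -> C, forall Z, siegel_space Z ->
      h Z = \sum_(j < d) c j * f j Z
}.

Definition S_fun n (k d : nat) (f : 'I_d -> 'M[C]_n -> C) (Z : 'M[C]_n) : R :=
  \sum_(j < d) \det (ImM Z) ^+ k * cabs (f j Z) ^+ 2.

Definition cross_ratio n (Z W : 'M[C]_n) : 'M[C]_n :=
  let Zb := map_mx Num.conj Z in let Wb := map_mx Num.conj W in
  (Z - W) *m invmx (Zb - W) *m (Zb - Wb) *m invmx (Z - Wb).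

(* eigenvalues with multiplicity, as the roots of the characteristic
   polynomial in some order *)
Definition eigenvals n (A : 'M[C]_n) : seq C :=
  sval (closed_field_poly_normal (char_poly A)).

(* The eigenvalues of the cross-ratio matrix are real in [0, 1[, hence the
   real part; r is the solution of exp(2r) = (1 + sqrt rho)/(1 - sqrt rho). *)
Definition r_fun n (Z W : 'M[C]_n) (j : 'I_n) : R :=
  let s := Num.sqrt (complex.Re (eigenvals (cross_ratio Z W))`_j) in
  ln ((1 + s) / (1 - s)) / 2.

End Siegel.

(* Main.v *)
Require Import Defs.
From HB Require Import structures.
From mathcomp Require Import all_boot all_order all_algebra.
From mathcomp Require Import fingroup perm complex.
From mathcomp Require Import all_classical all_reals all_analysis.
From mathcomp Require Import measurable_realfun.
From mathcomp Require Import ring lra.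

(** Write [S_kappa^Gamma(Z) = det(Y)^kappa |h(Z)|^2 / ||h||^2] where
    [h = \sum_j conj(f_j(Z)) f_j].  Move [Z] to [i] by an affine symplectic map.
    On the polydisc [P] of radius [delta = c / sqrt kappa] around [i], the function
    [h] times the holomorphic weight [(1 - i tr(zeta) / 2)^kappa] has modulus
    squared bounded by a constant times [det(Y)^kappa |h|^2], so the mean value
    inequality bounds the value at [Z] by [C kappa^N] times the integral of the
    invariant function [det(Y)^kappa |h|^2] over the translate of [P], with
    [N = n(n+1)/2].  Unfolding this integral over a fundamental domain bounds it by
    [||h||^2] times the largest number of [gamma] moving a given point into the
    translate of [P].  If [gamma] maps one point of that translate to another, then
    [gamma Z] is within [O(delta)] of [Z], hence [\prod_j ch^kappa(r_j^gamma(Z))] is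
    bounded, and the count is dominated by the sum over [Gamma]. *)

Set Implicit Arguments.
Unset Strict Implicit.
Unset Printing Implicit Defensive.

Import Order.TTheory GRing.Theory Num.Theory.
Import numFieldNormedType.Exports.

Local Open Scope classical_set_scope.
Local Open Scope ring_scope.

Local Notation ImM := Defs.ImM.

(** * The action of the symplectic group *)

(** The exponent of [kappa] reflects the real dimension 2N of the half-space: the polydisc has
    volume of order [delta^(2N)], whose reciprocal is of order [kappa^N] for [delta] of order
    [1 / sqrt kappa]. At this radius det(Y)^kappa is not almost constant: it varies like exp(kappa
    tr Im zeta), with an exponent of order sqrt kappa. The weight is chosen so that its modulus
    squared has the same linear term as det(1 + Im zeta); the two then differ by a factor 1 +
    O(delta^2), whose kappa-th power stays bounded. The count has the same quadratic gain: the cross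
    ratio of points at distance O(delta) is O(delta^2). The measure is given in coordinates, so its
    invariance must be derived: Sp_n(R) is generated by translations and inversions in a single
    diagonal entry, and these split into affine maps and inversions of one complex variable at a
    time. Holomorphy means differentiability at each point, without continuity of the derivative, so
    the mean value inequality rests on a Goursat bisection. *)

Section Cabs.
Context (R : realType).
Local Notation C := R[i].
Implicit Types z w : C.

Lemma cabsE z : (cabs z)%:C%C = `|z|.
Proof. by rewrite /cabs normc_def. Qed.

Lemma cabs_ge0 z : 0 <= cabs z.
Proof. by rewrite -(ler0c (cabs z)) cabsE. Qed.

Lemma cabsM z w : cabs (z * w) = cabs z * cabs w.
Proof. by apply: (@complexI R); rewrite rmorphM /= !cabsE normrM. Qed.

Lemma cabsX z k : cabs (z ^+ k) = cabs z ^+ k.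
Proof. by apply: (@complexI R); rewrite rmorphXn /= !cabsE normrX. Qed.

Lemma cabsD z w : cabs (z + w) <= cabs z + cabs w.
Proof. by rewrite -lecR rmorphD /= !cabsE ler_normD. Qed.

Lemma cabsN z : cabs (- z) = cabs z.
Proof. by apply: (@complexI R); rewrite !cabsE normrN. Qed.

Lemma cabsB z w : cabs (z - w) <= cabs z + cabs w.
Proof. by rewrite -(cabsN w) cabsD. Qed.

Lemma cabs0 : cabs (0 : C) = 0.
Proof. by apply: (@complexI R); rewrite !cabsE normr0. Qed.

Lemma cabs1 : cabs (1 : C) = 1.
Proof. by apply: (@complexI R); rewrite !cabsE normr1. Qed.

Lemma cabs_conj z : cabs (Num.conj z) = cabs z.
Proof. by apply: (@complexI R); rewrite !cabsE norm_conjC. Qed.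

Lemma cabs_eq0 z : (cabs z == 0) = (z == 0).
Proof. by rewrite -(inj_eq (@complexI R)) cabsE normr_eq0. Qed.

Lemma cabs_sqr z : cabs z ^+ 2 = complex.Re z ^+ 2 + complex.Im z ^+ 2.
Proof.
rewrite /cabs normc_def /= sqr_sqrtr//.
by rewrite addr_ge0 ?sqr_ge0.
Qed.

Lemma cabs_real (a : R) : cabs (a%:C%C) = `|a|.
Proof.
by apply/eqP; rewrite -(@eqrXn2 _ 2%N) ?cabs_ge0// cabs_sqr /= expr0n addr0 real_normK ?num_real.
Qed.

Lemma cabs_Re z : `|complex.Re z| <= cabs z.
Proof.
rewrite -ler_sqr ?nnegrE ?cabs_ge0// cabs_sqr real_normK ?num_real//.
by rewrite lerDl sqr_ge0.
Qed.

Lemma cabs_Im z : `|complex.Im z| <= cabs z.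
Proof.
rewrite -ler_sqr ?nnegrE ?cabs_ge0// cabs_sqr real_normK ?num_real//.
by rewrite lerDr sqr_ge0.
Qed.

Lemma cabs_le z : cabs z <= `|complex.Re z| + `|complex.Im z|.
Proof.
rewrite -ler_sqr ?nnegrE ?cabs_ge0 ?addr_ge0// cabs_sqr sqrrD.
rewrite !real_normK ?num_real// lerD2r lerDl.
by rewrite mulrn_wge0// mulr_ge0.
Qed.

Lemma cabs_sum (I : Type) (s : seq I) (P : pred I) (F : I -> C) :
  cabs (\sum_(i <- s | P i) F i) <= \sum_(i <- s | P i) cabs (F i).
Proof.
elim/big_ind2 : _ => //; first by rewrite cabs0.
by move=> a b c d ab cd; rewrite (le_trans (cabsD _ _))// lerD.
Qed.

Lemma conjC_complex (a b : R) : Num.conj (Complex a b) = Complex a (- b).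
Proof. by []. Qed.

End Cabs.

Section SiegelAction.
Context (R : realType) (n : nat).
Local Notation C := R[i].
Implicit Types (Z W : 'M[C]_n) (g h : 'M[R]_(n + n)).

Definition sympl_J (K : pzRingType) : 'M[K]_(n + n) :=
  block_mx 0 1%:M (- 1%:M) 0.

Definition numfactor g Z : 'M[C]_n := toC (ulsubmx g) *m Z + toC (ursubmx g).

Definition gC g : 'M[C]_(n + n) := map_mx (real_complex R) g.

(** Homogeneous form of the action: identities for numerators and automorphy factors become
    identities between matrix products. *)
Lemma gCE g Z : gC g *m col_mx Z 1%:M = col_mx (numfactor g Z) (autfactor g Z).
Proof.
rewrite /gC -[g in LHS]submxK map_block_mx /= mul_block_col !mulmx1.
by rewrite /numfactor /autfactor /toC.
Qed.

Lemma symplecticC g : symplectic g ->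
  (gC g)^T *m sympl_J C *m gC g = sympl_J C.
Proof.
move=> sg; rewrite /gC map_trmx.
have -> : sympl_J C = map_mx (real_complex R) (sympl_J R).
  by rewrite /sympl_J map_block_mx !map_mx0 map_mxN map_mx1.
by rewrite -!map_mxM; congr map_mx; exact: sg.
Qed.

(** Both sides are values of the symplectic form, on the columns [(Z; 1)] and [(W; 1)] and on their
    images under [g]. Equal points give the symmetry of the image, conjugate points its imaginary
    part. *)
Lemma sympl_pair g Z W : symplectic g ->
  (numfactor g Z)^T *m autfactor g W - (autfactor g Z)^T *m numfactor g W = Z^T - W.
Proof.
move=> /symplecticC sg.
have E (A B A' B' : 'M[C]_n) : (col_mx A B)^T *m sympl_J C *m col_mx A' B' =
    A^T *m B' - B^T *m A'.
  rewrite tr_col_mx /sympl_J mul_row_block !mulmx0 mulmx1 add0r addr0 mulmxN mulmx1.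
  by rewrite mul_row_col mulNmx addrC.
rewrite -E -!gCE trmx_mul !mulmxA -(mulmxA _ (gC g)^T).
by rewrite -(mulmxA _ (_ *m _) (gC g)) sg E trmx1 mulmx1 mul1mx.
Qed.

Definition conjM m p (A : 'M[C]_(m, p)) : 'M[C]_(m, p) := map_mx Num.conj A.

Lemma conjM_real m p (A : 'M[R]_(m, p)) : conjM (map_mx (real_complex R) A) = map_mx (real_complex R) A.
Proof. by apply/matrixP => i j; rewrite !mxE /= conjC_complex oppr0. Qed.

Lemma conjM_mul m p q (A : 'M[C]_(m, p)) (B : 'M[C]_(p, q)) :
  conjM (A *m B) = conjM A *m conjM B.
Proof. exact: map_mxM. Qed.

Lemma conjMD m p (A B : 'M[C]_(m, p)) : conjM (A + B) = conjM A + conjM B.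
Proof. exact: map_mxD. Qed.

Lemma conjMK m p : involutive (@conjM m p).
Proof. by move=> A; apply/matrixP => i j; rewrite !mxE conjCK. Qed.

Lemma conjM_unit (A : 'M[C]_n) : (conjM A \in unitmx) = (A \in unitmx).
Proof. exact: map_unitmx. Qed.

Lemma conjM_inv (A : 'M[C]_n) : conjM (invmx A) = invmx (conjM A).
Proof. exact: map_invmx. Qed.

Lemma conjM_tr m p (A : 'M[C]_(m, p)) : conjM A^T = (conjM A)^T.
Proof. by rewrite /conjM map_trmx. Qed.

Lemma autfactor_conj g Z : conjM (autfactor g Z) = autfactor g (conjM Z).
Proof. by rewrite /autfactor conjMD conjM_mul !conjM_real. Qed.

Lemma numfactor_conj g Z : conjM (numfactor g Z) = numfactor g (conjM Z).
Proof. by rewrite /numfactor conjMD conjM_mul !conjM_real. Qed.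

Lemma siegel_act_conj g Z : conjM (siegel_act g Z) = siegel_act g (conjM Z).
Proof.
by rewrite /siegel_act -/(numfactor g Z) conjM_mul conjM_inv autfactor_conj numfactor_conj.
Qed.

Lemma complexEi (z : C) : z = (complex.Re z)%:C%C + Complex 0 1 * (complex.Im z)%:C%C.
Proof. exact: complexE. Qed.

Lemma ImM_tr Z : (ImM Z)^T = ImM Z^T.
Proof. by apply/matrixP => i j; rewrite !mxE. Qed.

Lemma subM_conj Z : Z - conjM Z = Complex 0 2 *: toC (ImM Z).
Proof.
apply/matrixP => i j; rewrite !mxE; case: (Z i j) => a b /=; rewrite conjC_complex.
by apply/eqP; rewrite eq_complex /=; apply/andP; split; apply/eqP; ring.
Qed.

Lemma mulRe_Im (z : 'cV[C]_n) :
  z = map_mx (real_complex R) (map_mx (@complex.Re R) z)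
    + Complex 0 1 *: map_mx (real_complex R) (map_mx (@complex.Im R) z).
Proof. by apply/matrixP => i j; rewrite !mxE; exact: complexEi. Qed.

(** The mixed terms in the real and imaginary parts of [z] cancel because [Y] is symmetric. *)
Lemma herm_form (Y : 'M[R]_n) (z : 'cV[C]_n) : Y^T = Y ->
  let x := map_mx (@complex.Re R) z in let y := map_mx (@complex.Im R) z in
  ((conjM z)^T *m toC Y *m z) 0 0 =
  ((x^T *m Y *m x) 0 0 + (y^T *m Y *m y) 0 0)%:C%C.
Proof.
move=> Ys x y.
have zE := mulRe_Im z; rewrite -/x -/y in zE.
have zcE : conjM z = map_mx (real_complex R) x - Complex 0 1 *: map_mx (real_complex R) y.
  apply/matrixP => i j; rewrite !mxE; case: (z i j) => a b /=.
  apply/eqP; rewrite eq_complex /=; apply/andP; split; apply/eqP; ring.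
clearbody x y; rewrite zcE zE /toC raddfB /= linearZ /= !map_trmx.
rewrite !(mulmxDl, mulmxDr, mulNmx) -!scalemxAl -!scalemxAr.
rewrite -!map_mxM.
have E : x^T *m Y *m y = y^T *m Y *m x.
  have tr11 (s : 'M[R]_1) : s^T = s by rewrite (mx11_scalar s) tr_scalar_mx.
  transitivity ((x^T *m Y *m y)^T); first by rewrite tr11.
  by rewrite trmx_mul trmx_mul trmxK Ys; exact: mulmxA.
generalize E; clear E.
generalize (x^T *m Y *m x) (y^T *m Y *m y) (x^T *m Y *m y) (y^T *m Y *m x) => p q r s ->; rewrite !mxE /=.
apply/eqP; rewrite eq_complex /=; apply/andP; split; apply/eqP; ring.
Qed.

Lemma herm_form_gt0 (Y : 'M[R]_n) (z : 'cV[C]_n) : posdef Y -> z != 0 ->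
  exists2 t : R, 0 < t & ((conjM z)^T *m toC Y *m z) 0 0 = t%:C%C.
Proof.
move=> [Ys Yp] z0; rewrite herm_form//; eexists; last by [].
have F (v : 'cV[R]_n) : 0 <= (v^T *m Y *m v) 0 0.
  by have [->|/Yp/ltW//] := eqVneq v 0; rewrite mulmx0 mxE.
set x := map_mx (@complex.Re R) z; set y := map_mx (@complex.Im R) z.
have [x0|/Yp xp] := eqVneq x 0; last by rewrite ltr_wpDr.
have [y0|/Yp yp] := eqVneq y 0; last by rewrite ltr_wpDl.
case/negP: z0; rewrite (mulRe_Im z) -/x -/y x0 y0.
by rewrite !map_mx0 scaler0 addr0.
Qed.

Lemma unitmx_col (K : fieldType) m (A : 'M[K]_m) :
  (forall v : 'cV[K]_m, A *m v = 0 -> v = 0) -> A \in unitmx.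
Proof.
move=> inj; rewrite -unitmx_tr -row_free_unit -kermx_eq0; apply/eqP/row_matrixP => i.
rewrite row0; apply: trmx_inj; rewrite trmx0; apply: inj.
by rewrite -[X in X *m _]trmxK -trmx_mul -row_mul mulmx_ker row0 trmx0.
Qed.

(** A vector [v] killed by [C Z + D] makes the left side of [sympl_pair] at [(conj Z, Z)] vanish on
    [v], whereas the right side is [-2i] times the positive definite form of [Im Z]. *)
Lemma autfactor_unit g Z : symplectic g -> siegel_space Z -> autfactor g Z \in unitmx.
Proof.
move=> sg [Zs Zp]; apply: unitmx_col => v jv0; apply: contrapT => /eqP v0.
have [t t0 tE] := herm_form_gt0 Zp v0.

have := sympl_pair (conjM Z) Z sg.
move=> /(congr1 (fun A => (conjM v)^T *m A *m v)).
rewrite -autfactor_conj -numfactor_conj mulmxBr mulmxBl !mulmxA.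
rewrite -(mulmxA _ (autfactor g Z)) jv0 mulmx0 -trmx_mul -conjM_mul jv0.
have -> : conjM (0 : 'cV[C]_n) = 0 by rewrite /conjM map_mx0.
rewrite trmx0 !mul0mx subr0 -(conjM_tr Z) Zs.
rewrite -(opprB Z) subM_conj mulmxN mulNmx -scalemxAr -scalemxAl -/(conjM v).
move=> /matrixP/(_ 0 0); rewrite [LHS]mxE [RHS]mxE [X in - X]mxE tE => /eqP.
rewrite eq_complex /= !(mul0r, mulr0, subr0, addr0, add0r, oppr0) eqxx /=.
by rewrite eq_sym oppr_eq0 mulf_eq0 pnatr_eq0 /= gt_eqF.
Qed.

Lemma siegel_actE g Z : siegel_act g Z = numfactor g Z *m invmx (autfactor g Z).
Proof. by []. Qed.

Lemma siegel_act1 Z : siegel_act 1%:M Z = Z.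
Proof.
rewrite /siegel_act /autfactor /toC (@scalar_mx_block _ n n 1).
rewrite block_mxKul block_mxKur block_mxKdl block_mxKdr.
by rewrite map_mx0 map_mx1 mul0mx add0r addr0 mul1mx invmx1 mulmx1.
Qed.

Local Opaque conjM siegel_act autfactor numfactor Defs.ImM toC.

Lemma siegel_actM g Z : symplectic g -> siegel_space Z ->
  siegel_act g Z *m autfactor g Z = numfactor g Z.
Proof. by move=> sg /(autfactor_unit sg) u; rewrite siegel_actE mulmxKV. Qed.

(** Stated for invertible automorphy factors rather than for points of the half-space, so that it
    applies to conjugate points, which lie outside it. *)
Lemma siegel_act_pair g Z W : symplectic g ->
  autfactor g Z \in unitmx -> autfactor g W \in unitmx ->
  (autfactor g Z)^T *m ((siegel_act g Z)^T - siegel_act g W) *m autfactor g W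
  = Z^T - W.
Proof.
move=> sg uZ uW; rewrite -(sympl_pair Z W sg) mulmxBr mulmxBl -trmx_mul.
have H V : autfactor g V \in unitmx -> siegel_act g V *m autfactor g V = numfactor g V.
  by move=> u; rewrite siegel_actE mulmxKV.
by rewrite (H Z uZ) -(mulmxA _^T (siegel_act g W)) (H W uW).
Qed.

Lemma siegel_act_sym g Z : symplectic g -> siegel_space Z ->
  (siegel_act g Z)^T = siegel_act g Z.
Proof.
move=> sg sZ; have u := autfactor_unit sg sZ.
have := siegel_act_pair sg u u; rewrite sZ.1 subrr => /(canRL (mulmxK u)).
rewrite mul0mx => /(canRL (mulKmx _)); rewrite unitmx_tr => /(_ u).
by rewrite mulmx0 => /subr0_eq.
Qed.

Lemma siegel_act_sub g Z W : symplectic g -> siegel_space Z -> siegel_space W ->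
  (autfactor g Z)^T *m (siegel_act g Z - siegel_act g W) *m autfactor g W = Z - W.
Proof.
move=> sg sZ sW; rewrite -[in LHS](siegel_act_sym sg sZ) siegel_act_pair ?autfactor_unit//.
by rewrite sZ.1.
Qed.

Lemma siegel_act_Im g Z : symplectic g -> siegel_space Z ->
  (conjM (autfactor g Z))^T *m toC (ImM (siegel_act g Z)) *m autfactor g Z = toC (ImM Z).
Proof.
move=> sg sZ; have u := autfactor_unit sg sZ.
have uc : autfactor g (conjM Z) \in unitmx by rewrite -autfactor_conj conjM_unit.
have := siegel_act_pair sg uc u.

rewrite -(siegel_act_conj g Z) -(conjM_tr (siegel_act g Z)) (siegel_act_sym sg sZ).
rewrite -(conjM_tr Z) sZ.1 -(opprB Z) -(opprB (siegel_act g Z)) !subM_conj.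
rewrite mulmxN mulNmx -scalemxAr -scalemxAl -(autfactor_conj g Z) => /oppr_inj.
apply: scalerI; rewrite eq_complex /= negb_and pnatr_eq0 orbT//.
Qed.

Lemma siegel_act_space g Z : symplectic g -> siegel_space Z ->
  siegel_space (siegel_act g Z).
Proof.
move=> sg sZ; have u := autfactor_unit sg sZ.
split; first exact: siegel_act_sym.
have sI : (ImM (siegel_act g Z))^T = ImM (siegel_act g Z) by rewrite ImM_tr siegel_act_sym.
split => // v v0.
pose vc : 'cV[C]_n := map_mx (real_complex R) v.
(* With [v = j w], [j] the automorphy factor, the form of [Im (g Z)] at [v] becomes the form of
   [Im Z] at [w]. *)
pose w := invmx (autfactor g Z) *m vc.
have vE : vc = autfactor g Z *m w by rewrite /w mulKVmx.
have w0 : w != 0.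
  apply: contra_neq v0 => w0; move: vE; rewrite w0 mulmx0 => /matrixP vE.
  by apply/matrixP => i j; have := vE i j; rewrite !mxE => -[].
have [t t0] := herm_form_gt0 sZ.2 w0.
rewrite -(siegel_act_Im sg sZ) !mulmxA -trmx_mul -conjM_mul -vE -mulmxA -(mulmxA _ _ w) -vE.
rewrite herm_form// => /complexI tE.
have Rv : map_mx (@complex.Re R) vc = v by apply/matrixP => i j; rewrite !mxE.
have Iv : map_mx (@complex.Im R) vc = 0 by apply/matrixP => i j; rewrite !mxE.
by move: tE; rewrite Rv Iv mulmx0 [X in _ + X]mxE addr0 => ->.
Qed.

Lemma det_toC (A : 'M[R]_n) : \det (toC A) = (\det A)%:C%C.
Proof. exact: det_map_mx. Qed.

Lemma det_conjM (A : 'M[C]_n) : \det (conjM A) = Num.conj (\det A).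
Proof. exact: det_map_mx. Qed.

(** This relation makes [det(Y)^k |f|^2] invariant when [f] is modular of weight [k]. *)
Lemma det_siegel_act_Im g Z : symplectic g -> siegel_space Z ->
  cabs (\det (autfactor g Z)) ^+ 2 * \det (ImM (siegel_act g Z)) = \det (ImM Z).
Proof.
move=> sg sZ; have := congr1 determinant (siegel_act_Im sg sZ).
rewrite !det_mulmx det_tr !det_toC det_conjM => E.
apply: complexI; rewrite -E rmorphM rmorphXn /= cabsE normCK; ring.
Qed.

Lemma autfactorM g h Z : symplectic h -> siegel_space Z ->
  autfactor (g *m h) Z = autfactor g (siegel_act h Z) *m autfactor h Z.
Proof.
move=> sh sZ.
have : gC (g *m h) *m col_mx Z 1%:M =
    gC g *m col_mx (siegel_act h Z) 1%:M *m autfactor h Z.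
  rewrite /gC map_mxM -!/(gC _) -mulmxA gCE -mulmxA mul_col_mx mul1mx.
  by rewrite siegel_actM.
by rewrite !gCE mul_col_mx => /eq_col_mx[].
Qed.

Lemma numfactorM g h Z : symplectic h -> siegel_space Z ->
  numfactor (g *m h) Z = numfactor g (siegel_act h Z) *m autfactor h Z.
Proof.
move=> sh sZ.
have : gC (g *m h) *m col_mx Z 1%:M =
    gC g *m col_mx (siegel_act h Z) 1%:M *m autfactor h Z.
  rewrite /gC map_mxM -!/(gC _) -mulmxA gCE -mulmxA mul_col_mx mul1mx.
  by rewrite siegel_actM.
by rewrite !gCE mul_col_mx => /eq_col_mx[].
Qed.

Lemma siegel_act_mul g h Z : symplectic g -> symplectic h -> siegel_space Z ->
  siegel_act (g *m h) Z = siegel_act g (siegel_act h Z).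
Proof.
move=> sg sh sZ.
have shZ := siegel_act_space sh sZ.
have ug := autfactor_unit sg shZ; have uh := autfactor_unit sh sZ.
have u : autfactor (g *m h) Z \in unitmx by rewrite (autfactorM g sh sZ) unitmx_mul ug.
apply: (can_inj (mulmxK u)).

rewrite {1}siegel_actE (mulmxKV u) (numfactorM g sh sZ) (autfactorM g sh sZ) mulmxA.
by rewrite (siegel_actM sg shZ).
Qed.

Lemma symplecticM g h : symplectic g -> symplectic h -> symplectic (g *m h).
Proof.
rewrite /symplectic /= -/(sympl_J R) => sg sh; rewrite trmx_mul.
have -> : h^T *m g^T *m sympl_J R *m (g *m h) = h^T *m (g^T *m sympl_J R *m g) *m h.
  by rewrite !mulmxA.
by rewrite sg.
Qed.

Lemma symplectic_unit g : symplectic g -> g \in unitmx.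
Proof.
rewrite /symplectic /= -/(sympl_J R) => /(congr1 (fun A => - sympl_J R *m A)).
have -> : - sympl_J R *m sympl_J R = 1%:M.
  rewrite /sympl_J opp_block_mx mulmx_block !oppr0 opprK !(mulmx0, mul0mx, mulNmx, mulmxN, mulmx1, mul1mx, addr0, add0r, opprK).
  by rewrite oppr0 -(@scalar_mx_block _ n n 1).
by rewrite mulmxA => /mulmx1_unit[].
Qed.

Lemma symplecticV g : symplectic g -> symplectic (invmx g).
Proof.
move=> sg; have u := symplectic_unit sg.
rewrite /symplectic /= -{1}sg !mulmxA -trmx_mul mulmxV// trmx1 mul1mx.
by rewrite mulmxK.
Qed.

Lemma siegel_actK g Z : symplectic g -> siegel_space Z ->
  siegel_act (invmx g) (siegel_act g Z) = Z.
Proof.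
move=> sg sZ; rewrite -siegel_act_mul//; last exact: symplecticV.
by rewrite mulVmx ?siegel_act1// symplectic_unit.
Qed.

Lemma siegel_actKV g Z : symplectic g -> siegel_space Z ->
  siegel_act g (siegel_act (invmx g) Z) = Z.
Proof.
move=> sg sZ; rewrite -siegel_act_mul//; last exact: symplecticV.
by rewrite mulmxV ?siegel_act1// symplectic_unit.
Qed.

End SiegelAction.

(** * Generators of the symplectic group *)

Section SymGen.
Context (K : realFieldType).

Lemma dotmx_ge0 m (v : 'cV[K]_m) : 0 <= (v^T *m v) 0 0.
Proof. by rewrite mxE sumr_ge0// => i _; rewrite mxE -expr2 sqr_ge0. Qed.

Lemma dotmx_gt0 m (v : 'cV[K]_m) : v != 0 -> 0 < (v^T *m v) 0 0.
Proof.
move=> v0; rewrite lt_neqAle dotmx_ge0 andbT eq_sym; apply: contra_neq v0.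
rewrite mxE => /psumr_eq0P E; apply/matrixP => i j; rewrite ord1 mxE; apply/eqP.
have := E _ i isT; rewrite mxE -expr2 => /(_ _)/eqP; rewrite sqrf_eq0; apply.
by move=> k _; rewrite mxE -expr2 sqr_ge0.
Qed.

Definition lower_unip m (w : 'cV[K]_m) : 'M[K]_(1 + m) := block_mx 1 0 w 1%:M.

(* L(w) is the quotient of two symmetric matrices with vanishing corner entry *)
Lemma lower_unip_sym m (P : 'M[K]_(1 + m) -> Prop) :
  (forall S, S^T = S -> S \in unitmx -> P S) ->
  (forall A B, A \in unitmx -> B \in unitmx -> P A -> P B -> P (A *m B)) ->
  forall w, P (lower_unip w) /\ P (lower_unip w)^T.
Proof.
move=> Psym Pmul w; rewrite /lower_unip.
have [->|w0] := eqVneq w 0.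
  rewrite -(@scalar_mx_block _ 1 m 1) tr_scalar_mx.
  by split; apply: Psym; rewrite ?tr_scalar_mx ?unitmx1.
(* A sum of squares, hence nonzero over an ordered field; this is what makes the bordered matrix
   [S2] invertible, with explicit inverse [V2]. *)
pose s := (w^T *m w) 0 0.
have sE : w^T *m w = s%:M by rewrite [LHS]mx11_scalar.
have s0 : s != 0 by rewrite gt_eqF ?dotmx_gt0.
pose S2 : 'M[K]_(1 + m) := block_mx 0 w^T w 1%:M.
pose S1 : 'M[K]_(1 + m) := block_mx 0 w^T w (w *m w^T + 1%:M).
pose V2 : 'M[K]_(1 + m) :=
  block_mx (- s^-1)%:M (s^-1 *: w^T) (s^-1 *: w) (1%:M - s^-1 *: (w *m w^T)).
have S2V : S2 *m V2 = 1%:M.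
  rewrite mulmx_block !mul0mx !add0r !mul1mx mulmxBr mulmx1.
  rewrite -!scalemxAr sE mulmxA sE mul_scalar_mx !scalerA mulVf// scale1r subrr.
  rewrite mul_mx_scalar scaleNr addNr addrCA subrr addr0.
  by rewrite scale_scalar_mx mulVf// -(@scalar_mx_block _ 1 m 1).
have S2u : S2 \in unitmx by have [] := mulmx1_unit S2V.
have S2s : S2^T = S2 by rewrite tr_block_mx trmxK trmx1 trmx0.
have S1E : block_mx 1 0 w 1%:M *m S2 = S1.
  by rewrite mulmx_block !(mulmx0, mul0mx, mul1mx, add0r, addr0, mulmx1).
have Lu : (block_mx 1 0 w 1%:M : 'M[K]_(1 + m)) \in unitmx.
  by rewrite unitmxE det_lblock !det1 mulr1 unitr1.
have S1s : S1^T = S1.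
  by rewrite tr_block_mx trmxK trmx0 raddfD /= trmx1 trmx_mul trmxK.
have S1u : S1 \in unitmx by rewrite -S1E unitmx_mul Lu.
have LE : block_mx 1 0 w 1%:M = S1 *m invmx S2 by rewrite -S1E mulmxK.
have Vs : (invmx S2)^T = invmx S2 by rewrite trmx_inv S2s.
have Vu : invmx S2 \in unitmx by rewrite unitmx_inv.
rewrite LE trmx_mul S1s Vs.
by split; apply: (Pmul) => //; apply: Psym.
Qed.

(** Invertible matrices are products of symmetric ones. Gaussian elimination: a transposition,
    itself symmetric, brings a nonzero pivot into the corner; what remains is a lower unipotent, a
    block diagonal and an upper unipotent factor, and the induction handles the Schur complement
    [D']. *)
Lemma unitmx_sym_ind m (P : 'M[K]_m -> Prop) :
  (forall S, S^T = S -> S \in unitmx -> P S) ->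
  (forall A B, A \in unitmx -> B \in unitmx -> P A -> P B -> P (A *m B)) ->
  forall A, A \in unitmx -> P A.
Proof.
elim: m P => [|m IH] P Psym Pmul A uA.
  by apply: Psym => //; rewrite [LHS]flatmx0 [RHS]flatmx0.
have [i Ai0] : exists i, A i 0 != 0.
  apply: contrapT => H; have Ac : A *m delta_mx 0 0 = 0 :> 'cV_m.+1.
    apply/matrixP => k j; rewrite -colE !mxE; apply/eqP/negbNE/negP => h.
    by apply: H; exists k.
  have /matrixP/(_ 0 0) : delta_mx 0 0 = 0 :> 'cV[K]_m.+1 by rewrite -(mulKmx uA (delta_mx 0 0)) Ac mulmx0.
  by rewrite !mxE !eqxx => /eqP; rewrite oner_eq0.
pose T : 'M[K]_m.+1 := tperm_mx 0 i.
have TT : T *m T = 1%:M by rewrite /T /tperm_mx -perm_mxM perm.tperm2 perm_mx1.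
have uT : T \in unitmx by have [] := mulmx1_unit TT.
have Ts : T^T = T by rewrite /T /tperm_mx tr_perm_mx perm.tpermV.
pose A' : 'M[K]_(1 + m) := T *m A.
have AE : A = T *m A' by rewrite /A' mulmxA TT mul1mx.
have uA' : A' \in unitmx by rewrite unitmx_mul uT.
rewrite AE; apply: (Pmul) => //; first exact: Psym.
have a0 : A' 0 0 != 0 by rewrite /A' -xrowE !mxE perm.tpermL.
pose a := A' 0 0; pose b := ursubmx A'; pose c := dlsubmx A'; pose D := drsubmx A'.
have ulE : ulsubmx A' = a%:M.
  rewrite [LHS]mx11_scalar /a; clearbody A'; congr _%:M; rewrite [LHS]mxE [LHS]mxE.
  by congr (A' _ _); apply/val_inj.
pose D' := D - a^-1 *: (c *m b).
have A'E : A' = lower_unip (a^-1 *: c) *m (block_mx a%:M 0 0 1%:M *m block_mx 1 0 0 D') *m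
     (lower_unip (a^-1 *: b^T))^T.
  rewrite -[LHS]submxK ulE -/b -/c -/D /lower_unip tr_block_mx !trmx1 trmx0 linearZ /= trmxK.
  rewrite !mulmx_block !(mulmx0, mul0mx, mul1mx, add0r, addr0, mulmx1).
  rewrite mul_mx_scalar scalerA divff// scale1r mul_scalar_mx scalerA divff// scale1r.
  by rewrite -scalemxAr addrC subrK.
have uL w : (lower_unip w : 'M[K]_(1 + m)) \in unitmx.
  by rewrite unitmxE det_lblock !det1 mulr1 unitr1.
have uM1 : (block_mx a%:M 0 0 1%:M : 'M[K]_(1 + m)) \in unitmx.
  by rewrite unitmxE det_lblock det_scalar1 det1 mulr1 unitfE.
have uM2 : (block_mx 1 0 0 D' : 'M[K]_(1 + m)) \in unitmx.
  by move: uA'; rewrite A'E !unitmx_mul unitmx_tr !uL uM1 /= andbT.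
have uD' : D' \in unitmx by move: uM2; rewrite !unitmxE det_lblock det1 mul1r.
rewrite A'E; have Lw := lower_unip_sym Psym Pmul.
apply: (Pmul); rewrite ?unitmx_mul ?unitmx_tr ?uL ?uM1//; last exact: (Lw _).2.
apply: (Pmul); rewrite ?unitmx_mul ?unitmx_tr ?uL ?uM1//; first exact: (Lw _).1.
apply: (Pmul) => //.
  by apply: (Psym) => //; rewrite (@tr_block_mx _ 1 m 1 m) tr_scalar_mx !trmx0 trmx1.
pose P' (B : 'M[K]_m) := P (block_mx 1 0 0 B : 'M[K]_(1 + m)).
suff : P' D' by [].
apply: (IH P') => //; rewrite /P'.
- move=> S Ss Su; apply: (Psym); first by rewrite (@tr_block_mx _ 1 m 1 m) Ss !trmx0 trmx1.
  by rewrite unitmxE (@det_lblock _ 1 m) det1 mul1r -unitmxE.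
- move=> B1 B2 u1 u2 P1 P2.
  have -> : (block_mx 1 0 0 (B1 *m B2) : 'M[K]_(1 + m)) = block_mx 1 0 0 B1 *m block_mx 1 0 0 B2.
    by rewrite mulmx_block !(mulmx0, mul0mx, mul1mx, add0r, addr0, mulmx1).
  by apply: (Pmul) => //; rewrite unitmxE (@det_lblock _ 1 m) det1 mul1r -unitmxE.
Qed.

End SymGen.

Section SpGen.
Context (R : realType) (n : nat).
Local Notation C := R[i].
Implicit Types (S A : 'M[R]_n) (g h : 'M[R]_(n + n)).

Definition sp_trans S : 'M[R]_(n + n) := block_mx 1%:M S 0 1%:M.
Definition sp_low S : 'M[R]_(n + n) := block_mx 1%:M 0 S 1%:M.
Definition sp_levi A : 'M[R]_(n + n) := block_mx A 0 0 (invmx A)^T.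
(** For a symmetric idempotent [e], an inversion in the directions of its image only: [e = 1] is the
    full inversion [Z -> - Z^-1], a diagonal matrix unit gives the inversion in one diagonal
    entry. *)
Definition sp_pinv_mx (e : 'M[R]_n) : 'M[R]_(n + n) :=
  block_mx (1%:M - e) (- e) e (1%:M - e).
Definition sp_pinv (l : 'I_n) : 'M[R]_(n + n) := sp_pinv_mx (delta_mx l l).

(** The generators are chosen for the measure: the Jacobians of translations and of inversions in
    one diagonal entry can be computed one complex coordinate at a time. *)
Inductive spgen : 'M[R]_(n + n) -> Prop :=
| spgen_trans S : S^T = S -> spgen (sp_trans S)
| spgen_pinv l : spgen (sp_pinv l)
| spgen_mul g h : spgen g -> spgen h -> spgen (g *m h).

Local Ltac mxs := rewrite ?(mulmx_block, mulmx0, mul0mx, mul1mx, add0r, addr0, mulmx1, mulmxN, mulNmx, opprK, oppr0, subr0).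

Lemma sp_trans0 : sp_trans 0 = 1%:M.
Proof. by rewrite /sp_trans -(@scalar_mx_block _ n n 1). Qed.

Lemma sp_transD S S' : sp_trans S *m sp_trans S' = sp_trans (S + S').
Proof. by rewrite /sp_trans; mxs; rewrite addrC. Qed.

Lemma spgen1 : spgen 1%:M.
Proof. by rewrite -sp_trans0; apply: spgen_trans; rewrite trmx0. Qed.

(** Partial inversions for orthogonal idempotents multiply to the one for their sum; over all
    indices this yields the full inversion. *)
Lemma spgen_pinv_mx (s : seq 'I_n) : uniq s ->
  spgen (sp_pinv_mx (\sum_(i <- s) delta_mx i i)).
Proof.
elim: s => [_|l s IH /= /andP[ls us]].
  rewrite big_nil /sp_pinv_mx; mxs; rewrite -(@scalar_mx_block _ n n 1); exact: spgen1.
rewrite big_cons; set e := \sum_(i <- s) _ in IH *.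
have le : delta_mx l l *m e = 0.
  rewrite /e mulmx_sumr big_seq big1// => i si.
  by rewrite mul_delta_mx_0//; apply: contraNneq ls => ->.
have -> : sp_pinv_mx (delta_mx l l + e) = sp_pinv l *m sp_pinv_mx e.
  rewrite /sp_pinv /sp_pinv_mx; set d := delta_mx l l in le *.
  rewrite mulmx_block !(mulmxBl, mulmxBr, mulmxN, mulNmx, mul1mx, mulmx1) le.
  by congr block_mx; apply/matrixP => i j; rewrite !mxE; ring.
by apply: spgen_mul; [exact: spgen_pinv|exact: IH].
Qed.

Definition sp_inv : 'M[R]_(n + n) := block_mx 0 (- 1%:M) 1%:M 0.

Lemma spgen_inv : spgen sp_inv.
Proof.
have := spgen_pinv_mx (enum_uniq 'I_n).
rewrite big_enum /= -mx1_sum_delta /sp_pinv_mx subrr//.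
Qed.

Lemma spgen_low S : S^T = S -> spgen (sp_low S).
Proof.
(* Conjugation of a translation by the inversion, which has order four, so that its cube is its
   inverse. *)
move=> Ss; have -> : sp_low S = sp_inv *m sp_trans (- S) *m (sp_inv *m sp_inv *m sp_inv).
  by rewrite /sp_inv /sp_trans /sp_low; mxs.
have H := spgen_inv; do ?apply: spgen_mul => //.
by apply: spgen_trans; rewrite linearN /= Ss.
Qed.

(** For symmetric [S] the identity of SL_2 that writes a diagonal matrix through unipotents and the
    inversion still makes sense; products of symmetric matrices then give every invertible
    matrix. *)
Lemma spgen_levi A : A \in unitmx -> spgen (sp_levi A).
Proof.
move: A; apply: unitmx_sym_ind => [S Ss Su|A B uA uB IA IB].
  have -> : sp_levi S = sp_trans S *m sp_low (- invmx S) *m sp_trans S *m sp_inv.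
    rewrite /sp_inv /sp_trans /sp_low /sp_levi; mxs; rewrite mulmxV// mulVmx// trmx_inv Ss.
    by mxs; rewrite subrr addNr; mxs.
  have H := spgen_inv; do ?apply: spgen_mul => //; try exact: spgen_trans.
  by apply: spgen_low; rewrite linearN /= trmx_inv Ss.
have -> : sp_levi (A *m B) = sp_levi A *m sp_levi B.
  rewrite /sp_levi; mxs; rewrite -trmx_mul; congr block_mx; congr trmx.
  apply: (can_inj (mulmxK (_ : A *m B \in unitmx))); first by rewrite unitmx_mul uA.
  rewrite mulVmx ?unitmx_mul ?uA// !mulmxA mulmxKV// mulVmx//.
exact: spgen_mul.
Qed.

Lemma symplectic_blocks g : symplectic g ->
  [/\ (ulsubmx g)^T *m dlsubmx g = (dlsubmx g)^T *m ulsubmx g,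
      (ursubmx g)^T *m drsubmx g = (drsubmx g)^T *m ursubmx g &
      (ulsubmx g)^T *m drsubmx g - (dlsubmx g)^T *m ursubmx g = 1%:M].
Proof.

rewrite /symplectic /= -{1 2}[g]submxK tr_block_mx; mxs => /eq_block_mx[E1 E2 _ E4].
split.
- by apply/eqP; rewrite -subr_eq0 addrC E1.
- by apply/eqP; rewrite -subr_eq0 addrC E4.
- by rewrite addrC E2.
Qed.

Lemma symplectic_trans S : S^T = S -> symplectic (sp_trans S).
Proof.
move=> Ss; rewrite /symplectic /= /sp_trans tr_block_mx !trmx1 trmx0 Ss.
mxs; congr block_mx; apply/matrixP => i j; rewrite !mxE; ring.
Qed.

Lemma symplectic_pinv l : symplectic (sp_pinv l).
Proof.
rewrite /symplectic /= /sp_pinv /sp_pinv_mx tr_block_mx.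
set e := delta_mx l l.
have eT : e^T = e by rewrite trmx_delta.
have E : e *m e = e by rewrite mul_delta_mx.
rewrite !linearB /= !linearN /= !trmx1 eT.
rewrite !mulmx_block !(mulmxBl, mulmxBr, mulmxN, mulNmx, mul1mx, mulmx1, mul0mx, mulmx0, mulmxDl) E.
by congr block_mx; apply/matrixP => i j; rewrite !mxE; ring.
Qed.

Lemma spgen_symplectic g : spgen g -> symplectic g.
Proof.
elim=> [S|l|g1 g2 _ s1 _ s2]; [exact: symplectic_trans|exact: symplectic_pinv|exact: symplecticM].
Qed.

(** Block elimination on the open cell: with [D] invertible, [g] is the translation by [B D^-1],
    times a Levi element, times the lower unipotent with entry [D^-1 C]. The symplectic relations
    make both unipotent entries symmetric. *)
Lemma spgen_dunit g : symplectic g -> drsubmx g \in unitmx -> spgen g.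
Proof.
move=> sg uD; have [EAC EBD EAD] := symplectic_blocks sg.
rewrite -[g]submxK.
set A := ulsubmx g in EAC EBD EAD *; set B := ursubmx g in EAC EBD EAD *.
set c := dlsubmx g in EAC EBD EAD *; set D := drsubmx g in uD EAC EBD EAD *.
pose S := B *m invmx D.
have uDT : D^T \in unitmx by rewrite unitmx_tr.
have DVT : (invmx D)^T = invmx D^T by rewrite trmx_inv.
have Ss : S^T = S.
  rewrite /S trmx_mul DVT; apply: (can_inj (mulKmx uDT)).
  by rewrite mulKVmx// mulmxA -EBD mulmxK.
have AE : A = invmx D^T + S *m c.
  apply: (can_inj (mulKmx uDT)); rewrite mulmxDr mulmxV// -Ss /S trmx_mul DVT.
  rewrite -mulmxA mulKVmx//; apply: trmx_inj.
  by rewrite raddfD /= !trmx_mul !trmxK trmx1 -EAD subrK.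
pose L := invmx D *m c.
have Ls : L^T = L.
  move: EAC; rewrite AE raddfD /= trmx_mul Ss mulmxDl mulmxDr !mulmxA.
  by move/addIr; rewrite -trmx_inv trmxK /L trmx_mul => ->; rewrite trmx_inv.
have -> : block_mx A B c D = sp_trans S *m sp_levi (invmx D)^T *m sp_low L.
  rewrite /sp_trans /sp_levi /sp_low; mxs.
  have -> : (invmx (invmx D)^T)^T = D by rewrite DVT invmxK trmxK.
  by rewrite -(mulmxA S) /L mulKVmx// DVT -AE /S mulmxKV.
apply: spgen_mul; last exact: spgen_low.
apply: spgen_mul; first exact: spgen_trans.
by apply: spgen_levi; rewrite unitmx_tr unitmx_inv.
Qed.

Lemma siegel_i : siegel_space ((Complex 0 1)%:M : 'M[C]_n).
Proof.
split; first by rewrite tr_scalar_mx.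
have -> : ImM ((Complex 0 1)%:M : 'M[C]_n) = 1%:M.
  by apply/matrixP => i j; rewrite !mxE; case: eqP.
split; first by rewrite trmx1.
by move=> v v0; rewrite mulmx1 dotmx_gt0.
Qed.

(** The determinant is a real polynomial in the scalar; being nonzero at one complex number, it is
    not the zero polynomial and cannot vanish at all small integers. *)
Lemma exists_det_neq0 (D E : 'M[R]_n) (z : C) :
  \det (toC D *m z%:M + toC E) != 0 -> exists t : R, \det (D *m t%:M + E) != 0.
Proof.
move=> dz.
pose p := \det (map_mx polyC D *m ('X%:M) + map_mx polyC E).
have pE t : p.[t] = \det (D *m t%:M + E).
  rewrite -[LHS]/(horner_eval t p) /p -det_map_mx map_mxD map_mxM map_scalar_mx /=.
  congr (\det (_ *m _%:M + _)); first by apply/matrixP => i j; rewrite !mxE /horner_eval hornerC.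
    by rewrite /horner_eval hornerX.
  by apply/matrixP => i j; rewrite !mxE /horner_eval hornerC.
have p0 : p != 0.
  apply: contra_neq dz => p0.
  pose phi : {rmorphism {poly R} -> C} := horner_eval z \o map_poly (real_complex R).
  have : phi p = 0 by rewrite p0 /phi /= rmorph0 /horner_eval horner0.
  have phiC (A : 'M[R]_n) : map_mx phi (map_mx polyC A) = toC A.
    by apply/matrixP => i j; rewrite !mxE /= map_polyC /horner_eval hornerC.
  rewrite /p -(det_map_mx phi) map_mxD map_mxM map_scalar_mx !phiC => <-.
  by rewrite /= map_polyX /horner_eval hornerX.
apply: contrapT => H; case/negP: p0; apply/eqP.
apply: (@roots_geq_poly_eq0 _ _ [seq k%:R | k <- iota 0 (size p)]).
- apply/allP => _ /mapP[k _ ->]; apply/rootP; rewrite pE.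
  by apply/eqP/negbNE/negP => h; apply: H; exists k%:R.
- by rewrite map_inj_uniq ?iota_uniq//; apply: mulrIn; rewrite oner_neq0.
- by rewrite size_map size_iota.
Qed.

(** Since [C i + D] is invertible, [C t + D] is invertible for some real [t]; so [g] followed on the
    right by a translation by [t] lies in the open cell. *)
Lemma symplectic_spgen g : symplectic g -> spgen g.
Proof.
move=> sg; have := autfactor_unit sg siegel_i.
rewrite unitmxE unitfE => /exists_det_neq0[t dt].
have tS (s : R) : (s%:M : 'M[R]_n)^T = s%:M by rewrite tr_scalar_mx.
have -> : g = g *m sp_trans t%:M *m sp_trans (- t)%:M.
  rewrite -mulmxA sp_transD; have -> : t%:M + (- t)%:M = 0 :> 'M[R]_n.
    by rewrite -raddfD /= subrr raddf0.
  by rewrite sp_trans0 mulmx1.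
apply: spgen_mul; last exact: spgen_trans.
apply: spgen_dunit; first by apply: symplecticM => //; exact: symplectic_trans.
rewrite unitmxE unitfE -[g in g *m _]submxK /sp_trans mulmx_block block_mxKdr.
by rewrite mulmx1.
Qed.

End SpGen.

(** * Positive definite matrices and estimates near the base point *)

Section Cholesky.
Context (K : rcfType).

Lemma posdef_block m (a : K) (b : 'cV[K]_m) (Y : 'M[K]_m) (M : 'M[K]_(1 + m)) :
  M = block_mx a%:M b^T b Y -> M^T = M ->
  (forall v : 'cV[K]_(1 + m), v != 0 -> 0 < (v^T *m M *m v) 0 0) ->
  [/\ 0 < a, Y^T = Y & forall v : 'cV[K]_m, v != 0 ->
     0 < (v^T *m (Y - a^-1 *: (b *m b^T)) *m v) 0 0].
Proof.
move=> -> MT H.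
have a0 : 0 < a.
  have := H (col_mx 1%:M 0); rewrite tr_col_mx mul_row_block !trmx1 !trmx0 !mul1mx !mul0mx !addr0.
  rewrite mul_row_col mulmx0 addr0 mulmx1 mxE eqxx mulr1n; apply.
  apply/eqP => /(congr1 usubmx); rewrite col_mxKu linear0 => /matrixP/(_ 0 0)/eqP.
  by rewrite !mxE ?eqxx ?mulr1n oner_eq0.
have YT : Y^T = Y.
  by move: MT; rewrite tr_block_mx trmxK => /eq_block_mx[].
split => // v v0.
pose w : 'cV[K]_(1 + m) := col_mx (- a^-1 *: (b^T *m v)) v.
have w0 : w != 0.
  apply: contra v0 => /eqP/(congr1 dsubmx); rewrite col_mxKd linear0 => ->.
  exact: eqxx.
have := H w w0; rewrite /w tr_col_mx mul_row_block mul_row_col.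
have -> : (- a^-1 *: (b^T *m v))^T = - a^-1 *: (v^T *m b).
  apply/matrixP => i j; rewrite !mxE; congr (_ * _).
  by apply: eq_bigr => k _; rewrite !mxE mulrC.
set x := v^T *m b; have xT : b^T *m v = x^T by rewrite /x trmx_mul trmxK.
rewrite xT mul_mx_scalar scalerA mulrN mulfV ?gt_eqF// scaleN1r addNr mul0mx add0r.
suff -> : v^T *m (Y - a^-1 *: (b *m b^T)) = - a^-1 *: x *m b^T + v^T *m Y by [].
by rewrite mulmxBr -scalemxAr mulmxA addrC scaleNr mulNmx -scalemxAl.
Qed.

Lemma cholesky_step m (x : K) (b : 'cV[K]_m) (A D : 'M[K]_m) : x != 0 ->
  D - (x * x)^-1 *: (b *m b^T) = A *m A^T ->
  let B := block_mx x%:M 0 (x^-1 *: b) A in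
  B *m B^T = block_mx (x * x)%:M b^T b D.
Proof.
move=> x0 AE /=; rewrite tr_block_mx mulmx_block !trmx0 !mul0mx !mulmx0 !addr0 tr_scalar_mx -scalar_mxM.
have -> : (x^-1 *: b)^T = x^-1 *: b^T by apply/matrixP => i j; rewrite !mxE.
rewrite mul_scalar_mx mul_mx_scalar !scalerA mulfV// !scale1r.
by rewrite -scalemxAl -scalemxAr scalerA -invfM -AE addrC subrK.
Qed.

Lemma cholesky m (Y : 'M[K]_m) : Y^T = Y ->
  (forall v : 'cV[K]_m, v != 0 -> 0 < (v^T *m Y *m v) 0 0) ->
  exists2 A : 'M[K]_m, A \in unitmx & Y = A *m A^T.
Proof.
elim: m Y => [|m IH] Y YT YP.
  by exists 1%:M; [exact: unitmx1|apply/matrixP => -[]].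
pose M : 'M[K]_(1 + m) := Y.
have YE : M = block_mx (M 0 0)%:M (dlsubmx M)^T (dlsubmx M) (drsubmx M).
  rewrite -[LHS]submxK; congr block_mx.
  - apply/matrixP => i j; rewrite !mxE !ord1 eqxx mulr1n; congr (M _ _); exact: val_inj.
  - by rewrite trmx_dlsub (YT : M^T = M).
have [a0 DT SP] := posdef_block YE YT YP.
set a := M 0 0 in YE a0 SP; set b := dlsubmx M in YE SP; set D := drsubmx M in YE DT SP.
have ST : (D - a^-1 *: (b *m b^T))^T = D - a^-1 *: (b *m b^T).
  by rewrite linearB linearZ /= trmx_mul trmxK DT.
have [A Au AE] := IH _ ST SP.
have sa : Num.sqrt a * Num.sqrt a = a by rewrite -expr2 sqr_sqrtr// ltW.
have sa0 : Num.sqrt a != 0 by rewrite gt_eqF// sqrtr_gt0.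
pose B : 'M[K]_(1 + m) := block_mx (Num.sqrt a)%:M 0 ((Num.sqrt a)^-1 *: b) A.
exists B.
  have dB : \det B = \det ((Num.sqrt a)%:M : 'M[K]_1) * \det A by exact: det_lblock.
  by rewrite unitmxE dB unitrM -(unitmxE A) Au det_scalar1 unitfE sa0.
have -> : Y = M by [].
by rewrite YE; apply/esym; have := cholesky_step (b := b) (A := A) (D := D) sa0; rewrite /= sa; apply.
Qed.

End Cholesky.

Section Nrm.
Context (R : realType).
Local Notation C := R[i].

(** The entrywise norm is chosen because it is submultiplicative, is unchanged by transposition and
    conjugation, and dominates every eigenvalue. *)
Definition nrm m p (A : 'M[C]_(m, p)) : R := \sum_i \sum_j cabs (A i j).

Lemma nrm_ge0 m p (A : 'M[C]_(m, p)) : 0 <= nrm A.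
Proof. by apply: sumr_ge0 => i _; apply: sumr_ge0 => j _; exact: cabs_ge0. Qed.

Lemma nrm_entry m p (A : 'M[C]_(m, p)) i j : cabs (A i j) <= nrm A.
Proof.
rewrite /nrm (bigD1 i)//= (bigD1 j)//= -addrA lerDl addr_ge0//.
  by apply: sumr_ge0 => k _; exact: cabs_ge0.
by apply: sumr_ge0 => k _; apply: sumr_ge0 => l _; exact: cabs_ge0.
Qed.

Lemma nrmD m p (A B : 'M[C]_(m, p)) : nrm (A + B) <= nrm A + nrm B.
Proof.
rewrite /nrm -big_split /=; apply: ler_sum => i _; rewrite -big_split /=.
by apply: ler_sum => j _; rewrite mxE cabsD.
Qed.

Lemma nrmZ m p a (A : 'M[C]_(m, p)) : nrm (a *: A) = cabs a * nrm A.
Proof.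
rewrite /nrm mulr_sumr; apply: eq_bigr => i _; rewrite mulr_sumr.
by apply: eq_bigr => j _; rewrite mxE cabsM.
Qed.

Lemma nrmN m p (A : 'M[C]_(m, p)) : nrm (- A) = nrm A.
Proof. by rewrite -scaleN1r nrmZ cabsN cabs1 mul1r. Qed.

Lemma nrmB m p (A B : 'M[C]_(m, p)) : nrm (A - B) <= nrm A + nrm B.
Proof. by rewrite -(nrmN B) nrmD. Qed.

Lemma nrmM m p q (A : 'M[C]_(m, p)) (B : 'M[C]_(p, q)) : nrm (A *m B) <= nrm A * nrm B.
Proof.
rewrite /nrm mulr_suml; apply: ler_sum => i _.
apply: (@le_trans _ _ (\sum_j \sum_k cabs (A i k) * cabs (B k j))).
  apply: ler_sum => j _; rewrite mxE; apply: le_trans (cabs_sum _ _ _) _.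
  by apply: ler_sum => k _; rewrite cabsM.
rewrite exchange_big /= mulr_suml; apply: ler_sum => k _.
rewrite -mulr_sumr ler_wpM2l ?cabs_ge0// (bigD1 k)//= lerDl.
by apply: sumr_ge0 => l _; apply: sumr_ge0 => j _; exact: cabs_ge0.
Qed.

Lemma nrm_tr m p (A : 'M[C]_(m, p)) : nrm A^T = nrm A.
Proof.
by rewrite /nrm exchange_big /=; apply: eq_bigr => i _; apply: eq_bigr => j _; rewrite mxE.
Qed.

Lemma nrm_conj m p (A : 'M[C]_(m, p)) : nrm (conjM A) = nrm A.
Proof. by apply: eq_bigr => i _; apply: eq_bigr => j _; rewrite mxE cabs_conj. Qed.

Lemma nrm_le n (A : 'M[C]_n) e : (forall i j, cabs (A i j) <= e) -> nrm A <= (n ^ 2)%:R * e.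
Proof.
move=> H; apply: (@le_trans _ _ (\sum_(i < n) \sum_(j < n) e)).
  by apply: ler_sum => i _; apply: ler_sum => j _.
by rewrite !sumr_const !card_ord -mulrnA mulr_natl.
Qed.

Lemma nrm_scalar n (a : C) : nrm (a%:M : 'M[C]_n) = n%:R * cabs a.
Proof.
rewrite /nrm (eq_bigr (fun=> cabs a)) ?sumr_const ?card_ord ?mulr_natl// => i _.
rewrite (bigD1 i)//= mxE eqxx mulr1n big1 ?addr0// => j ji.
by rewrite mxE eq_sym (negbTE ji) mulr0n cabs0.
Qed.

Lemma nrm_eq0 m p (A : 'M[C]_(m, p)) : nrm A = 0 -> A = 0.
Proof.
move=> A0; apply/matrixP => i j; rewrite mxE; apply/eqP; rewrite -cabs_eq0.
by rewrite eq_le cabs_ge0 -A0 nrm_entry.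
Qed.

Lemma nrm_eigenvalue n (A : 'M[C]_n) a : eigenvalue A a -> cabs a <= nrm A.
Proof.
move=> /eigenvalueP[v vA v0].
have v1 : 0 < nrm v.
  by rewrite lt_neqAle nrm_ge0 andbT eq_sym; apply: contra v0 => /eqP/nrm_eq0 ->.
have := nrmM v A; rewrite vA nrmZ mulrC ler_pM2l//.
Qed.

End Nrm.

Section DetNear1.
Context (R : realType).

(** The two bounds are proved together: adding a factor changes the quadratic remainder by [a i]
    times the linear sum, which therefore has to be controlled as well. *)
Lemma prod1D_bound (I : Type) (s : seq I) (a : I -> R) (e : R) : 0 <= e <= 1 ->
  (forall i, `|a i| <= e) ->
  `|\prod_(i <- s) (1 + a i) - 1 - \sum_(i <- s) a i| <= 4 ^+ size s * e ^+ 2 /\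
  `|\sum_(i <- s) a i| <= (size s)%:R * e.
Proof.
move=> /andP[e0 e1] H; elim: s => [|i s [IH1 IH2]].
  by rewrite !big_nil subrr subr0 normr0 mul0r mulr_ge0// ?sqr_ge0.
rewrite !big_cons; set P := \prod_(j <- s) _ in IH1 *; set S := \sum_(j <- s) _ in IH1 IH2 *.
split; last first.
  by apply: le_trans (ler_normD _ _) _; rewrite /= mulrSr mulrDl mul1r addrC lerD.
have -> : (1 + a i) * P - 1 - (a i + S) = (1 + a i) * (P - 1 - S) + a i * S by ring.
apply: le_trans (ler_normD _ _) _; rewrite !normrM.
have h1 : `|1 + a i| <= 2.
  by apply: le_trans (ler_normD _ _) _; rewrite normr1; have := H i; lra.
have h2 := ler_pM (normr_ge0 _) (normr_ge0 _) h1 IH1.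
have h3 := ler_pM (normr_ge0 _) (normr_ge0 _) (H i) IH2.
have sz : (size s)%:R <= 2 * 4 ^+ size s :> R.
  rewrite -natrX -natrM ler_nat; apply: leq_trans (leq_pmull _ _) => //.
  by apply: ltnW; exact: ltn_expl.
have := ler_wpM2r (sqr_ge0 e) sz; rewrite /= [4 ^+ _.+1]exprS.
by lra.
Qed.

(** The first summand is the error of the identity permutation, the second that of the at most [n!]
    others. *)
Definition det_cst (n : nat) : R := 4 ^+ n + (n`!)%:R * 2 ^+ n.

Lemma det_cst_ge1 n : 1 <= det_cst n.
Proof.
apply: le_trans (_ : 4 ^+ n <= _); first by rewrite exprn_ege1// ler1n.
by rewrite lerDl mulr_ge0// exprn_ge0.
Qed.

(** A permutation other than the identity moves some [i] and also [s i], so its term has two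
    off-diagonal factors of size [e]; the identity contributes the linear term, the trace. *)
Lemma det1D_bound n (E : 'M[R]_n) (e : R) : 0 <= e <= 1 -> (forall i j, `|E i j| <= e) ->
  `|\det (1%:M + E) - 1 - \tr E| <= det_cst n * e ^+ 2.
Proof.
move=> /[dup] e01 /andP[e0 e1] H.
rewrite /determinant (bigD1 1%g)//= odd_perm1 expr0 mul1r.
have -> : \prod_i (1%:M + E) i ((1%g : 'S_n) i) = \prod_i (1 + E i i).
  by apply: eq_bigr => i _; rewrite perm1 !mxE eqxx.
have [h1 _] := prod1D_bound (enum 'I_n) e01 (fun i => H i i).
move: h1; rewrite !big_enum /= -cardE card_ord => h1.
rewrite -addrA -addrA addrA [X in `|X|](_ : _ =
  (\prod_i (1 + E i i) - 1 - \sum_i E i i) + (\sum_(s : 'S_n | s != 1%g) (-1) ^+ s * \prod_i (1%:M + E) i (s i))); last first.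
  by rewrite /mxtrace; ring.
apply: le_trans (ler_normD _ _) _; rewrite /det_cst mulrDl lerD//.
apply: le_trans (ler_norm_sum _ _ _) _.
apply: (@le_trans _ _ (\sum_(s : 'S_n | s != 1%g) 2 ^+ n * e ^+ 2)); last first.
  apply: (@le_trans _ _ (\sum_(s : 'S_n) 2 ^+ n * e ^+ 2)).
    by rewrite [leRHS](bigD1 1%g)//= lerDr mulr_ge0// ?exprn_ge0// sqr_ge0.
  by rewrite sumr_const card_Sn -mulrA mulr_natl.
apply: ler_sum => s s1; rewrite normrMsign normr_prod.
have [i si] : exists i, s i != i.
  apply/existsP; apply: contraR s1; rewrite negb_exists => /forallP h.
  by apply/eqP/permP => i; rewrite perm1; apply/eqP; have := h i; rewrite negbK.
have ssi : s (s i) != s i by rewrite (inj_eq perm_inj).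
rewrite (bigD1 i)//= (bigD1 (s i))//= mulrA.
have off j : s j != j -> `|(1%:M + E) j (s j)| <= e.
  by move=> sj; rewrite !mxE eq_sym (negbTE sj) add0r.
have le2 j : `|(1%:M + E) j (s j)| <= 2.
  rewrite !mxE; apply: le_trans (ler_normD _ _) _; have := H j (s j).
  by case: (_ == _); rewrite ?normr1 ?normr0; lra.
have pr (P : pred 'I_n) : \prod_(j | P j) `|(1%:M + E) j (s j)| <= 2 ^+ n.
  apply: (@le_trans _ _ (\prod_(j | P j) 2)).
    by apply: ler_prod => j _; rewrite normr_ge0 le2.
  rewrite prodr_const; apply: ler_weXn2l; first by rewrite ler1n.
  by apply: leq_trans (max_card _) _; rewrite card_ord.
rewrite [leRHS]mulrC expr2; apply: ler_pM => //.
- by apply: prodr_ge0.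
- by apply: ler_pM => //; exact: off.
Qed.

End DetNear1.

Section PosDef.
Context (R : realType) (n : nat).
Local Notation C := R[i].

Lemma posdef_cong (A Y : 'M[R]_n) : A \in unitmx -> posdef Y -> posdef (A *m Y *m A^T).
Proof.
move=> Au [YT YP]; split; first by rewrite !trmx_mul trmxK YT mulmxA.
move=> v v0; have := YP (A^T *m v); rewrite trmx_mul trmxK !mulmxA; apply.
have ATu : A^T \in unitmx by rewrite unitmx_tr.
apply: contra v0 => /eqP h; rewrite -[v](mulKmx ATu) h mulmx0.
exact: eqxx.
Qed.

Lemma posdefD (X Y : 'M[R]_n) : posdef X -> posdef Y -> posdef (X + Y).
Proof.
move=> [XT XP] [YT YP]; split; first by rewrite linearD /= XT YT.
by move=> v v0; rewrite mulmxDr mulmxDl mxE addr_gt0 ?XP ?YP.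
Qed.

(** From [2 |v_i v_j| <= v_i^2 + v_j^2], summed over all pairs of indices. *)
Lemma quad_bound (E : 'M[R]_n) (v : 'cV[R]_n) (e : R) : (forall i j, `|E i j| <= e) ->
  `|(v^T *m E *m v) 0 0| <= n%:R * e * (v^T *m v) 0 0.
Proof.
move=> H.
have -> : (v^T *m E *m v) 0 0 = \sum_j \sum_i v i 0 * E i j * v j 0.
  by rewrite mxE; apply: eq_bigr => j _; rewrite mxE mulr_suml; apply: eq_bigr => i _; rewrite mxE.
have -> : (v^T *m v) 0 0 = \sum_i v i 0 ^+ 2.
  by rewrite mxE; apply: eq_bigr => i _; rewrite mxE expr2.
apply: le_trans (ler_norm_sum _ _ _) _.
apply: (@le_trans _ _ (\sum_j \sum_i e * ((v i 0 ^+ 2 + v j 0 ^+ 2) / 2))).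
  apply: ler_sum => j _; apply: le_trans (ler_norm_sum _ _ _) _.
  apply: ler_sum => i _; rewrite !normrM mulrAC mulrC.
  apply: ler_pM => //.
  rewrite -normrM ler_norml; have := sqr_ge0 (v i 0 - v j 0); have := sqr_ge0 (v i 0 + v j 0).
  by move=> h1 h2; apply/andP; split; nra.
rewrite le_eqVlt; apply/orP; left; apply/eqP.
under eq_bigr do rewrite -mulr_sumr -mulr_suml big_split /= sumr_const card_ord.
rewrite -mulr_sumr -mulr_suml big_split /= sumr_const card_ord sumrMnl.
set S := \sum_(i < n) _; rewrite -(mulr_natl S n).
have aux (x y z : R) : x * ((y * z + y * z) / 2) = y * x * z by field.
exact: aux.
Qed.

Lemma posdef1D (E : 'M[R]_n) e : E^T = E -> (forall i j, `|E i j| <= e) -> n%:R * e < 1 ->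
  posdef (1%:M + E).
Proof.
move=> ET H ne; split; first by rewrite linearD /= trmx1 ET.
move=> v v0; rewrite mulmxDr mulmx1 mulmxDl mxE.
have := quad_bound v H; rewrite ler_norml => /andP[h _].
have d0 := dotmx_gt0 v0.
apply: lt_le_trans (_ : (v^T *m v) 0 0 - n%:R * e * (v^T *m v) 0 0 <= _); last by rewrite lerD2l.
by rewrite subr_gt0 gtr_pMl.
Qed.

Lemma posdef_det_gt0 (Y : 'M[R]_n) : posdef Y -> 0 < \det Y.
Proof.
move=> [YT YP]; have [A Au ->] := cholesky YT YP.
by rewrite det_mulmx det_tr -expr2 lt_neqAle sqr_ge0 andbT eq_sym sqrf_eq0 -unitfE -unitmxE.
Qed.

(** A point of the half-space is its own automorphy factor under the inversion. *)
Lemma siegel_unit (Z : 'M[C]_n) : siegel_space Z -> Z \in unitmx.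
Proof.
move=> ZH; have := autfactor_unit (spgen_symplectic (spgen_inv R n)) ZH.
rewrite /autfactor /sp_inv block_mxKdl block_mxKdr /toC map_mx1 map_mx0 mul1mx addr0.
exact.
Qed.

Lemma siegelD (Z W : 'M[C]_n) : siegel_space Z -> siegel_space W -> siegel_space (Z + W).
Proof.
move=> [ZT ZP] [WT WP]; split; first by rewrite linearD /= ZT WT.
have -> : ImM (Z + W) = ImM Z + ImM W.
  by apply/matrixP => i j; rewrite !mxE; case: (Z i j) (W i j) => [a b] [c d].
exact: posdefD.
Qed.

Lemma siegel_act_levi (A : 'M[R]_n) Z : A \in unitmx ->
  siegel_act (sp_levi A) Z = toC A *m Z *m toC A^T.
Proof.
move=> Au; rewrite /siegel_act /autfactor /sp_levi !block_mxKul !block_mxKur !block_mxKdl !block_mxKdr.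
rewrite /toC !map_mx0 mul0mx add0r addr0 -map_invmx; congr (_ *m map_mx _ _).
by rewrite -trmx_inv invmxK.
Qed.

End PosDef.

(** * Displacements and cross ratios near the base point *)

Section LocalEstimates.
Context (R : realType) (n : nat).
Local Notation C := R[i].
Implicit Types (Z W : 'M[C]_n) (g : 'M[R]_(n + n)).

Local Notation iM := ((Complex 0 1)%:M : 'M[C]_n).

(** Real and imaginary parts are bounded separately: the polydisc is a product of squares, hence a
    box in the real coordinates of the measure. *)
Definition small (e : R) Z := forall i j, `|complex.Re (Z i j)| <= e /\ `|complex.Im (Z i j)| <= e.

Lemma small_nrm e Z : small e Z -> nrm Z <= (n ^ 2)%:R * (2 * e).
Proof.
move=> H; apply: nrm_le => i j; apply: le_trans (cabs_le _) _.
by have [h1 h2] := H i j; rewrite mulr_natl mulr2n lerD.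
Qed.

Lemma ImM_iD Z : ImM (iM + Z) = 1%:M + ImM Z.
Proof.
apply/matrixP => i j; rewrite !mxE; case: (Z i j) => a b.
by case: eqP => _ //=; rewrite ?mulr1n ?mulr0n.
Qed.

Lemma siegel_iD e Z : Z^T = Z -> small e Z -> n%:R * e < 1 -> siegel_space (iM + Z).
Proof.
move=> ZT Zs ne; split; first by rewrite linearD /= tr_scalar_mx ZT.
rewrite ImM_iD; apply: (@posdef1D _ _ _ e) => //; first by rewrite ImM_tr ZT.
by move=> i j; rewrite !mxE; have [] := Zs i j.
Qed.

(* trace of j^* Im(gZ) j = Im Z *)
Lemma nrm_autfactor g Z1 Z2 e : symplectic g -> Z1^T = Z1 -> Z2^T = Z2 ->
  small e Z1 -> small e Z2 -> n%:R * e <= 2^-1 -> e <= 1 ->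
  siegel_act g (iM + Z2) = iM + Z1 ->
  nrm (autfactor g (iM + Z2)) <= (n ^ 2)%:R * (2 * n%:R).
Proof.
move=> gS Z1T Z2T s1 s2 ne e1 gZ; set j := autfactor _ _.
have ne1 : n%:R * e < 1 by apply: le_lt_trans ne _; lra.
have := siegel_act_Im gS (siegel_iD Z2T s2 ne1); rewrite gZ -/j !ImM_iD => E; clearbody j.
pose x c : 'cV[R]_n := map_mx (@complex.Re R) (col c j).
pose y c : 'cV[R]_n := map_mx (@complex.Im R) (col c j).
have Yt : (1%:M + ImM Z1)^T = 1%:M + ImM Z1 by rewrite linearD /= trmx1 ImM_tr Z1T.
have diag c : ((x c)^T *m (1%:M + ImM Z1) *m x c) 0 0 + ((y c)^T *m (1%:M + ImM Z1) *m y c) 0 0 =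
    1 + complex.Im (Z2 c c).
  apply: (@complexI R); have := herm_form (col c j) Yt; rewrite /= -/(x c) -/(y c) => <-.
  have -> : (conjM (col c j))^T *m toC (1%:M + ImM Z1) *m col c j =
      row c ((conjM j)^T *m toC (1%:M + ImM Z1)) *m col c j.
    by rewrite row_mul; congr (_ *m _ *m _); apply/matrixP => a b; rewrite !mxE.
  transitivity ((((conjM j)^T *m toC (1%:M + ImM Z1)) *m j) c c).
    by rewrite !mxE; apply: eq_bigr => k _; rewrite !mxE.
  by rewrite E !mxE eqxx.
(* As [n * e <= 1/2], the matrix [1 + Im Z1] is at least half the identity. Each column of [j] then
   has squared length at most [2 (1 + e) <= 4], which bounds its entries by 2. *)
have lo (v : 'cV[R]_n) : (v^T *m v) 0 0 <= 2 * (v^T *m (1%:M + ImM Z1) *m v) 0 0.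
  have -> : (v^T *m (1%:M + ImM Z1) *m v) 0 0 = (v^T *m v) 0 0 + (v^T *m ImM Z1 *m v) 0 0.
    by rewrite mulmxDr mulmx1 mulmxDl mxE.
  have := @quad_bound R n (ImM Z1) v e; rewrite ler_norml => /(_ _)/andP[|h _].
    by move=> i k; rewrite !mxE; have [] := s1 i k.
  have := ler_wpM2r (dotmx_ge0 v) ne; lra.
have n1 : (0 < n)%N -> 1 <= n%:R :> R by rewrite ler1n.
apply: nrm_le => r c.
have n0 : 1 <= n%:R :> R by rewrite ler1n; apply: leq_ltn_trans (ltn_ord r).
have bd : cabs (j r c) ^+ 2 <= 4.
  have ent (v : 'cV[R]_n) : v r 0 ^+ 2 <= (v^T *m v) 0 0.
    rewrite mxE (bigD1 r)//= !mxE -expr2 lerDl; apply: sumr_ge0 => k _.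
    by rewrite mxE -expr2 sqr_ge0.
  rewrite cabs_sqr; have := ent (x c); have := ent (y c).
  have -> : x c r 0 = complex.Re (j r c) by rewrite !mxE.
  have -> : y c r 0 = complex.Im (j r c) by rewrite !mxE.
  move=> h1 h2.
  have := lo (x c); have := lo (y c); have := diag c.
  have [_ h3] := s2 c c; have := ler_norm (complex.Im (Z2 c c)); lra.
have : cabs (j r c) <= 2 by rewrite -(ler_pXn2r (n := 2)) ?nnegrE ?cabs_ge0//; apply: le_trans bd _; rewrite -natrX.
by move/le_trans; apply; rewrite ler_pMr.
Qed.

Lemma autfactor_sub g Z W : autfactor g W = autfactor g Z + toC (dlsubmx g) *m (W - Z).
Proof. by rewrite /autfactor mulmxBr [RHS]addrC addrA subrK. Qed.

(** With [J = 2 n^3] bounding the automorphy factor and [z = 2 n^2 e] bounding the two small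
    matrices, the displacement found below is at most [z + 2 J^2 z]; the constant is this value over
    [e], rounded up. *)
Definition count_cst : R := (n ^ 2)%:R * 2 * (1 + 2 * (2 * ((n ^ 2)%:R * (2 * n%:R))) ^+ 2).

(** The inverse [h] of [g] carries [g i] to [i] and [i + Z1] to [i + Z2]. By [siegel_act_sub] the
    difference [g i - (i + Z1)] is the small matrix [- Z2] between two automorphy factors of [h].
    The factor at [g i] itself depends linearly on that difference; smallness of [e] allows it to be
    absorbed. *)
Lemma act_close g Z1 Z2 e : symplectic g -> Z1^T = Z1 -> Z2^T = Z2 ->
  small e Z1 -> small e Z2 -> e <= 1 -> n%:R * e <= 2^-1 ->
  (n ^ 2)%:R * e <= 2^-1 ->
  (2 * ((n ^ 2)%:R * (2 * n%:R))) ^+ 2 * ((n ^ 2)%:R * (2 * e)) <= 2^-1 ->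
  siegel_act g (iM + Z2) = iM + Z1 ->
  nrm (siegel_act g iM - iM) <= count_cst * e.
Proof.
move=> gS Z1T Z2T s1 s2 e1 ne n2e Ke gZ.
have ne1 : n%:R * e < 1 by apply: le_lt_trans ne _; lra.
have H1 := siegel_iD Z1T s1 ne1; have H2 := siegel_iD Z2T s2 ne1.
have Hi := siegel_i R n.
pose h := invmx g; have hS : symplectic h := symplecticV gS.
have hZ : siegel_act h (iM + Z1) = iM + Z2 by rewrite -gZ siegel_actK.
have jb := nrm_autfactor hS Z2T Z1T s2 s1 ne e1 hZ.
set J := (n ^ 2)%:R * (2 * n%:R) in Ke jb.
set j := autfactor h (iM + Z1) in jb.
pose w := siegel_act g iM - iM.
have gi : siegel_act g iM = iM + w by rewrite /w addrC subrK.
have Hw : siegel_space (iM + w) by rewrite -gi; exact: siegel_act_space.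
have := siegel_act_sub hS Hw H1; rewrite -{2}gi (siegel_actK gS Hi) hZ -/j.
have -> : iM + w - (iM + Z1) = w - Z1 by rewrite opprD addrACA subrr add0r.
have -> : iM - (iM + Z2) = - Z2 by rewrite opprD addrA subrr add0r.
have jw : autfactor h (iM + w) = j + toC (dlsubmx h) *m (w - Z1).
  by rewrite (autfactor_sub h (iM + Z1)) opprD addrACA subrr add0r.
rewrite jw => E.
(* The imaginary part of [j] is [C (1 + Im Z1)], so [C] is [Im j] minus [C Im Z1], and the last term
   is at most half of [C]. *)
have cb : nrm (toC (dlsubmx h)) <= 2 * J.
  pose D := toC (dlsubmx h); pose Y := toC (ImM Z1).
  have DE : D = toC (ImM j) - D *m Y.
    have -> : ImM j = dlsubmx h *m (1%:M + ImM Z1).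
      rewrite -ImM_iD; apply/matrixP => a b; rewrite !mxE.
      transitivity (complex.Im ((toC (dlsubmx h) *m (iM + Z1)) a b)).
        by rewrite /j /autfactor !mxE; case: (\sum_k _) => p q /=; rewrite addr0.
      rewrite !mxE (big_morph (@complex.Im R) (id1 := 0) (op1 := +%R)) //.
        by apply: eq_bigr => k _; rewrite !mxE; case: (_ + _) => p q /=; rewrite mul0r addr0.
      by move=> [a1 a2] [b1 b2].
    by rewrite /D /Y /toC -map_mxM -map_mxB mulmxDr mulmx1 addrK.
  have h1 : nrm (toC (ImM j)) <= nrm j.
    by apply: ler_sum => a _; apply: ler_sum => b _; rewrite !mxE cabs_real cabs_Im.
  have h2 : nrm Y <= (n ^ 2)%:R * e.
    by apply: nrm_le => a b; rewrite !mxE cabs_real; have [] := s1 a b.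
  have := nrmB (toC (ImM j)) (D *m Y); rewrite -DE => h3.
  have h4 := nrmM D Y.
  have h5 := ler_wpM2l (nrm_ge0 D) (le_trans h2 n2e).
  rewrite -/D; lra.
have z1 := small_nrm s1; have z2 := small_nrm s2.
set z := (n ^ 2)%:R * (2 * e) in z1 z2 Ke.
have z0 : 0 <= z by apply: le_trans z1; exact: nrm_ge0.
have J0 : 0 <= J by rewrite mulr_ge0// mulr_ge0.
have x0 := nrm_ge0 (w - Z1); set x := nrm (w - Z1) in x0 *.
have j1 : nrm ((j + toC (dlsubmx h) *m (w - Z1))^T) <= J + 2 * J * x.
  rewrite nrm_tr; apply: le_trans (nrmD _ _) _; apply: lerD => //.
  by apply: le_trans (nrmM _ _) _; rewrite ler_wpM2r.
have xb : x <= (J + 2 * J * x) * z * J.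
  apply: (@le_trans _ _ (nrm ((j + toC (dlsubmx h) *m (w - Z1))^T *m - Z2 *m j))); first by rewrite E.
  apply: le_trans (nrmM _ _) _.
  apply: ler_pM; rewrite ?nrm_ge0//.
  by apply: le_trans (nrmM _ _) _; rewrite nrmN; apply: ler_pM; rewrite ?nrm_ge0.
(* The hypothesis [Ke] reads [4 J^2 z <= 1/2], so the part of the bound that contains [x] is at most
   a quarter of [x]. *)
have xb2 : x <= 2 * J ^+ 2 * z.
  have : (2 * J) ^+ 2 * z * x <= 2^-1 * x by rewrite ler_wpM2r.
  have := mulr_ge0 (mulr_ge0 J0 J0) (mulr_ge0 z0 x0).
  nra.
have wE : w = (w - Z1) + Z1 by rewrite subrK.
rewrite -/w wE; apply: le_trans (nrmD _ _) _; rewrite -/x.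
apply: le_trans (lerD xb2 z1) _; rewrite /count_cst -/J.
have : 0 <= J ^+ 2 * z by rewrite mulr_ge0// sqr_ge0.
rewrite /z; nra.
Qed.

Lemma invmx_uniq (A B : 'M[C]_n) : A *m B = 1%:M -> invmx A = B.
Proof. by move=> h; have [u _] := mulmx1_unit h; rewrite -[RHS](mulKmx u) h mulmx1. Qed.

Lemma invmxN (M : 'M[C]_n) : invmx (- M) = - invmx M.
Proof.
have uN : (- M \in unitmx) = (M \in unitmx) by rewrite -scaleN1r unitmxZ ?unitrN1.
have [Mu|/negbTE Mu] := boolP (M \in unitmx).
  by apply: invmx_uniq; rewrite mulNmx mulmxN opprK mulmxV.
by rewrite /invmx uN Mu.
Qed.

Lemma nrm_invmx (M : 'M[C]_n) : nrm (M - (Complex 0 2)%:M) <= 1 -> nrm (invmx M) <= 2 * n%:R + 1.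
Proof.
move=> h; have n0 : 0 <= n%:R :> R by [].
have c2 : cabs (Complex 0 2 : C) = 2.
  by apply/eqP; rewrite -(eqrXn2 (n := 2)) ?cabs_ge0// cabs_sqr /= expr0n add0r.
(* On a singular matrix [invmx] is the identity, and the bound [2 n + 1] is then that of [M] itself;
   this avoids proving invertibility. *)
have [Mu|/negbTE Mu] := boolP (M \in unitmx); last first.
  rewrite /invmx Mu -[M](subrK (Complex 0 2)%:M); apply: le_trans (nrmD _ _) _.
  by rewrite nrm_scalar c2 mulrC addrC lerD2l.
set X := invmx M.
have XE : (Complex 0 2)%:M *m X = 1%:M - (M - (Complex 0 2)%:M) *m X.
  by rewrite mulmxBl mulmxV// opprB addrC subrK.
have : nrm ((Complex 0 2)%:M *m X) = 2 * nrm X by rewrite mul_scalar_mx nrmZ c2.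
rewrite XE => E.
have := nrmB 1%:M ((M - (Complex 0 2)%:M) *m X); rewrite E nrm_scalar cabs1 mulr1.
have := nrmM (M - (Complex 0 2)%:M) X; have := ler_wpM2r (nrm_ge0 X) h; lra.
Qed.

(** Two of the four factors are differences of nearby points, the other two are inverses of matrices
    close to [2i] or [-2i]; the cross ratio is therefore quadratic in the distance. *)
Lemma cross_ratio_close W : nrm (W - iM) <= 1 ->
  nrm (cross_ratio iM W) <= ((2 * n%:R + 1) * nrm (W - iM)) ^+ 2.
Proof.
move=> W1; rewrite /cross_ratio.
have iC : map_mx Num.conj iM = - iM.
  by rewrite map_scalar_mx /= conjC_complex -raddfN /=; congr _%:M; apply/eqP; rewrite eq_complex /= oppr0 !eqxx.
rewrite iC; set w := W - iM in W1 *; have WE : W = w + iM by rewrite subrK.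
have i2 : (Complex 0 2)%:M = iM + iM :> 'M[C]_n.
  by rewrite -raddfD /=; congr _%:M; apply/eqP; rewrite eq_complex /= addr0 eqxx /=; apply/eqP; ring.
have inv1 : nrm (invmx (- iM - W)) <= 2 * n%:R + 1.
  have -> : - iM - W = - (iM + W) by rewrite opprD.
  rewrite invmxN.
  rewrite nrmN; apply: nrm_invmx; rewrite i2 WE addrA [iM + w]addrC -[w + _ + _]addrA.
  by rewrite addrK.
have inv2 : nrm (invmx (iM - map_mx Num.conj W)) <= 2 * n%:R + 1.
  apply: nrm_invmx; rewrite i2 WE /= map_mxD /= iC opprD opprK addrA.
  have -> : iM - map_mx Num.conj w + iM - (iM + iM) = - conjM w.
    by rewrite -/(conjM w); apply/matrixP => i k; rewrite !mxE; ring.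
  by rewrite nrmN nrm_conj.
have d1 : nrm (iM - W) = nrm w by rewrite -nrmN opprB.
have d2 : nrm (- iM - map_mx Num.conj W) = nrm w.
  have -> : - iM - map_mx Num.conj W = - conjM w by rewrite -iC -map_mxB /= -/(conjM _) -[w]opprK opprB /conjM map_mxN opprK.
  by rewrite nrmN nrm_conj.
set c := 2 * n%:R + 1 in inv1 inv2 *.
have w0 := nrm_ge0 w; have c0 : 0 <= c by rewrite addr_ge0// mulr_ge0.
have -> : (c * nrm w) ^+ 2 = nrm w * c * nrm w * c by ring.
apply: le_trans (nrmM _ _) _; apply: ler_pM; rewrite ?nrm_ge0//.
apply: le_trans (nrmM _ _) _; apply: ler_pM; rewrite ?nrm_ge0 ?d2//.
apply: le_trans (nrmM _ _) _; apply: ler_pM; rewrite ?nrm_ge0 ?d1//.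
Qed.

Lemma cosh_artanh (s : R) : 0 <= s < 1 -> cosh (ln ((1 + s) / (1 - s)) / 2) ^+ 2 = (1 - s ^+ 2)^-1.
Proof.
move=> /andP[s0 s1].
have s1' : 0 < 1 - s by rewrite subr_gt0.
have s2' : 0 < 1 + s by rewrite ltr_pwDl.
set q := (1 + s) / (1 - s); have q0 : 0 < q by rewrite divr_gt0.
rewrite /cosh; set e := expR (ln q / 2).
have e2 : e ^+ 2 = q by rewrite /e -expRM_natl -mulr_natl mulrCA mulfV// mulr1 lnK.
have e0 : e != 0 by rewrite gt_eqF// expR_gt0.
rewrite expRN -/e.
have -> : ((e + e^-1) / 2) ^+ 2 = (e ^+ 2 + 2 + (e ^+ 2)^-1) / 4 by field.
rewrite e2 /q invf_div; have -> : 1 - s ^+ 2 = (1 - s) * (1 + s) by ring.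
by field; rewrite !gt_eqF.
Qed.

(** With [s^2] at most the modulus of the eigenvalue, hence at most [y <= 1/2], one has [ch(r)^2 = 1
    / (1 - s^2) <= 1 + 2 y <= exp(2 y)]. *)
Lemma cosh_r_fun_le Z W (y : R) j : nrm (cross_ratio Z W) <= y -> y <= 2^-1 ->
  cosh (r_fun Z W j) <= expR y.
Proof.
move=> Hy y2; have y0 : 0 <= y := le_trans (nrm_ge0 _) Hy.
rewrite /r_fun; set l := (eigenvals _)`_j; set s := Num.sqrt _.
have lb : cabs l <= y.
  (* An index beyond the list of eigenvalues reads the default value 0. *)
  have [jl|jl] := ltnP j (size (eigenvals (cross_ratio Z W))); last first.
    by rewrite /l nth_default// cabs0.
  apply: le_trans Hy; apply: nrm_eigenvalue; rewrite eigenvalue_root_char.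
  have lE := mem_nth 0 jl; rewrite -/l in lE.
  have := svalP (closed_field_poly_normal (char_poly (cross_ratio Z W))).
  rewrite -/(eigenvals _) => ->; rewrite rootE hornerZ.
  by have := root_prod_XsubC (eigenvals (cross_ratio Z W)) l; rewrite lE rootE => /eqP ->; rewrite mulr0.
have s0 : 0 <= s by exact: sqrtr_ge0.
have s2 : s ^+ 2 <= y.
  (* A negative real part has square root 0 by convention, for which the bound is trivial. *)
  have [l0|l0] := lerP 0 (complex.Re l).
    by rewrite sqr_sqrtr//; apply: le_trans lb; apply: le_trans (ler_norm _) (cabs_Re _).
  by rewrite /s ler0_sqrtr ?(ltW l0)// expr0n /=.
have s1 : s < 1 by rewrite -(ltr_pXn2r (n := 2)) ?nnegrE//; lra.
rewrite -(ler_pXn2r (n := 2)) ?nnegrE ?expR_ge0//; last first.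
  by rewrite /cosh divr_ge0// addr_ge0// expR_ge0.
rewrite cosh_artanh ?s0// -expRM_natl.
have h : 1 + 2 * y <= expR (2 * y) := expR_ge1Dx _.
apply: le_trans h; rewrite -[leLHS]mul1r ler_pdivrMr; nra.
Qed.

Lemma cross_conj (P Q a b c d : 'M[C]_n) : P \in unitmx -> Q \in unitmx -> b \in unitmx -> d \in unitmx ->
  P *m a *m Q *m invmx (P *m b *m Q) *m (P *m c *m Q) *m invmx (P *m d *m Q) =
  P *m (a *m invmx b *m c *m invmx d) *m invmx P.
Proof.
move=> Pu Qu bu du.
have inv_aff M : M \in unitmx -> invmx (P *m M *m Q) = invmx Q *m invmx M *m invmx P.
  by move=> Mu; apply: invmx_uniq; rewrite -!mulmxA (mulKVmx Qu) (mulKVmx Mu) mulmxV.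
rewrite (inv_aff b bu) (inv_aff d du).
have iPP : invmx P *m P = 1%:M := mulVmx Pu; have QiQ : Q *m invmx Q = 1%:M := mulmxV Qu.
move: (invmx P) (invmx Q) (invmx b) (invmx d) iPP QiQ => iP iQ ib id iPP QiQ.
by rewrite !mulmxA -(mulmxA _ Q iQ) QiQ mulmx1 -(mulmxA _ iP P) iPP mulmx1 -(mulmxA _ Q iQ) QiQ mulmx1.
Qed.

Lemma char_poly_conj (P M : 'M[C]_n) : P \in unitmx -> char_poly (P *m M *m invmx P) = char_poly M.
Proof.
move=> Pu; rewrite /char_poly /char_poly_mx.
pose P' := map_mx (@polyC C) P; pose Q' := map_mx (@polyC C) (invmx P).
have PQ : P' *m Q' = 1%:M by rewrite /P' /Q' -map_mxM mulmxV// map_mx1.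
have -> : 'X%:M - map_mx (@polyC C) (P *m M *m invmx P) =
   P' *m ('X%:M - map_mx (@polyC C) M) *m Q'.
  rewrite mulmxBr mulmxBl; congr (_ - _); last by rewrite !map_mxM.
  by rewrite scalar_mxC -mulmxA PQ mulmx1.
by rewrite !det_mulmx mulrAC -det_mulmx PQ det1 mul1r.
Qed.

(** The translation cancels in each difference, and the factors [A] and [A^T] telescope to a
    conjugation by [A]. The distances [r_fun] depend only on the characteristic polynomial, so they
    may be computed at the base point. *)
Lemma cross_ratio_affine (X A : 'M[R]_n) Z W : A \in unitmx -> siegel_space Z -> siegel_space W ->
  char_poly (cross_ratio (toC A *m Z *m toC A^T + toC X) (toC A *m W *m toC A^T + toC X)) =
  char_poly (cross_ratio Z W).
Proof.
move=> Au ZH WH.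
have AC : toC A \in unitmx by rewrite /toC map_unitmx.
have ATC : toC A^T \in unitmx by rewrite /toC map_unitmx unitmx_tr.
have conj_aff M : map_mx Num.conj (toC A *m M *m toC A^T + toC X) = toC A *m conjM M *m toC A^T + toC X.
  by rewrite map_mxD !map_mxM -!/(conjM _) !(conjM_real _).
have sub_aff M M' : toC A *m M *m toC A^T + toC X - (toC A *m M' *m toC A^T + toC X) =
    toC A *m (M - M') *m toC A^T.
  by rewrite opprD addrACA subrr addr0 mulmxBr mulmxBl.
have crossE (P Q : 'M[C]_n) (F : 'M[C]_n -> 'M[C]_n) :
    (forall M, map_mx Num.conj (F M) = F (conjM M)) ->
    (forall M M', F M - F M' = P *m (M - M') *m Q) ->
    cross_ratio (F Z) (F W) = P *m (Z - W) *m Q *m invmx (P *m (conjM Z - W) *m Q) *m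
      (P *m (conjM Z - conjM W) *m Q) *m invmx (P *m (Z - conjM W) *m Q).
  by rewrite /cross_ratio => h1 h2; rewrite !h1 !h2.
rewrite (crossE _ _ (fun M => toC A *m M *m toC A^T + toC X) conj_aff sub_aff).
have u2 : Z - conjM W \in unitmx.
  apply: unitmx_col => v.
  (* The matrix [- conj W] lies in the half-space, hence so does its sum with [Z], which is
     therefore invertible. *)
  have HH : siegel_space (Z + conjM (- W)).
    have [WT WP] := WH; have WH' : siegel_space (conjM (- W)).
      split; first by rewrite -conjM_tr linearN /= WT.
      suff -> : ImM (conjM (- W)) = ImM W by [].
      apply/matrixP => i k; rewrite !mxE; case: (W i k) => a b.
      by rewrite -[- _]/(Complex (- a) (- b)) conjC_complex /= opprK.
    exact: siegelD.
  have uH := siegel_unit HH; have E : Z - conjM W = Z + conjM (- W) by rewrite /conjM map_mxN.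
  by rewrite E => h; rewrite -[v](mulKmx uH) h mulmx0.
have u1 : conjM Z - W \in unitmx.
  have -> : conjM Z - W = conjM (Z - conjM W).
    by rewrite -{1}(conjMK W); apply/matrixP => i k; rewrite !mxE rmorphB.
  by rewrite conjM_unit.
by rewrite (cross_conj _ _ AC ATC u1 u2) (char_poly_conj _ AC).
Qed.

End LocalEstimates.

(** * Change of variables in one and two real dimensions *)

Section OneDim.
Context (R : realType).
Local Notation T := (measurableTypeR R).
Local Notation leb := (@lebesgue_measure R).
Local Open Scope ereal_scope.

(** The image of Lebesgue measure agrees with it on half-open intervals, and these determine the
    measure. *)
Lemma integral_shift (f : T -> \bar R) (a : R) : measurable_fun setT f ->
  (forall x, 0 <= f x) -> \int[leb]_x f (x + a)%R = \int[leb]_x f x.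
Proof.
move=> mf f0; pose T1 : T -> T := fun x => (x + a)%R.
have mT : measurable_fun setT T1 by exact: measurable_funD.
rewrite -(ge0_integral_pushforward mT _ _ mf)//.
apply: eq_measure_integral => A mA _; apply/esym/lebesgue_measure_unique => //= _ [[x y] _ <-].
rewrite /pushforward (_ : _ @^-1` _ = `](x - a), (y - a)]%classic)%R; last first.
  by apply/seteqP; split => z /=; rewrite !in_itv /= /T1 ltrBlDr lerBrDr.
rewrite !lebesgue_measure_itv /= !lte_fin ltrD2r; case: ifP => // _.
by rewrite -!EFinD; congr EFin; ring.
Qed.

Lemma integral_opp (f : T -> \bar R) : measurable_fun setT f ->
  (forall x, 0 <= f x) -> \int[leb]_x f (- x)%R = \int[leb]_x f x.
Proof.
move=> mf f0; have mT : measurable_fun setT (-%R : T -> T) by exact: measurable_funN.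
rewrite -(ge0_integral_pushforward mT _ _ mf)//.
by apply: eq_measure_integral => A mA _; exact: lebesgue_measureN.
Qed.

Lemma integral_scale_pos (f : T -> \bar R) (a : R) : measurable_fun setT f ->
  (forall x, 0 <= f x) -> (0 < a)%R ->
  a%:E * \int[leb]_x f (a * x)%R = \int[leb]_x f x.
Proof.
move=> mf f0 a0; pose T1 : T -> T := fun x => (a * x)%R.
have mT : measurable_fun setT T1 by exact: measurable_funM.
pose a' := NngNum (ltW a0).
rewrite -[LHS]/(a'%:num%:E * \int[leb]_x (f \o T1) x).
rewrite -(ge0_integral_pushforward mT _ _ mf)// -ge0_integral_mscale//.
apply: eq_measure_integral => A mA _; apply/esym/lebesgue_measure_unique => //= _ [[x y] _ <-].
rewrite /mscale /= /pushforward (_ : _ @^-1` _ = `](x / a), (y / a)]%classic)%R; last first.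
  by apply/seteqP; split => z /=; rewrite !in_itv /= /T1 ltr_pdivrMr// ler_pdivlMr// ![(z * a)%R]mulrC.
rewrite !lebesgue_measure_itv /= !lte_fin ltr_pM2r ?invr_gt0//; case: ifP => _; last by rewrite mule0.
by rewrite -!EFinD -EFinM; congr EFin; field; rewrite gt_eqF.
Qed.

Lemma integral_scale (f : T -> \bar R) (a : R) : measurable_fun setT f ->
  (forall x, 0 <= f x) -> (a != 0)%R ->
  `|a|%:E * \int[leb]_x f (a * x)%R = \int[leb]_x f x.
Proof.
move=> mf f0; case: (ltgtP a 0%R) => // a0 _; last first.
  by rewrite gtr0_norm// integral_scale_pos.
rewrite ltr0_norm// -[RHS](@integral_scale_pos _ (- a)%R) ?oppr_gt0//; congr (_ * _).
rewrite -[RHS]integral_opp//; first by apply: eq_integral => x _; rewrite mulrNN.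
by apply: (measurableT_comp mf); exact: measurable_funM.
Qed.

Let integral_inv_sqr_y (c : R) : (0 < c)%R ->
  \int[leb]_(x in `[c, +oo[) (x ^- 2)%:E = (c^-1)%:E.
Proof.
move=> c0; have D (x : R) : (0 < x)%R -> is_derive x 1%R (fun x : R => - x^-1)%R (x ^- 2)%R.
  move=> x0; have x0' : x != 0%R by rewrite gt_eqF.
  have /is_derive_eq := is_deriveN (is_deriveV x0' (is_derive_id x 1%R)).
  by apply; rewrite scaleNr opprK /GRing.scale /= mulr1.
rewrite (@ge0_continuous_FTC2y _ (fun x => x ^- 2)%R (fun x => - x^-1)%R c 0%R).
- by rewrite sub0e -EFinN opprK.
- by move=> x cx; rewrite invr_ge0 exprn_ge0// (le_trans (ltW c0)).
- apply: continuous_in_subspaceT => x /set_mem /=; rewrite in_itv /= andbT => cx.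
  have x0 : x != 0%R by rewrite gt_eqF// (lt_le_trans c0).
  apply: (@cvgV _ _ _ _ (fun x : R => x ^+ 2)%R); first by rewrite expf_neq0.
  exact: exprn_continuous.
- rewrite -oppr0; apply: cvgN; apply/gtr0_cvgV0; last exact: cvg_id.
  by near=> x; near: x; exact: nbhs_pinfty_gt.
- by move=> x cx; have [] := D x (lt_trans c0 cx).
- apply: cvg_at_right_filter; apply: cvgN; apply: cvgV; last exact: cvg_id.
  by rewrite gt_eqF.
- move=> x; rewrite in_itv /= andbT => cx.
  by rewrite derive1E; apply: derive_val; exact: D (lt_trans c0 cx).
Unshelve. all: end_near. Qed.

Let w2 (x : R) : R := if (0 < x)%R then (x ^- 2)%R else 0%R.

Lemma measurable_inv : measurable_fun (setT : set T) (fun x : R => x^-1 : T)%R.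
Proof.
have mU : measurable ([set~ 0%R] : set T) by exact: measurableC.
have -> : [set: T] = ~` [set 0%R] `|` [set 0%R] by rewrite setvU.
apply/measurable_funU => //; split; last exact: measurable_fun_set1.
apply: open_continuous_measurable_fun.
  by apply: closed_openC; exact: closed_eq.
by move=> x /set_mem /= /eqP x0; apply: cvgV.
Qed.

Let mw2 : measurable_fun (setT : set T) (w2 : T -> T).
Proof.
rewrite /w2; apply: measurable_fun_ifT => //.
  exact: measurable_fun_ltr.
by apply: (measurableT_comp measurable_inv); exact: measurable_funX.
Qed.

Let w2_ge0 x : (0 <= w2 x)%R.
Proof. by rewrite /w2; case: ifP => // x0; rewrite invr_ge0 exprn_ge0// ltW. Qed.

(** The measure of an interval after inversion: the density [x^-2] integrates over [[1/b, 1/a[] to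
    [b - a]. *)
Let integral_w2 (a b : R) : (0 <= a < b)%R ->
  \int[leb]_x (w2 x * \1_(`]a, b]%classic : set R) (x^-1))%:E = (b - a)%:E.
Proof.
move=> /andP[a0 ab]; have b0 := le_lt_trans a0 ab.
have bV : (0 < b^-1)%R by rewrite invr_gt0.
have Hy (c : R) : (0 < c)%R -> \int[leb]_(x in `[c, +oo[) (w2 x)%:E = (c^-1)%:E.
  move=> c0; rewrite -integral_inv_sqr_y//; apply: eq_integral => x.
  by rewrite inE /= in_itv /= andbT => cx; rewrite /w2 (lt_le_trans c0 cx).
(* For [a = 0] the inverted interval is the whole half-line from [1/b] on; otherwise two such
   half-lines are subtracted. *)
have [a0'|a_neq0] := eqVneq a 0%R.
  rewrite a0' subr0 -[in RHS](invrK b) -Hy// [RHS]integral_mkcond; apply: eq_integral => x _.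
  rewrite patchE mem_setE in_itv /= andbT indicE mem_setE in_itv /= invr_gt0 /w2.
  case: ifP => [x0|_]; last by rewrite mul0r if_same.
  by rewrite invf_ple ?posrE//=; case: ifP; rewrite ?mulr1 ?mulr0.
have a_gt0 : (0 < a)%R by rewrite lt_neqAle eq_sym a_neq0.
have aV : (0 < a^-1)%R by rewrite invr_gt0.
have := Hy _ bV; rewrite invrK.
have -> : (`[b^-1, +oo[%classic = `[b^-1, a^-1[%classic `|` `[a^-1, +oo[%classic :> set R)%R.
  by rewrite -itv_bndbnd_setU// bnd_simp lef_pV2 ?posrE// ltW.
rewrite ge0_integral_setU//=; last 3 first.
- by apply: measurable_funTS; exact/measurable_EFinP.
- by move=> x _; rewrite lee_fin.
- by apply/disj_setPS => x /= []; rewrite !in_itv /= andbT => /andP[_ xa]; rewrite leNgt xa.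
rewrite Hy// invrK => E.
have -> : \int[leb]_x (w2 x * \1_(`]a, b]%classic : set R) (x^-1))%:E =
    \int[leb]_(x in `[(b^-1)%R, (a^-1)%R[) (w2 x)%:E.
  rewrite [RHS]integral_mkcond; apply: eq_integral => x _.
  rewrite patchE mem_setE in_itv /= indicE mem_setE in_itv /= /w2.
  case: ifP => [x0|_]; last by rewrite mul0r if_same.
  have -> : (a < x^-1 <= b)%R = (b^-1 <= x < a^-1)%R.
    by rewrite andbC -[b in LHS]invrK -[a in LHS]invrK lef_pV2 ?ltf_pV2 ?posrE.
  by case: ifP; rewrite ?mulr1 ?mulr0.
move: E; set J := \int[leb]_(x in _) _; case: J => [r| |]//=.
by rewrite -EFinD => -[<-]; rewrite addrK.
Qed.

(* Lebesgue measure on ]0, +oo[ as the image under (x, y) |-> 1/x of the region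
   0 < y < x^-2 *)
Let invreg (p : T * T) : T :=
  if (0 < p.2)%R && (p.2 < w2 p.1)%R then (p.1^-1)%R else (- 1)%R.

Let minvreg : measurable_fun setT invreg.
Proof.
apply: measurable_fun_ifT => //.
  apply: measurable_and; first exact: measurable_fun_ltr.
  by apply: measurable_fun_ltr => //; exact: measurableT_comp.
by apply: (measurableT_comp measurable_inv).
Qed.

Let invm : {measure set T -> \bar R}.
Proof. by refine (pushforward (leb \x leb) invreg : {measure set T -> \bar R}). Defined.

Let pos : set T := `]0%R, +oo[%classic.

(** For fixed [x] the fibre of the region is an interval of length [w2 x]; off the region [invreg]
    takes the value -1, which lies outside [pos]. *)
Let integral_invreg (f : T -> \bar R) : measurable_fun setT f -> (forall x, 0 <= f x) ->
  \int[invm]_(x in pos) f x = \int[leb]_x (f (x^-1)%R * (w2 x)%:E).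
Proof.
move=> mf f0; rewrite /invm ge0_integral_pushforward//; last exact: measurable_funTS.
rewrite integral_mkcond fubini_tonelli1.
- apply: eq_integral => x _; rewrite /fubini_F.
  transitivity (\int[leb]_(y in `]0%R, w2 x[) f (x^-1)%R).
    rewrite [RHS]integral_mkcond; apply: eq_integral => y _.
    have H : (invreg @^-1` pos) (x, y) <-> (0 < y)%R && (y < w2 x)%R.
      rewrite /preimage /= /pos /= /invreg /= in_itv /= andbT; split.
        by case: ifP => // _; rewrite ltNge lerN10.
      move=> h; rewrite h invr_gt0; move/andP: h => -[y0 yx].
      by move: (lt_trans y0 yx); rewrite /w2; case: ifP => //; rewrite ltxx.
    rewrite !patchE; case: ifPn => [/set_mem/H h|/negP h].
      by rewrite mem_setE in_itv /= h /invreg /= h.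
    by rewrite mem_setE in_itv /=; case: ifP => // /H/mem_set.
  rewrite integral_cst//= lebesgue_measure_itv /= lte_fin sube0; case: ifP => // w0.
  have -> : w2 x = 0%R by apply/eqP; rewrite eq_le w2_ge0 leNgt w0.
  by [].
- have mD : measurable (invreg @^-1` pos).
    by rewrite -[X in measurable X]setTI; apply: minvreg => //; exact: measurable_itv.
  have : measurable_fun (invreg @^-1` pos) (f \o invreg).
    by apply: measurable_funTS; exact: (measurableT_comp mf minvreg).
  by move/(measurable_restrictT _ mD).
- by move=> p; apply: erestrict_ge0 => x _; exact: f0.
- exact: measurable_itv.
Qed.

Lemma integral_itv_inv (f : T -> \bar R) : measurable_fun setT f -> (forall x, 0 <= f x) ->
  \int[leb]_(x in `]0%R, +oo[) f x =
  \int[leb]_(x in `]0%R, +oo[) (f (x^-1)%R * (x ^- 2)%:E).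
Proof.
move=> mf f0; transitivity (\int[leb]_x (f (x^-1)%R * (w2 x)%:E)); last first.
  rewrite [RHS]integral_mkcond; apply: eq_integral => x _.
  by rewrite patchE mem_setE in_itv /= andbT /w2; case: ifP => // _; rewrite mule0.
rewrite -integral_invreg//; apply: eq_measure_integral => A mA Apos.
have mpos : measurable pos by exact: measurable_itv.
have mposC : measurable (~` pos) by exact: measurableC.
(* Uniqueness of Lebesgue measure concerns measures on the whole line, so the inverted measure on
   [pos] is completed by Lebesgue measure on the complement. *)
pose nu := measure_add (mrestr (invm) mpos) (mrestr leb mposC).
have AE : invm A = nu A.
  rewrite /nu /= /measure_add /= /msum !big_ord_recl big_ord0 /= /mrestr.
  rewrite (setIidl Apos) (_ : A `&` ~` pos = set0) ?measure0 ?adde0//.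
  by apply/seteqP; split => // x [/Apos].
rewrite AE; apply: lebesgue_measure_unique => // _ [[a b] _ <-] /=.
rewrite /nu /= /measure_add /= /msum !big_ord_recl big_ord0 /= /mrestr adde0.
set I := `]a, b]%classic; set a' := Num.max a 0%R.
have mI : measurable (I : set T) by exact: measurable_itv.
rewrite [LHS](_ : _ = leb (I `&` pos) + leb (I `&` ~` pos)); last first.
  rewrite -measureU; [|exact: measurableI..|].
    by rewrite -setIUr setUv setIT.
  by apply/seteqP; split => // x [[_ xp] [_]].
congr (_ + _).
have -> : I `&` pos = `]a', b]%classic.
  apply/seteqP; split => x /=; rewrite /pos /I /= !in_itv /= andbT /a' gt_max.
    by move=> [/andP[-> ->] ->].
  by move=> /andP[/andP[-> ->] ->].
have [ab|ba] := ltP a' b; last first.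
  rewrite (_ : `]a', b]%classic = set0) ?measure0//.
  by apply/seteqP; split => // x /=; rewrite in_itv /= => /andP[/lt_le_trans/[apply]]; rewrite ltNge ba.
rewrite lebesgue_measure_itv /= lte_fin ab.
have a'0 : (0 <= a')%R by rewrite /a' le_max lexx orbT.
rewrite -EFinD -(@integral_w2 a' b) ?a'0//.
rewrite -[RHS]/(invm `]a', b]%classic) -[X in _ = invm X](setIidl (_ : `]a', b]%classic `<=` pos)); last first.
  by move=> x; rewrite /pos /= !in_itv /= andbT => /andP[/(le_lt_trans a'0)].
transitivity (\int[invm]_(x in pos) (\1_(`]a', b]%classic : set R) x)%:E); last first.
  by rewrite integral_indic//; exact: measurable_itv.
rewrite integral_invreg//.
  by apply: eq_integral => x _; rewrite -EFinM mulrC.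
apply/measurable_EFinP; apply: measurable_indic; exact: measurable_itv.
Qed.

End OneDim.

(** * Translations, complex multiplication and inversion in the plane *)

Section TwoDim.
Context (R : realType).
Local Notation T := (measurableTypeR R).
Local Notation leb := (@lebesgue_measure R).
Local Open Scope ereal_scope.

Ltac mreal := repeat first
  [ exact: measurable_fst | exact: measurable_snd | exact: measurable_cst | exact: measurable_id
  | apply: measurable_funD | apply: measurable_funB | apply: measurable_funM
  | apply: measurable_funN | apply: measurable_funX
  | apply: (measurableT_comp (@measurable_inv R)) ].

Lemma measurable_pair_comp d (X : measurableType d) (h : T * T -> \bar R) (F G : X -> T) :
  measurable_fun setT h -> measurable_fun setT F -> measurable_fun setT G ->
  measurable_fun setT (fun x => h (F x, G x)).
Proof. by move=> mh mF mG; apply: (measurableT_comp mh); exact: measurable_fun_pair. Qed.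

Lemma measurable_integral_snd (k : T -> T -> \bar R) :
  measurable_fun setT (fun p : T * T => k p.1 p.2) -> (forall x y, 0 <= k x y) ->
  measurable_fun setT (fun x => \int[leb]_y k x y).
Proof.
move=> mk k0.
by apply: (measurable_fun_fubini_tonelli_F (fun p : T * T => k p.1 p.2)) => // p.
Qed.

Lemma exchange_integral (k : T -> T -> \bar R) :
  measurable_fun setT (fun p : T * T => k p.1 p.2) -> (forall x y, 0 <= k x y) ->
  \int[leb]_x \int[leb]_y k x y = \int[leb]_y \int[leb]_x k x y.
Proof.
by move=> mk k0; exact: (fubini_tonelli (fun p : T * T => k p.1 p.2)).
Qed.

Lemma integral_if (b : bool) (f : T -> \bar R) :
  \int[leb]_x (if b then f x else 0) = if b then \int[leb]_x f x else 0.
Proof. by case: b; rewrite ?integral0. Qed.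

Lemma integral_affine (f : T -> \bar R) (c d : R) : measurable_fun setT f ->
  (forall x, 0 <= f x) -> (c != 0)%R ->
  `|c|%:E * \int[leb]_x f (c * x + d)%R = \int[leb]_x f x.
Proof.
move=> mf f0 c0; rewrite -[RHS](integral_shift d)// -[RHS](@integral_scale _ _ c)//.
by apply: (measurableT_comp mf); mreal.
Qed.

Lemma integral_pos_inv (f : T -> \bar R) : measurable_fun setT f -> (forall x, 0 <= f x) ->
  \int[leb]_x (if (0 < x)%R then f x else 0) =
  \int[leb]_x (if (0 < x)%R then f (x^-1)%R * (x ^- 2)%:E else 0).
Proof.
move=> mf f0; have := integral_itv_inv mf f0.
rewrite integral_mkcond [in RHS]integral_mkcond => E.
transitivity (\int[leb]_x ((f \_ (`]0%R, +oo[)) x)).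
  by apply: eq_integral => x _; rewrite patchE mem_setE in_itv /= andbT.
by rewrite E; apply: eq_integral => x _; rewrite patchE mem_setE in_itv /= andbT.
Qed.

Definition I2 (h : T * T -> \bar R) := \int[leb]_x \int[leb]_y h (x, y).

(** The substitution [x = t y] in the half-plane: in the coordinates [(t, y)] the inversion acts on
    [y] alone, up to a reflection of [t]. *)
Lemma I2_pos (k : T * T -> \bar R) : measurable_fun setT k -> (forall p, 0 <= k p) ->
I2 (fun p : T * T => if (0 < p.2)%R then k p else 0) =
  \int[leb]_t \int[leb]_y (if (0 < y)%R then y%:E * k (t * y, y)%R else 0).
Proof.
have mpos : measurable_fun setT (fun p : T * T => (0 < p.2)%R).
by apply: measurable_fun_ltr => //; mreal.
move=> mk k0; have mk2 : measurable_fun setT (fun p : T * T => if (0 < p.2)%R then k p else 0).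
  exact: measurable_fun_ifT.
rewrite /I2 (@exchange_integral (fun x y => if (0 < y)%R then k (x, y) else 0)); first last.
- by move=> x y; case: ifP.
- by apply: measurable_fun_ifT => //; apply: measurable_pair_comp => //; mreal.
rewrite (@exchange_integral (fun t y => if (0 < y)%R then y%:E * k (t * y, y)%R else 0)); first last.
- by move=> t p; case: ifP => // p0; rewrite mule_ge0// lee_fin ltW.
- apply: measurable_fun_ifT => //; apply: emeasurable_funM; first exact/measurable_EFinP.
  by apply: measurable_pair_comp => //; mreal.
apply: eq_integral => y _ /=; rewrite !integral_if; case: ifP => y0 //.
rewrite ge0_integralZl//; first last.
- by rewrite lee_fin ltW.
- by apply: measurable_pair_comp => //; mreal.
rewrite -[LHS](@integral_scale _ _ y) ?gt_eqF//; last first.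
  by apply: measurable_pair_comp => //; mreal.
rewrite gtr0_norm//; congr (_ * _); apply: eq_integral => x _.
by rewrite mulrC.
Qed.

Section I2.
Context (h : T * T -> \bar R) (mh : measurable_fun setT h) (h0 : forall p, 0 <= h p).

Lemma I2_shift a b : I2 (fun p => h (p.1 + a, p.2 + b)%R) = I2 h.
Proof.
rewrite /I2 -[RHS](integral_shift a).
- apply: eq_integral => x _ /=; rewrite (@integral_shift _ (fun y => h (x + a, y)%R)) //.
  by apply: measurable_pair_comp => //; mreal.
- exact: (measurable_fun_fubini_tonelli_F h).
- by move=> x; exact: integral_ge0.
Qed.

(** For [b] nonzero, multiplication by [a + i b] is done by two affine substitutions of one
    variable, with an exchange of the integrals in between: first [y = c u - (a / b) x], then
    [x = a u - b v]. Their Jacobians [|c|] and [|b|] multiply to [a^2 + b^2]. *)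
Lemma I2_cmul (a b : R) : (a ^+ 2 + b ^+ 2 != 0)%R ->
  (a ^+ 2 + b ^+ 2)%:E * I2 (fun p => h (a * p.1 - b * p.2, b * p.1 + a * p.2)%R) = I2 h.
Proof.
move=> ab0; have m1 x : measurable_fun setT (fun y => h (x, y)).
  by apply: measurable_pair_comp => //; mreal.
have [b0|b0] := eqVneq b 0%R.
  have a0 : a != 0%R by move: ab0; rewrite b0 expr0n addr0 sqrf_eq0.
  rewrite b0 expr0n addr0 -[in LHS](real_normK (num_real a)) expr2 EFinM -muleA.
  rewrite /I2 -[RHS](@integral_scale _ _ a)//; first last.
  - by move=> x; exact: integral_ge0.
  - exact: (measurable_fun_fubini_tonelli_F h).
  congr (_ * _); rewrite -ge0_integralZl//; first last.
  - by move=> x _; exact: integral_ge0.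
  - apply: measurable_integral_snd => //=.
    by apply: measurable_pair_comp => //; mreal.
  apply: eq_integral => x _ /=; rewrite -[RHS](@integral_scale _ _ a)//.
  by congr (_ * _); apply: eq_integral => y _; rewrite !mul0r subr0 add0r.
have [c cE] : exists c : R, c = ((a ^+ 2 + b ^+ 2) / b)%R by eexists.
have c0 : c != 0%R by rewrite cE mulf_neq0// invr_eq0.
have mk : measurable_fun setT (fun p : T * T => h (p.2, c * p.1 - (a / b) * p.2)%R).
  by apply: measurable_pair_comp => //; mreal.
have E1 : I2 h = `|c|%:E * \int[leb]_x \int[leb]_u h (x, c * u - (a / b) * x)%R.
  have mI : measurable_fun setT (fun x => \int[leb]_u h (x, c * u - (a / b) * x)%R).
    apply: (measurable_integral_snd (k := fun x u => h (x, c * u - (a / b) * x)%R)) => /=.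
      by apply: measurable_pair_comp => //; mreal.
    by move=> ? ?; exact: h0.
  have I0 x : 0 <= \int[leb]_u h (x, c * u - (a / b) * x)%R by apply: integral_ge0 => u _; exact: h0.
  transitivity (\int[leb]_x (`|c|%:E * \int[leb]_u h (x, c * u - (a / b) * x)%R)); first last.
    by apply: ge0_integralZl => //; rewrite lee_fin.
  by apply: eq_integral => x _; rewrite -[LHS](@integral_affine _ c (- (a / b * x))%R).
have X := @exchange_integral (fun u x => h (x, c * u - (a / b) * x)%R) mk (fun _ _ => h0 _).
rewrite E1 -X.
have -> : (a ^+ 2 + b ^+ 2)%:E = `|c|%:E * `|b|%:E.
  by rewrite -EFinM -normrM cE divfK// ger0_norm// addr_ge0 ?sqr_ge0.
rewrite -muleA; congr (_ * _).
have mJ : measurable_fun setT (fun u => \int[leb]_y h (a * u - b * y, b * u + a * y)%R).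
  apply: (measurable_integral_snd (k := fun u y => h (a * u - b * y, b * u + a * y)%R)) => /=.
    by apply: measurable_pair_comp => //; mreal.
  by move=> ? ?; exact: h0.
have J0 x : 0 <= \int[leb]_y h (a * x - b * y, b * x + a * y)%R by apply: integral_ge0 => y _; exact: h0.
transitivity (\int[leb]_u (`|b|%:E * \int[leb]_y h (a * u - b * y, b * u + a * y)%R)).
  by apply/esym; apply: ge0_integralZl => //; rewrite lee_fin.
clear mJ J0 X E1.
apply: eq_integral => u _ /=.
rewrite -[RHS](@integral_affine _ (- b)%R (a * u)%R) ?oppr_eq0//; last first.
  by apply: measurable_pair_comp => //; mreal.
rewrite normrN; congr (_ * _); apply: eq_integral => v _; congr h; congr pair; first by ring.
by rewrite cE; field.
Qed.

(** The map is [z -> -1/z]. With [t = x / y] it sends [t] to [- t] and [y] to [1 / (m y)], where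
    [m = 1 + t^2], so it is a reflection, an inversion on the half-line and a scaling. *)
Lemma I2_inv :
  I2 (fun p : T * T => if (0 < p.2)%R then h p else 0) =
  I2 (fun p : T * T => if (0 < p.2)%R then
     h (- p.1 / (p.1 ^+ 2 + p.2 ^+ 2), p.2 / (p.1 ^+ 2 + p.2 ^+ 2))%R *
     ((p.1 ^+ 2 + p.2 ^+ 2) ^- 2)%:E else 0).
Proof.
have mpos : measurable_fun setT (fun p : T * T => (0 < p.2)%R).
  by apply: measurable_fun_ltr => //; mreal.
pose k' (p : T * T) := h (- p.1 / (p.1 ^+ 2 + p.2 ^+ 2), p.2 / (p.1 ^+ 2 + p.2 ^+ 2))%R *
     ((p.1 ^+ 2 + p.2 ^+ 2) ^- 2)%:E.
have k'0 p : 0 <= k' p.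
  by rewrite /k' mule_ge0// lee_fin invr_ge0 exprn_ge0// addr_ge0 ?sqr_ge0.
have mk' : measurable_fun setT k'.
  apply: emeasurable_funM; first by apply: measurable_pair_comp => //; mreal.
  by apply/measurable_EFinP; mreal.
change (I2 (fun p => if (0 < p.2)%R then h p else 0) = I2 (fun p => if (0 < p.2)%R then k' p else 0)).
rewrite (I2_pos mh h0) (I2_pos mk' k'0).
have m3 t : measurable_fun setT (fun y : T => if (0 < y)%R then y%:E * h (t * y, y)%R else 0).
  apply: measurable_fun_ifT => //; first exact: measurable_fun_ltr.
  apply: emeasurable_funM; first exact/measurable_EFinP.
  by apply: measurable_pair_comp => //; mreal.
rewrite -integral_opp; first last.
- by move=> t; apply: integral_ge0 => y _; case: ifP => // y0; rewrite mule_ge0// lee_fin ltW.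
- apply: measurable_integral_snd => //=.
    apply: measurable_fun_ifT => //; apply: emeasurable_funM; first exact/measurable_EFinP.
    by apply: measurable_pair_comp => //; mreal.
  by move=> x p; case: ifP => // p0; rewrite mule_ge0// lee_fin ltW.
apply: eq_integral => t _; pose m := (1 + t ^+ 2)%R.
have m0 : (0 < m)%R by rewrite ltr_pwDl ?sqr_ge0.
transitivity (\int[leb]_y (if (0 < y)%R then `|y|%:E * h (- t * y, y)%R else 0)).
  by apply: eq_integral => y _; case: ifP => // y0; rewrite gtr0_norm.
rewrite (@integral_pos_inv (fun y => `|y|%:E * h (- t * y, y)%R)); first last.
- by move=> y; rewrite mule_ge0.
- apply: emeasurable_funM; first by apply/measurable_EFinP; exact: normr_measurable.
  by apply: measurable_pair_comp => //; mreal.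
rewrite -[LHS](@integral_scale_pos _ _ m)//; first last.
- by move=> y; case: ifP => // y0; rewrite !mule_ge0// lee_fin invr_ge0 exprn_ge0// ltW.
- apply: measurable_fun_ifT => //; first exact: measurable_fun_ltr.
  apply: emeasurable_funM; last by apply/measurable_EFinP; mreal.
  apply: emeasurable_funM; first by apply/measurable_EFinP; apply: (measurableT_comp (@normr_measurable R setT)); mreal.
  by apply: measurable_pair_comp => //; mreal.
rewrite -ge0_integralZl//; first last.
- by rewrite lee_fin ltW.
- by move=> y _; case: ifP => // y0; rewrite !mule_ge0// lee_fin invr_ge0 exprn_ge0// ltW.
- apply: measurable_fun_ifT => //; first by apply: measurable_fun_ltr => //; mreal.
  apply: emeasurable_funM; last by apply/measurable_EFinP; mreal.
  apply: emeasurable_funM; first by apply/measurable_EFinP; apply: (measurableT_comp (@normr_measurable R setT)); mreal.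
  by apply: measurable_pair_comp => //; mreal.
apply: eq_integral => y _; rewrite pmulr_rgt0//; case: ifP => y0; last by rewrite mule0.
have y0' : y != 0%R by rewrite gt_eqF.
have m0' : m != 0%R by rewrite gt_eqF.
rewrite gtr0_norm ?invr_gt0 ?mulr_gt0//.
have r2 : ((t * y) ^+ 2 + y ^+ 2 = y ^+ 2 * m)%R by rewrite /m; ring.
rewrite /k' /= r2.
have -> : (- t / (m * y) = - (t * y) / (y ^+ 2 * m))%R by field; rewrite m0'.
have -> : ((m * y)^-1 = y / (y ^+ 2 * m))%R by field; rewrite m0'.
rewrite muleAC muleA -EFinM [RHS]muleA [in RHS]muleAC -EFinM.
by congr (_%:E * _); field; rewrite y0' m0'.
Qed.

End I2.

End TwoDim.

(** * Integration over symmetric matrices by coordinates *)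

Section TupleSection.
Context (R : realType).
Local Notation T := (measurableTypeR R).
Local Notation leb := (@lebesgue_measure R).
Local Notation lebn := (tuple_measure (@lebesgue_measure R)).
Local Open Scope ereal_scope.

Definition tupd N (t : N.-tuple T) (i : 'I_N) (x : T) : N.-tuple T :=
  [tuple if j == i then x else tnth t j | j < N].

Lemma tnth_tupd N (t : N.-tuple T) i x j :
  tnth (tupd t i x) j = if j == i then x else tnth t j.
Proof. by rewrite tnth_mktuple. Qed.

Lemma tupd_tupd N (t : N.-tuple T) i x y : tupd (tupd t i x) i y = tupd t i y.
Proof. by apply: eq_from_tnth => j; rewrite !tnth_tupd; case: eqP. Qed.

Lemma tupd0 N (t : N.-tuple T) (x y : T) :
  tupd (tuple_cons (y, t)) ord0 x = tuple_cons (x, t).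
Proof.
apply: eq_from_tnth => j; rewrite tnth_tupd.
by case: (unliftP ord0 j) => [k ->|->]; rewrite ?eqxx // (tnth_nth 0%R) (tnth_nth 0%R).
Qed.

Lemma tupd_lift N (t : N.-tuple T) (x y : T) i :
  tupd (tuple_cons (y, t)) (lift ord0 i) x = tuple_cons (y, tupd t i x).
Proof.
apply: eq_from_tnth => j; rewrite tnth_tupd.
case: (unliftP ord0 j) => [k ->|->]; last by [].
by rewrite (inj_eq (@lift_inj _ _)) /tuple_cons /= !tnthS tnth_tupd.
Qed.

Lemma measurable_tupd d (X : measurableType d) N (f : X -> N.-tuple T) (g : X -> T) i :
  measurable_fun setT f -> measurable_fun setT g ->
  measurable_fun setT (fun x => tupd (f x) i (g x)).
Proof.
move=> mf mg; apply/measurable_fun_tnthP => j.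
rewrite (_ : _ \o _ = if j == i then g else (fun x => tnth (f x) j)); last first.
  by apply/funext => x /=; rewrite tnth_tupd; case: eqP.
by case: eqP => // _; apply: (measurableT_comp (measurable_tnth j)).
Qed.

Lemma tuple_integral_cons N (H : N.+1.-tuple T -> \bar R) :
  measurable_fun setT H -> (forall t, 0 <= H t) ->
  \int[lebn N.+1]_t H t = \int[leb]_x \int[lebn N]_t H (tuple_cons (x, t)).
Proof.
move=> mH H0.
transitivity (\int[leb \x lebn N]_p H (tuple_cons p)).
  have := @ge0_integral_pushforward _ _ _ _ R _ (@measurable_tuple_cons _ T N) (leb \x lebn N) setT H measurableT mH.
  by rewrite preimage_setT; apply.
rewrite fubini_tonelli1//.
exact: (measurableT_comp mH (@measurable_tuple_cons _ T N)).
Qed.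

(** Tonelli in a chosen coordinate: for the head the two integrals are exchanged, for a later
    coordinate the induction applies to the inner integral. *)
Lemma tuple_section_le N (i : 'I_N) (H1 H2 : N.-tuple T -> \bar R) :
  measurable_fun setT H1 -> (forall t, 0 <= H1 t) ->
  measurable_fun setT H2 -> (forall t, 0 <= H2 t) ->
  (forall t, \int[leb]_x H1 (tupd t i x) <= \int[leb]_x H2 (tupd t i x)) ->
  \int[lebn N]_t H1 t <= \int[lebn N]_t H2 t.
Proof.
elim: N i H1 H2 => [[]//|N IH] i H1 H2 mH1 p1 mH2 p2 H12.
rewrite !tuple_integral_cons//.
have mc H : measurable_fun setT H -> measurable_fun setT (fun p : T * N.-tuple T => H (tuple_cons p) : \bar R).
  by move=> mH; exact: (measurableT_comp mH (@measurable_tuple_cons _ T N)).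
have mx H x : measurable_fun setT H -> measurable_fun setT (fun t : N.-tuple T => H (tuple_cons (x, t)) : \bar R).
  by move=> /mc mH; exact: (measurableT_comp mH (measurable_fun_pair (measurable_cst _) (@measurable_id _ _ _))).
have [j ij|ij] := unliftP ord0 i.
  apply: ge0_le_integral => //.
  - by move=> x _; exact: integral_ge0.
  - exact: (measurable_fun_fubini_tonelli_F (fun p : T * N.-tuple T => H1 (tuple_cons p)) (mc _ mH1)).
  - exact: (measurable_fun_fubini_tonelli_F (fun p : T * N.-tuple T => H2 (tuple_cons p)) (mc _ mH2)).
  move=> x _; apply: (IH j) => //; [exact: mx|exact: mx|].
  move=> t; have := H12 (tuple_cons (x, t)).
  by rewrite ij; under eq_integral do rewrite tupd_lift; under [X in _ <= X -> _]eq_integral do rewrite tupd_lift.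
rewrite (fubini_tonelli (fun p : T * N.-tuple T => H1 (tuple_cons p)) (mc _ mH1))//.
rewrite (fubini_tonelli (fun p : T * N.-tuple T => H2 (tuple_cons p)) (mc _ mH2))//.
apply: ge0_le_integral => //.
- by move=> x _; exact: integral_ge0.
- exact: (measurable_fun_fubini_tonelli_G (fun p : T * N.-tuple T => H1 (tuple_cons p)) (mc _ mH1)).
- exact: (measurable_fun_fubini_tonelli_G (fun p : T * N.-tuple T => H2 (tuple_cons p)) (mc _ mH2)).
(* The head 0 is arbitrary, since the section overwrites it. *)
move=> t _; have := H12 (tuple_cons ((0%R : R) : T, t)).
by rewrite ij; under eq_integral do rewrite tupd0; under [X in _ <= X -> _]eq_integral do rewrite tupd0.
Qed.

Lemma tuple_section_eq N (i : 'I_N) (H1 H2 : N.-tuple T -> \bar R) :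
  measurable_fun setT H1 -> (forall t, 0 <= H1 t) ->
  measurable_fun setT H2 -> (forall t, 0 <= H2 t) ->
  (forall t, \int[leb]_x H1 (tupd t i x) = \int[leb]_x H2 (tupd t i x)) ->
  \int[lebn N]_t H1 t = \int[lebn N]_t H2 t.
Proof.
move=> m1 p1 m2 p2 H12; apply/eqP; rewrite eq_le.
by rewrite !(@tuple_section_le _ i)// => t; rewrite H12.
Qed.

Section Coords.
Context (N : nat).
Local Notation coords := (N.-tuple T * N.-tuple T)%type.

Definition cupd (p : coords) (i : 'I_N) (z : T * T) : coords :=
  (tupd p.1 i z.1, tupd p.2 i z.2).

Lemma measurable_cupd d (X : measurableType d) (f : X -> coords) (g : X -> T * T) i :
  measurable_fun setT f -> measurable_fun setT g ->
  measurable_fun setT (fun x => cupd (f x) i (g x)).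
Proof.
move=> mf mg; apply: measurable_fun_pair; apply: measurable_tupd.
- by apply: (measurableT_comp measurable_fst).
- by apply: (measurableT_comp measurable_fst).
- by apply: (measurableT_comp measurable_snd).
- by apply: (measurableT_comp measurable_snd).
Qed.

Definition lebc := (lebn N \x lebn N)%E.

Let w (y : T) : R := \1_(`[0%R, 1%R]%classic : set R) y.

Let mw : measurable_fun setT (w : T -> T).
Proof. by apply: measurable_indic; exact: measurable_itv. Qed.

Let w0 y : (0 <= (w y)%:E). Proof. by rewrite lee_fin. Qed.

Let int_w : \int[leb]_y (w y)%:E = 1.
Proof.
transitivity (\int[leb]_y (\1_(`[0%R, 1%R]%classic : set R) y)%:E) => //.
transitivity (leb (`[0%R, 1%R]%classic : set R)).
  by rewrite integral_indic ?setIT//; exact: measurable_itv.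
by rewrite lebesgue_measure_itv /= lte_fin ltr01 -EFinD subr0.
Qed.

(* Averaging over the second coordinate, with the weight [w] keeping the total
   integral, reduces a two-dimensional section to a one-dimensional one. *)
Let K (i : 'I_N) (H : coords -> \bar R) (p : coords) : \bar R :=
  (\int[leb]_y H (p.1, tupd p.2 i y)) * (w (tnth p.2 i))%:E.

Let mK i H : measurable_fun setT H -> (forall p, 0 <= H p) -> measurable_fun setT (K i H).
Proof.
move=> mH H0; apply: emeasurable_funM; last first.
  apply/measurable_EFinP; apply: (measurableT_comp mw).
  by apply: (measurableT_comp (measurable_tnth i)).
apply: (measurable_fun_fubini_tonelli_F (fun q : coords * T => H (q.1.1, tupd q.1.2 i q.2))) => //.
apply: (measurableT_comp mH); apply: measurable_fun_pair.
  by apply: (measurableT_comp measurable_fst).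
by apply: measurable_tupd => //; apply: (measurableT_comp measurable_snd).
Qed.

Let K0 i H p : (forall p, 0 <= H p) -> 0 <= K i H p.
Proof. by move=> H0; rewrite mule_ge0// integral_ge0. Qed.

Let msnd (H : coords -> \bar R) t : measurable_fun setT H ->
  measurable_fun setT (fun s => H (t, s)).
Proof.
by move=> mH; apply: (measurableT_comp mH); exact: measurable_fun_pair.
Qed.

Let mfst (H : coords -> \bar R) t : measurable_fun setT H ->
  measurable_fun setT (fun s => H (s, t)).
Proof.
by move=> mH; apply: (measurableT_comp mH); exact: measurable_fun_pair.
Qed.

Let int_K i H : measurable_fun setT H -> (forall p, 0 <= H p) ->
  \int[lebc]_p K i H p = \int[lebc]_p H p.
Proof.
move=> mH H0; have mKH := mK i mH H0.
rewrite /lebc (fubini_tonelli1 (K i H) mKH (fun p => K0 i p H0)) (fubini_tonelli1 H mH H0).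
apply: eq_integral => t _; apply: (tuple_section_eq (i := i)).
- exact: msnd.
- by move=> s; exact: K0.
- exact: msnd.
- by [].
move=> s; rewrite /K /=.
transitivity (\int[leb]_x ((\int[leb]_y H (t, tupd s i y)) * (w x)%:E)).
  apply: eq_integral => x _; rewrite tnth_tupd eqxx; congr (_ * _).
  by apply: eq_integral => y _; rewrite tupd_tupd.
rewrite ge0_integralZl//; first by rewrite int_w mule1.
  exact/measurable_EFinP.
exact: integral_ge0.
Qed.

(** The two real coordinates of one complex entry lie in different tuples. Passing to [K i H], of
    the same total integral, moves the double section into a single section of the first tuple, with
    a common nonnegative weight on both sides. *)
Lemma coords_section_le (i : 'I_N) (H1 H2 : coords -> \bar R) :
  measurable_fun setT H1 -> (forall p, 0 <= H1 p) ->
  measurable_fun setT H2 -> (forall p, 0 <= H2 p) ->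
  (forall p, \int[leb]_x \int[leb]_y H1 (cupd p i (x, y)) <=
             \int[leb]_x \int[leb]_y H2 (cupd p i (x, y))) ->
  \int[lebc]_p H1 p <= \int[lebc]_p H2 p.
Proof.
move=> m1 p1 m2 p2 H12; rewrite -(int_K i m1 p1) -(int_K i m2 p2).
rewrite /lebc (fubini_tonelli2 (K i H1) (mK i m1 p1) (fun p => K0 i p p1)).
rewrite (fubini_tonelli2 (K i H2) (mK i m2 p2) (fun p => K0 i p p2)).
apply: ge0_le_integral => //.
- by move=> s _; apply: integral_ge0 => t _; exact: K0.
- by apply: (measurable_fun_fubini_tonelli_G (K i H1) (mK i m1 p1)) => ?; exact: K0.
- by apply: (measurable_fun_fubini_tonelli_G (K i H2) (mK i m2 p2)) => ?; exact: K0.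
move=> s _; apply: (@tuple_section_le _ i).
- by apply: mfst; exact: mK.
- by move=> t; exact: K0.
- by apply: mfst; exact: mK.
- by move=> t; exact: K0.
move=> t; rewrite /K /=.
have mm H : measurable_fun setT H -> (forall p, 0 <= H p) ->
    measurable_fun setT (fun x => \int[leb]_y H (tupd t i x, tupd s i y)).
  move=> mH H0; apply: (measurable_fun_fubini_tonelli_F (fun q : T * T => H (tupd t i q.1, tupd s i q.2))) => //.
  by apply: (measurableT_comp mH); apply: measurable_fun_pair; apply: measurable_tupd.
rewrite !ge0_integralZr//; try exact: mm; try by move=> x _; exact: integral_ge0.
by rewrite lee_wpmul2r//; exact: (H12 (t, s)).
Qed.

Lemma coords_section_eq (i : 'I_N) (H1 H2 : coords -> \bar R) :
  measurable_fun setT H1 -> (forall p, 0 <= H1 p) ->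
  measurable_fun setT H2 -> (forall p, 0 <= H2 p) ->
  (forall p, \int[leb]_x \int[leb]_y H1 (cupd p i (x, y)) =
             \int[leb]_x \int[leb]_y H2 (cupd p i (x, y))) ->
  \int[lebc]_p H1 p = \int[lebc]_p H2 p.
Proof.
move=> m1 p1 m2 p2 H12; apply/eqP; rewrite eq_le.
by rewrite !(@coords_section_le i)// => t; rewrite H12.
Qed.

End Coords.

End TupleSection.

Section SymIndex.

Lemma tri_succ m : ((m.+1 * m.+2)./2 = (m * m.+1)./2 + m.+1)%N.
Proof.
have -> : (m.+1 * m.+2 = m * m.+1 + m.+1.*2)%N by rewrite -mul2n -mulnDl mulnC addn2.
by rewrite halfD doubleK odd_double andbF.
Qed.

Lemma leq_tri m p : (m <= p)%N -> ((m * m.+1)./2 <= (p * p.+1)./2)%N.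
Proof. by move=> mp; apply: half_leq; rewrite leq_mul. Qed.

Lemma sym_indexC i j : sym_index i j = sym_index j i.
Proof. by rewrite /sym_index maxnC minnC. Qed.

Lemma sym_index_le i j : (i <= j)%N -> sym_index i j = ((j * j.+1)./2 + i)%N.
Proof. by move=> ij; rewrite /sym_index (maxn_idPr ij) (minn_idPl ij). Qed.

Lemma sym_index_lt n i j : (i < n)%N -> (j < n)%N -> (sym_index i j < (n * n.+1)./2)%N.
Proof.
wlog ij : i j / (i <= j)%N => [H ni nj|ni nj].
  by case: (leqP i j) => [/H|/ltnW/H]; rewrite 1?[sym_index i j]sym_indexC; apply.
rewrite (sym_index_le ij) (@leq_trans (j.+1 * j.+2)./2)//; last exact: leq_tri.
by rewrite tri_succ ltn_add2l ltnS.
Qed.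

(** The indices with larger entry [j] fill the interval of [j + 1] integers from the [j]-th
    triangular number on; these intervals are disjoint. *)
Lemma sym_index_inj i j i' j' : sym_index i j = sym_index i' j' ->
  (i = i' /\ j = j') \/ (i = j' /\ j = i').
Proof.
wlog ij : i j / (i <= j)%N => [H|].
  case: (leqP i j) => [/H//|/ltnW/H]; rewrite [sym_index i j]sym_indexC => {}H /H[].
    by move=> [-> ->]; right.
  by move=> [-> ->]; left.
wlog ij' : i' j' / (i' <= j')%N => [H|].
  case: (leqP i' j') => [/H//|/ltnW/H]; rewrite [sym_index i' j']sym_indexC => {}H /H[].
    by move=> [-> ->]; right.
  by move=> [-> ->]; left.
rewrite !sym_index_le// => E.
have F a b c d : (a <= b)%N -> ((b * b.+1)./2 + a = (d * d.+1)./2 + c)%N -> (d <= b)%N.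
  move=> ab Eq; rewrite leqNgt; apply/negP => /leq_tri.
  by rewrite tri_succ => /leq_trans/(_ (leq_addr c _)); rewrite -Eq leq_add2l leqNgt ltnS ab.
have jj : j = j' by apply/eqP; rewrite eqn_leq (F _ _ _ _ ij' (esym E)) (F _ _ _ _ ij E).
by left; split=> //; move: E; rewrite jj => /addnI.
Qed.

Lemma sym_index_surj n m : (m < (n * n.+1)./2)%N ->
  exists i j, [/\ (i < n)%N, (j < n)%N & sym_index i j = m].
Proof.
elim: n => [//|n IH]; rewrite tri_succ => mn.
have [/IH[i [j [ni nj E]]]|h] := ltnP m (n * n.+1)./2.
  by exists i, j; rewrite !ltnS ltnW// ltnW.
exists (m - (n * n.+1)./2)%N, n.
have ml : (m - (n * n.+1)./2 < n.+1)%N by rewrite ltn_subLR.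
by rewrite ml ltnSn sym_index_le// subnKC.
Qed.

End SymIndex.

Section MatrixCoords.
Context (R : realType) (n : nat).
Local Notation C := R[i].
Local Notation T := (measurableTypeR R).
Local Notation leb := (@lebesgue_measure R).
Local Notation N := ((n * n.+1)./2).
Local Notation coords := (N.-tuple T * N.-tuple T)%type.
Implicit Types (Z : 'M[C]_n) (p : coords) (m : 'I_N).

Definition sidx (i j : 'I_n) : 'I_N := Ordinal (sym_index_lt (ltn_ord i) (ltn_ord j)).

Lemma sidxC i j : sidx i j = sidx j i.
Proof. by apply: val_inj; rewrite /= sym_indexC. Qed.

Lemma sidx_eq i j i' j' : (sidx i j == sidx i' j') =
  ((i == i') && (j == j')) || ((i == j') && (j == i')).
Proof.
apply/eqP/idP => [/(congr1 val)/= /sym_index_inj[] []|].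
- by move=> /val_inj -> /val_inj ->; rewrite !eqxx.
- by move=> /val_inj -> /val_inj ->; rewrite !eqxx orbT.
by case/orP => /andP[/eqP-> /eqP->]; rewrite // sidxC.
Qed.

Lemma sidx_surj m : exists ij : 'I_n * 'I_n, sidx ij.1 ij.2 == m.
Proof.
have [i [j [ni nj E]]] := sym_index_surj (ltn_ord m).
by exists (Ordinal ni, Ordinal nj); apply/eqP/val_inj.
Qed.

Definition sidx_inv m : 'I_n * 'I_n := xchoose (sidx_surj m).

Lemma sidx_invK m : sidx (sidx_inv m).1 (sidx_inv m).2 = m.
Proof. exact/eqP/(xchooseP (sidx_surj m)). Qed.

Lemma siegel_ptE p i j :
  siegel_pt p i j = Complex (tnth p.1 (sidx i j)) (tnth p.2 (sidx i j)).
Proof. by rewrite mxE !(tnth_nth 0). Qed.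

Lemma siegel_pt_sym p : (siegel_pt p)^T = siegel_pt p :> 'M[C]_n.
Proof. by apply/matrixP => i j; rewrite mxE !siegel_ptE sidxC. Qed.

Definition setc Z m (z : C) : 'M[C]_n := \matrix_(i, j) if sidx i j == m then z else Z i j.

Lemma siegel_pt_cupd p m (x y : T) :
  siegel_pt (cupd p m (x, y)) = setc (siegel_pt p) m (Complex x y) :> 'M[C]_n.
Proof. apply/matrixP => i j; rewrite siegel_ptE /= !tnth_tupd [RHS]mxE siegel_ptE.
by case: eqP. Qed.

Lemma setc_sym Z m z : Z^T = Z -> (setc Z m z)^T = setc Z m z.
Proof. by move=> /matrixP sZ; apply/matrixP => i j; rewrite !mxE sidxC -sZ mxE. Qed.

Definition mx_coords Z : coords :=
  ([tuple complex.Re (Z (sidx_inv m).1 (sidx_inv m).2) : T | m < N],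
   [tuple complex.Im (Z (sidx_inv m).1 (sidx_inv m).2) : T | m < N]).

Lemma sym_sidx Z i j i' j' : Z^T = Z -> sidx i j = sidx i' j' -> Z i j = Z i' j'.
Proof.
move=> /matrixP sZ /eqP; rewrite sidx_eq => /orP[]/andP[/eqP-> /eqP->] //.
by rewrite -sZ mxE.
Qed.

Lemma mx_coordsK Z : Z^T = Z -> siegel_pt (mx_coords Z) = Z.
Proof.
move=> sZ; apply/matrixP => i j; rewrite siegel_ptE !tnth_mktuple.
rewrite (@sym_sidx _ (sidx_inv (sidx i j)).1 (sidx_inv (sidx i j)).2 i j) ?sidx_invK//.
by case: (Z i j).
Qed.

Definition mx_meas (h : 'M[C]_n -> \bar R) :=
  measurable_fun setT (fun p : coords => h (siegel_pt p)).

Definition mx_measC (f : 'M[C]_n -> C) :=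
  measurable_fun setT (fun p : coords => complex.Re (f (siegel_pt p)) : T) /\
  measurable_fun setT (fun p : coords => complex.Im (f (siegel_pt p)) : T).

Definition mx_int (h : 'M[C]_n -> \bar R) : \bar R := (\int[@lebc R N]_p h (siegel_pt p))%E.

Lemma mx_measC_entry i j : mx_measC (fun Z => Z i j).
Proof.
split.
  rewrite (_ : (fun _ => _) = (fun p : coords => tnth p.1 (sidx i j))); last first.
    by apply/funext => p; rewrite siegel_ptE.
  by apply: (measurableT_comp (measurable_tnth _)).
rewrite (_ : (fun _ => _) = (fun p : coords => tnth p.2 (sidx i j))); last first.
  by apply/funext => p; rewrite siegel_ptE.
by apply: (measurableT_comp (measurable_tnth _)).
Qed.

Lemma mx_measC_cst c : mx_measC (fun=> c).
Proof. by split; exact: measurable_cst. Qed.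

Lemma complex_ReD (z w : C) : complex.Re (z + w) = complex.Re z + complex.Re w.
Proof. by case: z; case: w. Qed.

Lemma complex_ImD (z w : C) : complex.Im (z + w) = complex.Im z + complex.Im w.
Proof. by case: z; case: w. Qed.

Lemma complex_ReM (z w : C) : complex.Re (z * w) =
  complex.Re z * complex.Re w - complex.Im z * complex.Im w.
Proof. by case: z; case: w. Qed.

Lemma complex_ImM (z w : C) : complex.Im (z * w) =
  complex.Re z * complex.Im w + complex.Im z * complex.Re w.
Proof. by case: z; case: w. Qed.

Lemma complex_ReN (z : C) : complex.Re (- z) = - complex.Re z.
Proof. by case: z. Qed.

Lemma complex_ImN (z : C) : complex.Im (- z) = - complex.Im z.
Proof. by case: z. Qed.

Lemma complex_ReV (z : C) : complex.Re z^-1 = complex.Re z / (complex.Re z ^+ 2 + complex.Im z ^+ 2).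
Proof. by case: z. Qed.

Lemma complex_ImV (z : C) : complex.Im z^-1 = - complex.Im z / (complex.Re z ^+ 2 + complex.Im z ^+ 2).
Proof. by case: z => a b; rewrite /= mulNr. Qed.

Lemma mx_measCD f g : mx_measC f -> mx_measC g -> mx_measC (fun Z => f Z + g Z).
Proof.
move=> [f1 f2] [g1 g2]; split.
  by under eq_fun do rewrite complex_ReD; exact: measurable_funD.
by under eq_fun do rewrite complex_ImD; exact: measurable_funD.
Qed.

Lemma mx_measCM f g : mx_measC f -> mx_measC g -> mx_measC (fun Z => f Z * g Z).
Proof.
move=> [f1 f2] [g1 g2]; split.
  by under eq_fun do rewrite complex_ReM; apply: measurable_funB; apply: measurable_funM.
by under eq_fun do rewrite complex_ImM; apply: measurable_funD; apply: measurable_funM.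
Qed.

Lemma mx_measCN f : mx_measC f -> mx_measC (fun Z => - f Z).
Proof.
move=> [f1 f2]; split.
  by under eq_fun do rewrite complex_ReN; exact: measurable_funN.
by under eq_fun do rewrite complex_ImN; exact: measurable_funN.
Qed.

Lemma mx_measCV f : mx_measC f -> mx_measC (fun Z => (f Z)^-1).
Proof.
move=> [f1 f2].
have H : measurable_fun setT (fun p : coords => (complex.Re (f (siegel_pt p)) ^+ 2 +
     complex.Im (f (siegel_pt p)) ^+ 2)^-1 : T).
  apply: (measurableT_comp (@measurable_inv R)).
  by apply: measurable_funD; apply: measurable_funX.
split.
  by under eq_fun do rewrite complex_ReV; exact: measurable_funM.
by under eq_fun do rewrite complex_ImV; apply: measurable_funM => //; exact: measurable_funN.
Qed.

Lemma mx_meas_comp (h : 'M[C]_n -> \bar R) (phi : 'M[C]_n -> 'M[C]_n) :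
  mx_meas h -> (forall Z, Z^T = Z -> (phi Z)^T = phi Z) ->
  (forall i j, mx_measC (fun Z => phi Z i j)) -> mx_meas (fun Z => h (phi Z)).
Proof.
move=> mh sphi mphi.
rewrite /mx_meas (_ : (fun _ => _) = (fun p => h (siegel_pt (mx_coords (phi (siegel_pt p)))))); last first.
  by apply/funext => p; rewrite mx_coordsK// sphi// siegel_pt_sym.
apply: (measurableT_comp mh); apply: measurable_fun_pair; apply/measurable_fun_tnthP => m.
  rewrite (_ : _ \o _ = fun p => complex.Re (phi (siegel_pt p) (sidx_inv m).1 (sidx_inv m).2)); last first.
    by apply/funext => p /=; rewrite tnth_mktuple.
  exact: (mphi _ _).1.
rewrite (_ : _ \o _ = fun p => complex.Im (phi (siegel_pt p) (sidx_inv m).1 (sidx_inv m).2)); last first.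
  by apply/funext => p /=; rewrite tnth_mktuple.
exact: (mphi _ _).2.
Qed.

Local Open Scope ereal_scope.

Lemma mx_section_meas h Z m : mx_meas h -> Z^T = Z ->
  measurable_fun setT (fun q : T * T => h (setc Z m (Complex q.1 q.2))).
Proof.
move=> mh sZ.
rewrite (_ : (fun _ => _) = (fun q : T * T => h (siegel_pt (cupd (mx_coords Z) m q)))); last first.
  by apply/funext => -[x y]; rewrite siegel_pt_cupd mx_coordsK.
apply: (measurableT_comp mh).
by apply: measurable_cupd.
Qed.

Lemma mx_section_eq m (h1 h2 : 'M[C]_n -> \bar R) :
  mx_meas h1 -> (forall Z, 0 <= h1 Z) -> mx_meas h2 -> (forall Z, 0 <= h2 Z) ->
  (forall Z, Z^T = Z -> I2 (fun q : T * T => h1 (setc Z m (Complex q.1 q.2))) =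
                        I2 (fun q : T * T => h2 (setc Z m (Complex q.1 q.2)))) ->
  mx_int h1 = mx_int h2.
Proof.
move=> m1 p1 m2 p2 H; apply: (coords_section_eq (i := m)) => // p.
have := H _ (siegel_pt_sym p); rewrite /I2.
by under eq_integral do under eq_integral do rewrite -siegel_pt_cupd; under [X in _ = X -> _]eq_integral do under eq_integral do rewrite -siegel_pt_cupd.
Qed.

Lemma mx_section_le m (h1 h2 : 'M[C]_n -> \bar R) :
  mx_meas h1 -> (forall Z, 0 <= h1 Z) -> mx_meas h2 -> (forall Z, 0 <= h2 Z) ->
  (forall Z, Z^T = Z -> I2 (fun q : T * T => h1 (setc Z m (Complex q.1 q.2))) <=
                        I2 (fun q : T * T => h2 (setc Z m (Complex q.1 q.2)))) ->
  mx_int h1 <= mx_int h2.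
Proof.
move=> m1 p1 m2 p2 H; apply: (coords_section_le (i := m)) => // p.
have := H _ (siegel_pt_sym p); rewrite /I2.
by under eq_integral do under eq_integral do rewrite -siegel_pt_cupd; under [X in _ <= X -> _]eq_integral do under eq_integral do rewrite -siegel_pt_cupd.
Qed.

Lemma I2_affine (h : T * T -> \bar R) (k t : C) : measurable_fun setT h -> (forall q, 0 <= h q) ->
  k != 0%R ->
  (cabs k ^+ 2)%:E * I2 (fun q => h (complex.Re (k * Complex q.1 q.2 + t)%R, complex.Im (k * Complex q.1 q.2 + t)%R)) = I2 h.
Proof.
move=> mh h0 k0; rewrite -(I2_shift mh h0 (complex.Re t) (complex.Im t)).
pose h' (q : T * T) := h (q.1 + complex.Re t, q.2 + complex.Im t)%R.
have mh' : measurable_fun setT h'.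
  by apply: measurable_pair_comp => //; apply: measurable_funD.
have k0' : (complex.Re k ^+ 2 + complex.Im k ^+ 2 != 0)%R by rewrite -cabs_sqr sqrf_eq0 cabs_eq0.
rewrite -[RHS](I2_cmul mh' (fun q => h0 _) k0') -cabs_sqr; congr (_ * I2 _).
apply/funext => -[x y]; rewrite /h' /=.
case: k {k0 k0'} => a b; case: t {h' mh'} => c d /=.
by congr (h (_, _)); rewrite /=; ring.
Qed.

Section TriangularAffine.
Context (kap tau : 'M[C]_n -> 'I_N -> C).

(** The entries with index in [s] undergo a complex affine map whose coefficients may depend on the
    other entries: a triangular substitution. *)
Definition taff (s : seq 'I_N) Z : 'M[C]_n :=
  \matrix_(i, j) if sidx i j \in s then (kap Z (sidx i j) * Z i j + tau Z (sidx i j))%R else Z i j.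

Definition tjac (s : seq 'I_N) Z : R := (\prod_(m <- s) cabs (kap Z m) ^+ 2)%R.

Lemma taff_sym s Z : Z^T = Z -> (taff s Z)^T = taff s Z.
Proof. by move=> /matrixP sZ; apply/matrixP => i j; rewrite !mxE sidxC -sZ mxE. Qed.

Context (kap0 : forall Z m, kap Z m != 0%R)
  (mkap : forall m, mx_measC (kap ^~ m)) (mtau : forall m, mx_measC (tau ^~ m)).

Lemma mx_meas_taff s i j : mx_measC (fun Z => taff s Z i j).
Proof.
rewrite (_ : (fun _ => _) = if sidx i j \in s then
    (fun Z => (kap Z (sidx i j) * Z i j + tau Z (sidx i j))%R) else (fun Z => Z i j)); last first.
  by apply/funext => Z; rewrite mxE; case: ifP.
case: ifP => _; last exact: mx_measC_entry.
by apply: mx_measCD => //; apply: mx_measCM => //; exact: mx_measC_entry.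
Qed.

Lemma mx_meas_tjac s : mx_meas (fun Z => (tjac s Z)%:E).
Proof.
apply/measurable_EFinP; rewrite /tjac; elim: s => [|m s IH].
  by under eq_fun do rewrite big_nil; exact: measurable_cst.
under eq_fun do rewrite big_cons; apply: measurable_funM => //.
under eq_fun do rewrite cabs_sqr.
by apply: measurable_funD; apply: measurable_funX; [exact: (mkap m).1|exact: (mkap m).2].
Qed.

(** The coefficients do not depend on the entries being moved, so these can be moved one after the
    other; each section is a one-variable affine map with real Jacobian [|kap|^2]. *)
Lemma mx_int_taff s (h : 'M[C]_n -> \bar R) : uniq s ->
  (forall Z m z, Z^T = Z -> m \in s -> kap (setc Z m z) = kap Z /\ tau (setc Z m z) = tau Z) ->
  mx_meas h -> (forall Z, 0 <= h Z) ->
  mx_int (fun Z => (tjac s Z)%:E * h (taff s Z)) = mx_int h.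
Proof.
move=> + + mh h0; elim: s => [_ _|m s IH /= /andP[ms us] indep].
  congr integral; apply/funext => p; rewrite /tjac big_nil mul1e; congr h.
  by apply/matrixP => i j; rewrite mxE.
have jac0 s' Z : (0 <= tjac s' Z)%R by apply: prodr_ge0 => i _; rewrite sqr_ge0.
have mm s' : mx_meas (fun Z => (tjac s' Z)%:E * h (taff s' Z)).
  apply: emeasurable_funM; first exact: mx_meas_tjac.
  by apply: mx_meas_comp => //; [move=> Z; exact: taff_sym|move=> i j; exact: mx_meas_taff].
rewrite -IH//; last by move=> Z k z sZ ks; apply: indep => //; rewrite inE ks orbT.
have p0 s' Z : 0 <= (tjac s' Z)%:E * h (taff s' Z) by rewrite mule_ge0// lee_fin.
apply: (mx_section_eq (m := m) (mm (m :: s)) (p0 (m :: s)) (mm s) (p0 s)) => Z sZ.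
have E z := indep Z m z sZ (mem_head _ _).
have jacE s' z : tjac s' (setc Z m z) = tjac s' Z by rewrite /tjac (E z).1.
have affE1 z : taff (m :: s) (setc Z m z) = setc (taff s Z) m (kap Z m * z + tau Z m)%R.
  apply/matrixP => i j; rewrite !mxE inE (E z).1 (E z).2.
  by case: (eqVneq (sidx i j) m) => [->|_]//.
have affE2 z : taff s (setc Z m z) = setc (taff s Z) m z.
  apply/matrixP => i j; rewrite !mxE (E z).1 (E z).2.
  by case: (eqVneq (sidx i j) m) => [->|_]//; rewrite (negbTE ms).
have sY := taff_sym s sZ.
have mq := mx_section_meas m mh sY.
have q0 (q : T * T) : 0 <= h (setc (taff s Z) m (Complex q.1 q.2)) by [].
have mint (f : T * T -> \bar R) : measurable_fun setT f -> (forall q, 0 <= f q) -> forall c : R, (0 <= c)%R ->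
   I2 (fun q => c%:E * f q) = c%:E * I2 f.
  move=> mf f0 c c0; rewrite /I2 -ge0_integralZl//; first last.
  - by move=> x _; exact: integral_ge0.
  - exact: (measurable_fun_fubini_tonelli_F f mf).
  apply: eq_integral => x _; rewrite ge0_integralZl//.
  by apply: measurable_pair_comp => //.
pose G (q : T * T) := h (setc (taff s Z) m (Complex q.1 q.2)).
pose v (q : T * T) := (kap Z m * Complex q.1 q.2 + tau Z m)%R.
pose G' (q : T * T) := G (complex.Re (v q), complex.Im (v q)).
have mG' : measurable_fun setT G'.
  apply: (measurableT_comp mq); rewrite /v; case: (kap Z m) => a b; case: (tau Z m) => c d.
  apply: measurable_fun_pair => /=.
    by apply: measurable_funD => //; apply: measurable_funB; apply: measurable_funM.
  by apply: measurable_funD => //; apply: measurable_funD; apply: measurable_funM.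
have E1 q : (tjac (m :: s) (setc Z m (Complex q.1 q.2)))%:E *
    h (taff (m :: s) (setc Z m (Complex q.1 q.2))) = (tjac (m :: s) Z)%:E * G' q.
  by rewrite jacE affE1 /G' /G /v; case: (_ + _)%R.
have E2 q : (tjac s (setc Z m (Complex q.1 q.2)))%:E *
    h (taff s (setc Z m (Complex q.1 q.2))) = (tjac s Z)%:E * G q.
  by rewrite jacE affE2.
rewrite (funext E1) (funext E2) (mint G' mG' (fun q => q0 _) _ (jac0 _ _)).
rewrite (mint G mq q0 _ (jac0 _ _)) -(I2_affine (tau Z m) mq q0 (kap0 Z m)).
by rewrite {1}/tjac big_cons mulrC EFinM -muleA.
Qed.

End TriangularAffine.

End MatrixCoords.

(** * Invariance of the measure *)

Section Invariance.
Context (R : realType) (n : nat).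
Local Notation C := R[i].
Local Notation T := (measurableTypeR R).
Local Notation N := ((n * n.+1)./2).
Local Notation coords := (N.-tuple T * N.-tuple T)%type.
Implicit Types (Z : 'M[C]_n) (p : coords) (m : 'I_N) (h : 'M[C]_n -> \bar R).
Local Open Scope ereal_scope.

(** Extension by zero lets every integral run over all symmetric matrices, so that coordinate
    substitutions carry no domain. *)
Definition mxH h Z : \bar R := if `[< siegel_space Z >] then h Z else 0.

Definition sdens Z : R := ((\det (ImM Z)) ^- n.+1)%R.

Definition sint h : \bar R := mx_int (fun Z => mxH h Z * (sdens Z)%:E).

Definition mx_measR (f : 'M[C]_n -> R) :=
  measurable_fun setT (fun p : coords => f (siegel_pt p) : T).

Lemma mx_measR_detIm : mx_measR (fun Z => \det (ImM Z)).
Proof.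
rewrite /mx_measR /determinant.
apply: (@measurable_sum _ _ _ setT) => s.
apply: measurable_funM => //.
elim: (index_enum _) => [|i r IH].
  by under eq_fun do rewrite big_nil; exact: measurable_cst.
under eq_fun do rewrite big_cons; apply: measurable_funM => //.
by under eq_fun do rewrite mxE; exact: (@mx_measC_entry R n _ _).2.
Qed.

Lemma mx_measR_inv (f : 'M[C]_n -> R) : mx_measR f -> mx_measR (fun Z => (f Z)^-1)%R.
Proof. by move=> mf; exact: (measurableT_comp (@measurable_inv R) mf). Qed.

Lemma mx_measR_X k (f : 'M[C]_n -> R) : mx_measR f -> mx_measR (fun Z => (f Z) ^+ k)%R.
Proof. by move=> mf; exact: measurable_funX. Qed.

Lemma mx_meas_mulR h (f : 'M[C]_n -> R) : mx_meas h -> mx_measR f ->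
  mx_meas (fun Z => h Z * (f Z)%:E).
Proof. by move=> mh mf; apply: emeasurable_funM => //; exact/measurable_EFinP. Qed.

Lemma mx_measR_dens : mx_measR sdens.
Proof. by apply: mx_measR_inv; apply: mx_measR_X; exact: mx_measR_detIm. Qed.

Lemma mx_meas_dens h : mx_meas (mxH h) -> mx_meas (fun Z => mxH h Z * (sdens Z)%:E).
Proof. by move=> mh; apply: mx_meas_mulR => //; exact: mx_measR_dens. Qed.

Lemma detIm_gt0 Z : siegel_space Z -> (0 < \det (ImM Z))%R.
Proof. by move=> [_]; exact: posdef_det_gt0. Qed.

Lemma mxH_ge0 h Z : (forall Z, siegel_space Z -> 0 <= h Z) -> 0 <= mxH h Z.
Proof. by move=> h0; rewrite /mxH; case: asboolP => // /h0. Qed.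

Lemma mxH_dens_ge0 h Z : (forall Z, siegel_space Z -> 0 <= h Z) -> 0 <= mxH h Z * (sdens Z)%:E.
Proof.
move=> h0; rewrite /mxH; case: asboolP => [sZ|_]; last by rewrite mul0e.
by rewrite mule_ge0 ?h0// lee_fin invr_ge0 exprn_ge0// ltW// detIm_gt0.
Qed.

Lemma eq_mx_int h1 h2 : (forall Z, Z^T = Z -> h1 Z = h2 Z) -> mx_int h1 = mx_int h2.
Proof.
move=> H; rewrite /mx_int; congr integral; apply/funext => p.
by apply: H; exact: siegel_pt_sym.
Qed.

Lemma eq_mx_meas h1 h2 : (forall Z, Z^T = Z -> h1 Z = h2 Z) -> mx_meas h1 -> mx_meas h2.
Proof.
move=> H; rewrite /mx_meas (_ : (fun p => h1 _) = (fun p => h2 (siegel_pt p)))//.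
by apply/funext => p; apply: H; exact: siegel_pt_sym.
Qed.

(** Measurability of the composite is part of the property because the second factor of a product is
    applied to it. *)
Definition sp_invariant (g : 'M[R]_(n + n)) := forall h, (forall Z, siegel_space Z -> 0 <= h Z) ->
  mx_meas (mxH h) ->
  mx_meas (mxH (h \o siegel_act g)) /\ sint (h \o siegel_act g) = sint h.

Lemma eq_mxH h1 h2 : (forall Z, siegel_space Z -> h1 Z = h2 Z) -> mxH h1 = mxH h2.
Proof.
by move=> H; apply/funext => Z; rewrite /mxH; case: asboolP => // /H.
Qed.

Lemma sp_invariant_mul g1 g2 : symplectic g1 -> symplectic g2 ->
  sp_invariant g1 -> sp_invariant g2 -> sp_invariant (g1 *m g2).
Proof.
move=> s1 s2 I1 I2 h h0 mh; have [m1 e1] := I1 h h0 mh.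
have [|m2 e2] := I2 (h \o siegel_act g1) _ m1.
  by move=> Z sZ; apply: h0; exact: siegel_act_space.
have E : mxH (h \o siegel_act (g1 *m g2)) = mxH ((h \o siegel_act g1) \o siegel_act g2).
  by apply: eq_mxH => Z sZ /=; rewrite siegel_act_mul.
by rewrite /sint E; split; [exact: m2|exact: (etrans e2 e1)].
Qed.

Lemma siegel_act_trans S Z : siegel_act (sp_trans S) Z = (Z + toC S)%R.
Proof.
rewrite /siegel_act /autfactor /sp_trans block_mxKul block_mxKur block_mxKdl block_mxKdr.
by rewrite /toC map_mx0 map_mx1 mul0mx add0r mul1mx invmx1 mulmx1.
Qed.

Lemma ImM_addR Z S : ImM (Z + toC S)%R = ImM Z.
Proof. by apply/matrixP => i j; rewrite !mxE complex_ImD /= addr0. Qed.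

Lemma toC_sym (S : 'M[R]_n) : S^T = S -> (toC S)^T = toC S.
Proof. by move=> sS; rewrite /toC map_trmx sS. Qed.

Lemma siegel_space_addR Z S : S^T = S -> siegel_space (Z + toC S)%R <-> siegel_space Z.
Proof.
move=> sS; rewrite /siegel_space /= ImM_addR raddfD /= (toC_sym sS).
by split => -[E pd]; split => //; [move/addIr: E|rewrite E].
Qed.

Lemma sp_invariant_trans S : S^T = S -> sp_invariant (sp_trans S).
Proof.
move=> sS h h0 mh.
pose tau Z m := toC S (sidx_inv m).1 (sidx_inv m).2.
have EH Z : mxH (h \o siegel_act (sp_trans S)) Z = mxH h (Z + toC S)%R.
  rewrite /mxH /= siegel_act_trans.
  by rewrite (asbool_equiv_eq (siegel_space_addR Z sS)).
have tE Z : taff (fun _ _ => 1%R) tau (enum 'I_N) Z = (Z + toC S)%R.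
  apply/matrixP => i j; rewrite [LHS]mxE [RHS]mxE mem_enum inE mul1r /tau.
  by congr (_ + _)%R; exact: sym_sidx (toC_sym sS) (sidx_invK _).
split.
  rewrite (funext EH); apply: (mx_meas_comp (phi := fun Z => (Z + toC S)%R)) => //.
    by move=> Z sZ; rewrite raddfD /= sZ toC_sym.
  move=> i j; under [X in mx_measC X]eq_fun do rewrite mxE.
  by apply: mx_measCD; [exact: mx_measC_entry|exact: mx_measC_cst].
rewrite /sint -[RHS](@mx_int_taff _ _ (fun _ _ => 1%R) tau _ _ _ (enum 'I_N)); first last.
- by move=> Z; exact: mxH_dens_ge0.
- exact: mx_meas_dens.
- by [].
- exact: enum_uniq.
- by move=> m; exact: mx_measC_cst.
- by move=> m; exact: mx_measC_cst.
- by move=> Z m; rewrite oner_neq0.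
apply: eq_mx_int => Z _; rewrite tE EH /tjac big1 ?mul1e; last first.
  by move=> m _; rewrite cabs1 expr1n.
by rewrite /sdens ImM_addR.
Qed.

Section PartialInversion.
Context (l : 'I_n).

(** The action of [sp_pinv] in coordinates, defined on all matrices: off the row and column [l] it
    is the Schur complement of the entry [(l, l)]. *)
Definition pinv_map Z : 'M[C]_n := (\matrix_(i, j)
  if (i == l) && (j == l) then - (Z l l)^-1
  else if i == l then Z l j / Z l l
  else if j == l then Z i l / Z l l
  else Z i j - Z i l * Z l j / Z l l)%R.

Lemma pinv_map_sym Z : Z^T = Z -> (pinv_map Z)^T = pinv_map Z.
Proof.
move=> /matrixP sZ; have E i j : Z i j = Z j i by rewrite -sZ mxE.
apply/matrixP => i j; rewrite !mxE; case: (eqVneq i l) => [?|il]; case: (eqVneq j l) => [?|jl] //=; try subst i; try subst j.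
- by rewrite E.
- by rewrite E.
- by rewrite (E j i) (E j l) (E l i) (mulrC (Z l j)).
Qed.

(** The square only changes the sign of the entries in row or column [l] off the diagonal, so the
    fourth power is the identity. *)
Lemma pinv_map4 Z : Z l l != 0%R -> pinv_map (pinv_map (pinv_map (pinv_map Z))) = Z.
Proof.
move=> z0.
have D (W : 'M[C]_n) : W l l != 0%R -> pinv_map (pinv_map W) =
    (\matrix_(i, j) if (i == l) (+) (j == l) then - W i j else W i j)%R.
  move=> w0; apply/matrixP => i j; rewrite !mxE !eqxx /=.
  case: (eqVneq i l) => [?|il]; case: (eqVneq j l) => [?|jl] /=; try subst i; try subst j.
  - by rewrite invrN opprK invrK.
  - by field.
  - by field.
  - by field.
rewrite D; last by rewrite D// mxE eqxx.
rewrite D//; apply/matrixP => i j; rewrite !mxE.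
by case: (eqVneq i l) => [?|il]; case: (eqVneq j l) => [?|jl] /=; rewrite ?opprK.
Qed.

Lemma autfactor_pinv Z i j : autfactor (sp_pinv R l) Z i j = if i == l then Z l j else (i == j)%:R%R.
Proof.
rewrite /autfactor /sp_pinv /sp_pinv_mx block_mxKdl block_mxKdr /toC map_mxB map_mx1 map_delta_mx mxE.
rewrite [X in (X + _)%R]mxE (bigD1 l)//= big1 ?addr0; last first.
  by move=> k kl; rewrite !mxE (negbTE kl) andbF mul0r.
rewrite !mxE !eqxx andbT.
case: (eqVneq i l) => [->|il] /=.
  by rewrite mul1r [l == j]eq_sym; case: (eqVneq j l) => _ /=; rewrite ?subrr ?addr0.
by rewrite mul0r add0r subr0.
Qed.

Lemma det_autfactor_pinv Z : \det (autfactor (sp_pinv R l) Z) = Z l l.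
Proof.
rewrite /determinant (bigD1 (1%g : {perm 'I_n}))//= [X in (_ + X)%R]big1 ?addr0.
  rewrite odd_perm1 expr0 mul1r (bigD1 l)//= big1 ?mulr1.
    by rewrite perm1 autfactor_pinv eqxx.
  by move=> i il; rewrite perm1 autfactor_pinv (negbTE il) eqxx.
move=> s s1; suff [i il si] : exists2 i, i != l & s i != i.
  by rewrite (bigD1 i)//= autfactor_pinv (negbTE il) eq_sym (negbTE si) mul0r mulr0.
apply: contrapT => H; case/negP: s1; apply/eqP.
have Hi i : i != l -> s i = i.
  by move=> il; apply: contrapT => /eqP si; apply: H; exists i.
apply/permP => i; rewrite perm1; have [->|/Hi//] := eqVneq i l.
apply: contrapT => /eqP sl; have := Hi _ sl => /perm_inj/eqP.
by rewrite (negbTE sl).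
Qed.

Lemma siegel_act_pinv Z : siegel_space Z -> siegel_act (sp_pinv R l) Z = pinv_map Z.
Proof.
move=> sZ; have sl := symplectic_pinv R l.
have z0 : Z l l != 0%R.
  by have := autfactor_unit sl sZ; rewrite unitmxE det_autfactor_pinv unitfE.
have u := autfactor_unit sl sZ.
apply: (can_inj (mulmxK u)); rewrite siegel_actM//.
apply/matrixP => i j; rewrite [RHS]mxE (bigD1 l)//= autfactor_pinv eqxx.
have -> : (\sum_(k < n | k != l) pinv_map Z i k * autfactor (sp_pinv R l) Z k j =
   if j == l then 0 else pinv_map Z i j)%R.
  have [->|jl] := eqVneq j l.
    by rewrite big1// => k kl; rewrite autfactor_pinv (negbTE kl) mulr0.
  rewrite (bigD1 j)//= autfactor_pinv (negbTE jl) eqxx mulr1 big1 ?addr0//.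
  by move=> k /andP[kl kj]; rewrite autfactor_pinv (negbTE kl) (negbTE kj) mulr0.
rewrite /numfactor /sp_pinv /sp_pinv_mx block_mxKul block_mxKur /toC map_mxB map_mxN map_mx1 map_delta_mx mxE.
rewrite [X in (X + _)%R = _]mxE.
have -> : (\sum_k (1%:M - delta_mx l l : 'M[C]_n) i k * Z k j = if i == l then 0 else Z i j)%R.
  rewrite (bigD1 i)//= big1 ?addr0.
    rewrite !mxE eqxx andbb; case: (eqVneq i l) => _ /=; rewrite ?subrr ?mul0r//.
    by rewrite subr0 mul1r.
  move=> k ki; rewrite !mxE eq_sym (negbTE ki).
  have -> : (i == l) && (k == l) = false.
    by apply/negP => /andP[/eqP il /eqP kl]; rewrite il kl eqxx in ki.
  by rewrite subrr mul0r.
rewrite !mxE eqxx andbT.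
case: (eqVneq i l) => [?|il]; case: (eqVneq j l) => [?|jl] /=; try subst i; try subst j.
- by rewrite add0r addr0 mulNr mulVf.
- by field.
- by field.
- by field.
Qed.

Lemma siegel_space_diag Z : siegel_space Z -> (0 < complex.Im (Z l l))%R.
Proof.
move=> [_ [_ /(_ (delta_mx l ord0))]].
have d0 : (delta_mx l ord0 : 'cV[R]_n) != 0%R.
  apply/eqP => /matrixP/(_ l ord0); rewrite !mxE !eqxx /= => /eqP.
  by rewrite oner_eq0.
by move=> /(_ d0); rewrite trmx_delta -rowE -colE !mxE.
Qed.

Lemma pinv_map_space Z : Z^T = Z -> (0 < complex.Im (Z l l))%R ->
  siegel_space (pinv_map Z) <-> siegel_space Z.
Proof.
move=> sZ z0; have sl := symplectic_pinv R l.
have step W : siegel_space W -> siegel_space (pinv_map W).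
  by move=> sW; rewrite -siegel_act_pinv//; exact: siegel_act_space.
split; last exact: step.
(* The inverse of the map is its cube, so three more forward steps return to [Z]. *)
move=> /step/step/step; rewrite pinv_map4//.
by apply: contraTneq z0 => ->; rewrite ltxx.
Qed.

Lemma mx_measC_pinv_map i j : mx_measC (fun Z => pinv_map Z i j).
Proof.
have mE a b := @mx_measC_entry R n a b.
have mV := mx_measCV (mE l l).
have -> : (fun Z => pinv_map Z i j) = (if (i == l) && (j == l) then fun Z => - (Z l l)^-1
  else if i == l then fun Z => Z l j / Z l l
  else if j == l then fun Z => Z i l / Z l l
  else fun Z => Z i j - Z i l * Z l j / Z l l)%R.
  by apply/funext => Z; rewrite mxE; do 3?case: ifP => _.
case: ifP => _; first exact: mx_measCN.
case: ifP => _; first exact: mx_measCM.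
case: ifP => _; first exact: mx_measCM.
by apply: mx_measCD => //; apply: mx_measCN; apply: mx_measCM => //; exact: mx_measCM.
Qed.

Lemma mx_meas_if_diag h : mx_meas h ->
  mx_meas (fun Z => if (0 < complex.Im (Z l l))%R then h Z else 0).
Proof.
move=> mh; apply: measurable_fun_ifT => //.
by apply: measurable_fun_ltr => //; exact: (@mx_measC_entry R n l l).2.
Qed.

Let K h Z := mxH h Z * (sdens Z)%:E.

(** The integrand after [z -> -1/z] in the entry [(l, l)] alone, with the real Jacobian [|z|^-4] of
    that map. *)
Let inv_diag h Z := if (0 < complex.Im (Z l l))%R then
  K h (setc Z (sidx l l) (- (Z l l)^-1)%R) * ((cabs (Z l l) ^+ 2) ^- 2)%:E else 0.

Let mx_measR_cabs i j : mx_measR (fun Z => (cabs (Z i j) ^+ 2)%R).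
Proof.
rewrite /mx_measR; under eq_fun do rewrite cabs_sqr.
by apply: measurable_funD; apply: measurable_funX; [exact: (@mx_measC_entry R n i j).1|exact: (@mx_measC_entry R n i j).2].
Qed.

Let mx_measC_setc_inv i j : mx_measC (fun Z => setc Z (sidx l l) (- (Z l l)^-1)%R i j).
Proof.
have -> : (fun Z => setc Z (sidx l l) (- (Z l l)^-1)%R i j) =
    (if sidx i j == sidx l l then fun Z => - (Z l l)^-1 else fun Z => Z i j)%R.
  by apply/funext => Z; rewrite mxE; case: ifP.
case: ifP => _; last exact: mx_measC_entry.
by apply: mx_measCN; apply: mx_measCV; exact: mx_measC_entry.
Qed.

Let m_inv_diag h : mx_meas (mxH h) -> mx_meas (inv_diag h).
Proof.
move=> mh; apply: mx_meas_if_diag.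
apply: mx_meas_mulR; last by apply: mx_measR_inv; apply: mx_measR_X; exact: mx_measR_cabs.
apply: (mx_meas_comp (h := K h) (phi := fun Z => setc Z (sidx l l) (- (Z l l)^-1)%R)).
- exact: mx_meas_dens.
- by move=> Z; exact: setc_sym.
- exact: mx_measC_setc_inv.
Qed.

Let inv_diag_ge0 h Z : (forall Z, siegel_space Z -> 0 <= h Z) -> 0 <= inv_diag h Z.
Proof.
move=> h0; rewrite /inv_diag; case: ifP => // _; rewrite mule_ge0//.
  exact: mxH_dens_ge0.
by rewrite lee_fin invr_ge0 !exprn_ge0// cabs_ge0.
Qed.

Let int_inv_diag h : (forall Z, siegel_space Z -> 0 <= h Z) -> mx_meas (mxH h) ->
  mx_int (K h) = mx_int (inv_diag h).
Proof.
move=> h0 mh; have mK := mx_meas_dens mh.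
have K0 Z : 0 <= K h Z by exact: mxH_dens_ge0.
apply: (@mx_section_eq _ _ (sidx l l) _ _ mK K0 (m_inv_diag mh)) => [Z|Z sZ].
  exact: inv_diag_ge0.
have mq := mx_section_meas (sidx l l) mK sZ.
have q0 (q : T * T) : 0 <= K h (setc Z (sidx l l) (Complex q.1 q.2)) by [].
have E1 : (fun q : T * T => K h (setc Z (sidx l l) (Complex q.1 q.2))) =
    (fun q => if (0 < q.2)%R then K h (setc Z (sidx l l) (Complex q.1 q.2)) else 0).
  apply/funext => q; case: ifPn => // q2; rewrite /K /mxH; case: asboolP; last by rewrite mul0e.
  by move=> /siegel_space_diag; rewrite mxE eqxx /= (negbTE q2).
rewrite E1 (I2_inv mq q0); congr I2; apply/funext => -[x y] /=.
rewrite /inv_diag mxE eqxx /=; case: ifP => // y0.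
rewrite cabs_sqr /=; congr (K h _ * _).
apply/matrixP => i j; rewrite !mxE; case: ifP => // _.
by apply/eqP; rewrite eq_complex /= -mulNr opprK !eqxx.
Qed.

Let s1 : seq 'I_N := [seq sidx l k | k <- enum (predC1 l)].
(** The value 1 at [Z l l = 0] keeps the factor nonzero on all matrices; it is never met where
    [Z l l] has positive imaginary part. *)
Let kap1 Z m : C := (if Z l l == 0 then 1 else (Z l l)^-1)%R.

Let s1P i j : (sidx i j \in s1) = (i == l) (+) (j == l).
Proof.
apply/mapP/idP => [[k]|].
  rewrite mem_enum inE => kl /eqP; rewrite sidx_eq => /orP[]/andP[/eqP-> /eqP->].
    by rewrite eqxx (negbTE kl).
  by rewrite eqxx (negbTE kl).
case: (eqVneq i l) => [->|il]; case: (eqVneq j l) => [->|jl] //= _.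
  by exists j; rewrite // mem_enum inE.
by exists i; rewrite 1?sidxC// mem_enum inE.
Qed.

Let s1_uniq : uniq s1.
Proof.
rewrite map_inj_in_uniq ?enum_uniq// => a b; rewrite !mem_enum !inE => al bl /eqP.
by rewrite sidx_eq eqxx /= => /orP[/eqP//|/andP[/eqP <- /eqP]].
Qed.

Let kap1_neq0 Z m : kap1 Z m != 0%R.
Proof. by rewrite /kap1; case: ifP => [_|/negbT z0]; rewrite ?oner_eq0 ?invr_neq0. Qed.

Let mkap1 m : mx_measC (kap1 ^~ m).
Proof.
have [m1 m2] := @mx_measC_entry R n l l; have [v1 v2] := mx_measCV (@mx_measC_entry R n l l).
have mb : measurable_fun setT (fun p : coords => siegel_pt p l l == 0%R :> C).
  under eq_fun do rewrite eq_complex /=.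
  by apply: measurable_and; apply: measurable_fun_eqr.
split; rewrite /kap1.
  rewrite (_ : (fun _ => _) = (fun p : coords => if siegel_pt p l l == 0%R :> C then 1%R else complex.Re (siegel_pt p l l)^-1%R : T)); last first.
    by apply/funext => p; case: ifP.
  exact: measurable_fun_ifT.
rewrite (_ : (fun _ => _) = (fun p : coords => if siegel_pt p l l == 0%R :> C then 0%R else complex.Im (siegel_pt p l l)^-1%R : T)); last first.
  by apply/funext => p; case: ifP.
exact: measurable_fun_ifT.
Qed.

Let s0 : seq 'I_N := [seq m <- enum 'I_N | ((sidx_inv m).1 != l) && ((sidx_inv m).2 != l)].
Let tau0 Z m : C := (- (Z (sidx_inv m).1 l * Z l (sidx_inv m).2 / Z l l))%R.

Let sidx_inv_cases i j (P : 'I_n -> 'I_n -> Prop) : P i j -> P j i ->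
  P (sidx_inv (sidx i j)).1 (sidx_inv (sidx i j)).2.
Proof.
move=> Pij Pji; have /eqP := sidx_invK (sidx i j).
by rewrite sidx_eq => /orP[]/andP[/eqP-> /eqP->].
Qed.

Let s0P i j : (sidx i j \in s0) = (i != l) && (j != l).
Proof.
rewrite mem_filter mem_enum andbT.
by apply: (@sidx_inv_cases i j (fun a b => (a != l) && (b != l) = (i != l) && (j != l))) => //; rewrite andbC.
Qed.

Let setc_off Z i j z a : sidx i j \in s0 -> setc Z (sidx i j) z a l = Z a l /\ setc Z (sidx i j) z l a = Z l a.
Proof.
rewrite s0P => /andP[il jl]; rewrite !mxE !sidx_eq.
by rewrite ![l == _]eq_sym (negbTE il) (negbTE jl) !andbF.
Qed.

(** The map is a shift of the entries off row and column [l], then a scaling of the remaining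
    entries of that row by [1 / Z l l], then the inversion of [Z l l]; each step reads coefficients
    from entries it does not alter. The Jacobians [1], [|z|^(-2(n-1))] and [|z|^-4] multiply to
    [|z|^(-2(n+1))], the factor compensated by the density [det(Y)^-(n+1)]. *)
Lemma sp_invariant_pinv : sp_invariant (sp_pinv R l).
Proof.
move=> h h0 mh.
have EH f Z : Z^T = Z -> mxH (f \o siegel_act (sp_pinv R l)) Z =
    if (0 < complex.Im (Z l l))%R then mxH f (pinv_map Z) else 0.
  move=> sZ; rewrite /mxH; case: (boolP (0 < complex.Im (Z l l))%R) => z0.
    rewrite (asbool_equiv_eq (pinv_map_space sZ z0)); case: asboolP => // sp.
    by rewrite /= siegel_act_pinv.
  by case: asboolP => // /siegel_space_diag; rewrite (negbTE z0).
split.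
  apply: eq_mx_meas (fun Z sZ => esym (EH h Z sZ)) _.
  apply: mx_meas_if_diag; apply: (mx_meas_comp (phi := pinv_map)) => //.
    exact: pinv_map_sym.
  exact: mx_measC_pinv_map.
rewrite /sint -/(K h) (int_inv_diag h0 mh).
have mi := m_inv_diag mh.
have i0 Z : 0 <= inv_diag h Z by exact: inv_diag_ge0.
rewrite -(@mx_int_taff _ _ kap1 (fun _ _ => 0%R) kap1_neq0 mkap1 (fun m => @mx_measC_cst R n 0%R) s1 _ s1_uniq _ mi i0); last first.
  move=> Z m z sZ /mapP[k]; rewrite mem_enum inE => kl ->; split=> //.
  apply/funext => m'; rewrite /kap1 mxE sidx_eq eqxx /= ![l == k]eq_sym (negbTE kl).
  by rewrite /=.
set G1 := fun Z => _ * inv_diag h _.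
have mG1 : mx_meas G1.
  apply: emeasurable_funM; first by apply: mx_meas_tjac => //; exact: mkap1.
  apply: (mx_meas_comp (phi := taff kap1 (fun _ _ => 0%R) s1)) => //.
    by move=> Z; exact: taff_sym.
  by move=> i j; apply: mx_meas_taff => // m; exact: mx_measC_cst.
have G10 Z : 0 <= G1 Z.
  by rewrite mule_ge0// lee_fin prodr_ge0// => i _; rewrite sqr_ge0.
have mtau0 m : mx_measC (tau0 ^~ m).
  apply: mx_measCN; apply: mx_measCM; last by apply: mx_measCV; exact: mx_measC_entry.
  by apply: mx_measCM; exact: mx_measC_entry.
rewrite -(@mx_int_taff _ _ (fun _ _ => 1%R) tau0 (fun _ _ => oner_neq0 _) (fun m => @mx_measC_cst R n 1%R) mtau0 s0 G1 (filter_uniq _ (enum_uniq _)) _ mG1 G10); last first.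
  move=> Z m z sZ ms; split=> //; apply/funext => m'.
  rewrite -(sidx_invK m) in ms *.
  by rewrite /tau0 (setc_off _ _ _ ms).1 (setc_off _ _ _ ms).2 (setc_off _ _ l ms).1.
apply: eq_mx_int => Z sZ.
have jac1 : tjac (fun _ _ => 1%R) s0 Z = 1%R :> R by rewrite /tjac big1// => i _; rewrite cabs1 expr1n.
rewrite jac1 mul1e EH// /G1 /inv_diag.
set W := taff (fun _ _ => 1%R) tau0 s0 Z; set V := taff kap1 _ s1 W.
have WE : W l l = Z l l by rewrite mxE s0P eqxx.
have VE : V l l = Z l l by rewrite mxE s1P eqxx.
rewrite VE; case: ifPn => z0; last by rewrite mule0 mul0e.
have zn0 : Z l l != 0%R by apply: contraTneq z0 => ->; rewrite ltxx.
have -> : setc V (sidx l l) (- (Z l l)^-1)%R = pinv_map Z.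
  apply/matrixP => i j; rewrite !mxE sidx_eq !s1P !s0P /kap1 WE (negbTE zn0).
  case: (eqVneq i l) => [?|il]; case: (eqVneq j l) => [?|jl] //=; try subst i; try subst j; rewrite ?addr0 1?mulrC//.
  rewrite mulrC mul1r /tau0; congr (_ - _ / _)%R.
  have E a b : Z a b = Z b a by move/matrixP: sZ => <-; rewrite mxE.
  apply: (@sidx_inv_cases i j (fun a b => Z a l * Z l b = Z i l * Z l j)%R) => //.
  by rewrite mulrC (E l i) (E j l).
have -> : tjac kap1 s1 W = ((cabs (Z l l) ^+ 2) ^- n.-1)%R.
  rewrite /tjac (eq_bigr (fun=> (cabs (Z l l) ^+ 2)^-1)%R); last first.
    move=> m _; rewrite /kap1 WE (negbTE zn0) -exprVn; congr (_ ^+ _)%R.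
    have c0 : cabs (Z l l) != 0%R by rewrite cabs_eq0.
    by apply: (mulfI c0); rewrite -cabsM !divff// cabs1.
  rewrite big_const_seq count_predT size_map -cardE cardC1 card_ord.
  by rewrite iter_mulr_1 exprVn.
rewrite /K muleCA -EFinM; rewrite -[LHS]/(mxH h (pinv_map Z) * (sdens Z)%:E).
rewrite -muleA -EFinM /mxH; case: asboolP => sp; last by rewrite !mul0e.
congr (_ * _%:E); rewrite /sdens -siegel_act_pinv; last exact/(pinv_map_space sZ z0).
have sZZ := (pinv_map_space sZ z0).1 sp.
have := det_siegel_act_Im (symplectic_pinv R l) sZZ; rewrite det_autfactor_pinv => <-.
have c0 : (cabs (Z l l) ^+ 2)%R != 0%R by rewrite sqrf_eq0 cabs_eq0.
rewrite exprMn invfM mulrC; congr (_ * _)%R.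
rewrite -invfM -exprD; congr (_ ^- _)%R.
(* The index [l] excludes [n = 0], hence [n.-1 + 2 = n.+1]. *)
by case: (n) l => [[]//|n' _]; rewrite /= addn2.
Qed.

End PartialInversion.

Lemma symplectic_invariant g : symplectic g -> sp_invariant g.
Proof.
move=> /symplectic_spgen; elim=> [S|l|g1 g2 G1 I1 G2 I2].
- exact: sp_invariant_trans.
- exact: sp_invariant_pinv.
- by apply: sp_invariant_mul => //; exact: spgen_symplectic.
Qed.

End Invariance.

(** * The mean value inequality *)

Section Green.
Context (R : realType).
Local Notation leb := (@lebesgue_measure R).

Definition itvint (f : R -> R) (a b : R) : R := \int[leb]_(x in `[a, b]) f x.

Lemma continuous_itv_sub (f : R -> R) (a b c d : R) : a <= c -> d <= b ->
  {within `[a, b], continuous f} -> {within `[c, d], continuous f}.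
Proof.
move=> ac db; apply: continuous_subspaceW => x /=; rewrite !in_itv /= => /andP[cx xd].
by rewrite (le_trans ac cx) (le_trans xd db).
Qed.

Lemma itv_integrable (f : R -> R) (a b : R) : {within `[a, b], continuous f} ->
  leb.-integrable `[a, b] (EFin \o f).
Proof. by move=> cf; apply: continuous_compact_integrable => //; exact: segment_compact. Qed.

Lemma itvint_split (f : R -> R) (a b c : R) : a <= b -> b <= c ->
  {within `[a, c], continuous f} -> itvint f a c = itvint f a b + itvint f b c.
Proof.
move=> ab bc cf; rewrite /itvint.
have := @Rintegral_itvB _ f (BLeft a) (BRight c) b (itv_integrable cf).
rewrite !bnd_simp => /(_ ab bc).
rewrite Rintegral_itv_obnd_cbnd; last first.
  apply: (@integrableS _ _ _ leb `[b, c]) => //; last exact: itv_integrable (continuous_itv_sub ab (lexx _) cf).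
  by move=> x /=; rewrite !in_itv /= => /andP[/ltW -> ->].
by move=> <-; rewrite addrC subrK.
Qed.

Lemma itvint_diff_bound (f g : R -> R) (a b k e : R) : a <= b ->
  {within `[a, b], continuous f} -> {within `[a, b], continuous g} ->
  (forall x, a <= x <= b -> `|f x - g x - k| <= e) ->
  `|itvint f a b - itvint g a b - k * (b - a)| <= e * (b - a).
Proof.
move=> ab cf cg H; rewrite /itvint.
have If := itv_integrable cf; have Ig := itv_integrable cg.
have cst c : \int[leb]_(x in `[a, b]) c = c * (b - a) :> R.
  rewrite Rintegral_cst//= lebesgue_measure_itv /= lte_fin.
  by move: ab; rewrite le_eqVlt => /orP[/eqP ->|->]; rewrite ?ltxx ?subrr ?mulr0.
have Ic c : leb.-integrable `[a, b] (EFin \o (fun=> c : R)).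
  by apply: itv_integrable => x; exact: cvg_cst.
have Id : leb.-integrable `[a, b] (EFin \o (fun x => f x - g x)).
  by apply: itv_integrable => x; apply: cvgB; [exact: cf|exact: cg].
have Ie : leb.-integrable `[a, b] (EFin \o (fun x => f x - g x - k)).
  by apply: itv_integrable => x; apply: cvgB; [apply: cvgB; [exact: cf|exact: cg]|exact: cvg_cst].
rewrite -cst -RintegralB// -RintegralB//.
rewrite (le_trans (le_normr_Rintegral _ Ie))// -cst; apply: le_Rintegral => //; exact: integrable_norm.
Qed.

Context (P Q : R -> R -> R).

Definition rect_form (a b c d : R) : R :=
  itvint (P^~ c) a b + itvint (Q b) c d - itvint (P^~ d) a b - itvint (Q a) c d.

Context (A B C D : R) (AB : A <= B) (CD : C <= D).
Hypothesis cP : forall y, C <= y <= D -> {within `[A, B], continuous (P^~ y)}.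
Hypothesis cQ : forall x, A <= x <= B -> {within `[C, D], continuous (Q x)}.

(* the 1-form P dx + Q dy is differentiable along segments near each point, with
   matching mixed derivatives; no continuity of these derivatives is assumed *)
Hypothesis closed_form : forall x y, A <= x <= B -> C <= y <= D ->
  exists L, forall e, 0 < e -> exists2 eta, 0 < eta & forall a b c d,
    A <= a -> a <= x <= b -> b <= B -> C <= c -> c <= y <= d -> d <= D ->
    b - a < eta -> d - c < eta ->
    (forall s, a <= s <= b -> `|P s d - P s c - L * (d - c)| <= e * (b - a + (d - c))) /\
    (forall t, c <= t <= d -> `|Q b t - Q a t - L * (b - a)| <= e * (b - a + (d - c))).

Let valid (r : (R * R) * (R * R)) :=
  [/\ A <= r.1.1, r.1.1 <= r.1.2, r.1.2 <= B, C <= r.2.1 & r.2.1 <= r.2.2 <= D].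

Let form (r : (R * R) * (R * R)) := rect_form r.1.1 r.1.2 r.2.1 r.2.2.

Let subrect (r s : (R * R) * (R * R)) :=
  [/\ r.1.1 <= s.1.1, s.1.2 <= r.1.2, r.2.1 <= s.2.1 & s.2.2 <= r.2.2] /\
  [/\ s.1.2 - s.1.1 = (r.1.2 - r.1.1) / 2, s.2.2 - s.2.1 = (r.2.2 - r.2.1) / 2 &
      `|form r| <= 4 * `|form s|].

(** The boundary integral is the sum over the four quarters, so some quarter carries at least a
    quarter of it. The witness is arbitrary for an invalid rectangle, which makes the choice
    total. *)
Let bisect r : exists s, valid r -> valid s /\ subrect r s.
Proof.
case: (pselect (valid r)) => [vr|]; last by exists r.
case: r vr => -[a b] [c d] [/= Aa ab bB Cc /andP[cd dD]].
pose x := (a + b) / 2; pose y := (c + d) / 2.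
have [ax xb cy yd] : [/\ a <= x, x <= b, c <= y & y <= d] by rewrite /x /y; split; lra.
have P1 u : C <= u <= D -> itvint (P^~ u) a b = itvint (P^~ u) a x + itvint (P^~ u) x b.
  by move=> uD; apply: itvint_split => //; exact: continuous_itv_sub (cP uD).
have Q1 u : A <= u <= B -> itvint (Q u) c d = itvint (Q u) c y + itvint (Q u) y d.
  by move=> uB; apply: itvint_split => //; exact: continuous_itv_sub (cQ uB).
have S : form ((a, b), (c, d)) = form ((a, x), (c, y)) + form ((x, b), (c, y)) +
    form ((a, x), (y, d)) + form ((x, b), (y, d)).
  by rewrite /form /rect_form /= !P1 ?Q1 //; try lra.
have /or4P H : [|| `|form ((a, b), (c, d))| <= 4 * `|form ((a, x), (c, y))|,
    `|form ((a, b), (c, d))| <= 4 * `|form ((x, b), (c, y))|,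
    `|form ((a, b), (c, d))| <= 4 * `|form ((a, x), (y, d))| |
    `|form ((a, b), (c, d))| <= 4 * `|form ((x, b), (y, d))|].
  apply: contraT; rewrite !negb_or -!ltNge => /and4P[h1 h2 h3 h4].
  have := ler_normD (form ((a, x), (c, y)) + form ((x, b), (c, y)) + form ((a, x), (y, d))) (form ((x, b), (y, d))).
  have := ler_normD (form ((a, x), (c, y)) + form ((x, b), (c, y))) (form ((a, x), (y, d))).
  have := ler_normD (form ((a, x), (c, y))) (form ((x, b), (c, y))).
  rewrite -S; lra.
have wx : x - a = (b - a) / 2 by rewrite /x; field.
have wx' : b - x = (b - a) / 2 by rewrite /x; field.
have wy : y - c = (d - c) / 2 by rewrite /y; field.
have wy' : d - y = (d - c) / 2 by rewrite /y; field.
case: H => H.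
- by exists ((a, x), (c, y)) => _; split; split => //=; try lra; apply/andP; split; lra.
- by exists ((x, b), (c, y)) => _; split; split => //=; try lra; apply/andP; split; lra.
- by exists ((a, x), (y, d)) => _; split; split => //=; try lra; apply/andP; split; lra.
- by exists ((x, b), (y, d)) => _; split; split => //=; try lra; apply/andP; split; lra.
Qed.

(** Goursat's argument: along nested quarters the form shrinks at most by [4^-k], while at their
    common point the expansions of [P] and [Q] have the same linear coefficient and leave an
    arbitrarily small multiple of the squared size, itself of order [4^-k]. *)
Lemma rect_form_eq0 : rect_form A B C D = 0.
Proof.
have [f fP] := choice bisect.
pose r0 := ((A, B), (C, D)); pose r k := iter k f r0.
have v0 : valid r0 by split => //=; rewrite ?lexx ?CD.
have vr k : valid (r k).
  by elim: k => [//|k IH]; have [] := fP _ IH.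
have sr k : subrect (r k) (r k.+1) by have [] := fP _ (vr k).
have wE k : (r k).1.2 - (r k).1.1 = (B - A) / 2 ^+ k.
  elim: k => [|k IH]; first by rewrite expr0 divr1.
  by have [_ [-> _ _]] := sr k; rewrite IH exprS invfM mulrA mulrAC.
have hE k : (r k).2.2 - (r k).2.1 = (D - C) / 2 ^+ k.
  elim: k => [|k IH]; first by rewrite expr0 divr1.
  by have [_ [_ -> _]] := sr k; rewrite IH exprS invfM mulrA mulrAC.
have fE k : `|form r0| <= 4 ^+ k * `|form (r k)|.
  elim: k => [|k IH]; first by rewrite expr0 mul1r.
  rewrite (le_trans IH)// exprSr -mulrA ler_pM2l ?exprn_gt0//.
  by have [_ []] := sr k.
have mono j k : (j <= k)%N -> [/\ (r j).1.1 <= (r k).1.1, (r k).1.2 <= (r j).1.2,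
    (r j).2.1 <= (r k).2.1 & (r k).2.2 <= (r j).2.2].
  elim: k => [|k IH]; first by rewrite leqn0 => /eqP ->.
  rewrite leq_eqVlt => /orP[/eqP ->//|]; rewrite ltnS => /IH[a b c d].
  have [[a' b' c' d'] _] := sr k.
  by split; [exact: le_trans a'|exact: le_trans b|exact: le_trans c'|exact: le_trans d].
have cross1 j k : (r j).1.1 <= (r k).1.2.
  have [a _ _ _] := mono _ _ (leq_maxl j k); have [_ b _ _] := mono _ _ (leq_maxr j k).
  by have [_ h _ _ _] := vr (maxn j k); apply: le_trans (le_trans a h) b.
have cross2 j k : (r j).2.1 <= (r k).2.2.
  have [_ _ a _] := mono _ _ (leq_maxl j k); have [_ _ _ b] := mono _ _ (leq_maxr j k).
  by have [_ _ _ _ /andP[h _]] := vr (maxn j k); apply: le_trans (le_trans a h) b.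
(* The point common to all the rectangles; [cross1] and [cross2] place every lower end below every
   upper end. *)
pose x := sup (range (fun k => (r k).1.1)); pose y := sup (range (fun k => (r k).2.1)).
have xP k : (r k).1.1 <= x <= (r k).1.2.
  apply/andP; split.
    apply: ub_le_sup; last by exists k.
    by exists (r 0%N).1.2 => _ [j _ <-].
  by apply: ge_sup; [exists (r 0%N).1.1, 0%N|move=> _ [j _ <-]].
have yP k : (r k).2.1 <= y <= (r k).2.2.
  apply/andP; split.
    apply: ub_le_sup; last by exists k.
    by exists (r 0%N).2.2 => _ [j _ <-].
  by apply: ge_sup; [exists (r 0%N).2.1, 0%N|move=> _ [j _ <-]].
have [L LP] := closed_form (xP 0%N) (yP 0%N).
apply/eqP; rewrite -normr_le0; apply/ler_addgt0Pr => e e0; rewrite add0r.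
(* The added 1 keeps [M] positive when the rectangle is degenerate. *)
pose M := (B - A + (D - C)) ^+ 2 + 1.
have M0 : 0 < M by rewrite /M ltr_wpDl ?sqr_ge0.
have [eta eta0 H] := LP (e / M) (divr_gt0 e0 M0).
have [k kP] : exists k, (B - A + (D - C)) / 2 ^+ k < eta.
  have D0 : 0 <= B - A + (D - C) by rewrite addr_ge0 ?subr_ge0.
  have := archi_boundP (divr_ge0 D0 (ltW eta0)); set k := Num.bound _ => kP; exists k.
  rewrite ltr_pdivrMr ?exprn_gt0// -ltr_pdivrMl// mulrC (lt_trans kP)//.
  by rewrite -natrX ltr_nat ltn_expl.
have [vA vAB vB vC /andP[vCD vD]] := vr k.
have [w h] : 0 <= B - A /\ 0 <= D - C by rewrite !subr_ge0.
have k0 : 0 < (2 ^+ k)^-1 :> R by rewrite invr_gt0 exprn_gt0.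
have wlt : (r k).1.2 - (r k).1.1 < eta.
  by rewrite wE; apply: le_lt_trans kP; rewrite ler_pM2r// lerDl.
have hlt : (r k).2.2 - (r k).2.1 < eta.
  by rewrite hE; apply: le_lt_trans kP; rewrite ler_pM2r// lerDr.
have [HP HQ] := H _ _ _ _ vA (xP k) vB vC (yP k) vD wlt hlt.
set W := (r k).1.2 - (r k).1.1 in wE wlt HP HQ *.
set V := (r k).2.2 - (r k).2.1 in hE hlt HP HQ *.
have inC : C <= (r k).2.1 <= D by rewrite vC (le_trans vCD).
have inD : C <= (r k).2.2 <= D by rewrite vD (le_trans vC).
have inA : A <= (r k).1.1 <= B by rewrite vA (le_trans vAB).
have inB : A <= (r k).1.2 <= B by rewrite vB (le_trans vA).
have b1 := itvint_diff_bound vAB (continuous_itv_sub vA vB (cP inD)) (continuous_itv_sub vA vB (cP inC)) HP.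
have b2 := itvint_diff_bound vCD (continuous_itv_sub vC vD (cQ inB)) (continuous_itv_sub vC vD (cQ inA)) HQ.
rewrite -/W -/V in b1 b2.
have bd : `|form (r k)| <= e / M * (W + V) ^+ 2.
  have -> : form (r k) = (itvint (Q (r k).1.2) (r k).2.1 (r k).2.2 - itvint (Q (r k).1.1) (r k).2.1 (r k).2.2 - L * W * V)
     - (itvint (P^~ (r k).2.2) (r k).1.1 (r k).1.2 - itvint (P^~ (r k).2.1) (r k).1.1 (r k).1.2 - L * V * W).
    by rewrite /form /rect_form; ring.
  by apply: le_trans (ler_normB _ _) _; apply: le_trans (lerD b2 b1) _; rewrite le_eqVlt; apply/orP; left; apply/eqP; ring.
have := fE k; rewrite /form /r0 /= => /le_trans; apply.
have WV : W + V = (B - A + (D - C)) / 2 ^+ k by rewrite /W /V wE hE -mulrDl.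
apply: (@le_trans _ _ (4 ^+ k * (e / M * (W + V) ^+ 2))).
  by rewrite ler_pM2l ?exprn_gt0.
have -> : 4 ^+ k * (e / M * (W + V) ^+ 2) = e * ((B - A + (D - C)) ^+ 2 / M).
  rewrite WV; have -> : 4 = 2 ^+ 2 :> R by rewrite -natrX.
  rewrite -exprM mulnC exprM exprMn exprVn; field.
  by rewrite gt_eqF//= expf_neq0// expf_neq0.
by rewrite ger_pMr// ler_pdivrMr// mul1r /M lerDl.
Qed.

End Green.

Section MeanValue.
Context (R : realType).
Local Notation C := R[i].
Local Notation T := (measurableTypeR R).
Local Notation leb := (@lebesgue_measure R).

(** Complex differentiability at a point with real moduli and radii, the form in which it is
    estimated along segments. *)
Definition cdiff (v : C -> C) z := exists L, forall e : R, 0 < e ->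
  exists2 eta : R, 0 < eta & forall w, cabs (w - z) < eta ->
    cabs (v w - v z - L * (w - z)) <= e * cabs (w - z).

Lemma differentiable_cdiff (v : C -> C) z :
  differentiable (v : (C : numFieldType)^o -> (C : numFieldType)^o) z -> cdiff v z.
Proof.
move=> /derivable1_diffP dv; exists ('D_1 (v : (C : numFieldType)^o -> (C : numFieldType)^o) z) => e e0.
have e0C : 0 < (e%:C%C : C) by rewrite (ltcR 0 e).
have /cvgrPdist_le/(_ _ e0C) := dv.
rewrite /dnbhs /= near_withinE => /nbhs_normP[eta /= eta0 H].
have etaE : eta = (complex.Re eta)%:C%C by case: (eta) eta0 => a b /=; rewrite ltcE /= => /andP[/eqP -> _].
exists (complex.Re eta); first by move: eta0; rewrite {1}etaE (ltcR 0).
move=> w wz; have [->|wz0] := eqVneq w z.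
  by rewrite !subrr mulr0 subr0 cabs0 mulr0.
have hz : w - z != 0 by rewrite subr_eq0.
have := H (w - z); rewrite /= sub0r normrN -cabsE etaE ltcR => /(_ wz hz).
rewrite /= /GRing.scale /= mulr1 subrK -cabsE lecR => h.
have -> : v w - v z - 'D_1 (v : (C : numFieldType)^o -> (C : numFieldType)^o) z * (w - z) =
   - (('D_1 (v : (C : numFieldType)^o -> (C : numFieldType)^o) z - (w - z)^-1 * (v w - v z)) * (w - z)).
  by rewrite mulrBl mulrAC mulVf// mul1r opprB.
by rewrite cabsN cabsM ler_wpM2r ?cabs_ge0.
Qed.

Lemma cdiff_scale v c k z : cabs k = 1 -> cdiff v (k * z) -> cdiff (fun w => c * v (k * w)) z.
Proof.
move=> k1 [L LP]; exists (c * L * k) => e e0.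
have c0 : 0 < 1 + cabs c by rewrite ltr_pwDl ?cabs_ge0.
have [eta eta0 H] := LP (e / (1 + cabs c)) (divr_gt0 e0 c0); exists eta => // w wz.
have kE : k * w - k * z = k * (w - z) by rewrite mulrBr.
have := H (k * w); rewrite kE cabsM k1 mul1r => /(_ wz) h.
have -> : c * v (k * w) - c * v (k * z) - c * L * k * (w - z) =
  c * (v (k * w) - v (k * z) - L * (k * (w - z))) by ring.
rewrite cabsM; apply: le_trans (ler_wpM2l (cabs_ge0 _) h) _.
rewrite mulrA ler_wpM2r ?cabs_ge0// mulrA ler_pdivrMr// mulrC ler_pM2l//.
by rewrite lerDr.
Qed.

Lemma cdiffD v w z : cdiff v z -> cdiff w z -> cdiff (fun x => v x + w x) z.
Proof.
move=> [L LP] [M MP]; exists (L + M) => e e0.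
have e2 : 0 < e / 2 by rewrite divr_gt0.
have [a a0 H] := LP _ e2; have [b b0 K] := MP _ e2.
exists (Num.min a b); first by rewrite lt_min a0.
move=> x; rewrite lt_min => /andP[/H h /K k].
have -> : v x + w x - (v z + w z) - (L + M) * (x - z) =
  (v x - v z - L * (x - z)) + (w x - w z - M * (x - z)) by ring.
by apply: le_trans (cabsD _ _) _; apply: le_trans (lerD h k) _; rewrite -mulrDl -splitr.
Qed.

Lemma cdiff_cont v z : cdiff v z -> forall e : R, 0 < e ->
  exists2 eta : R, 0 < eta & forall w, cabs (w - z) < eta -> cabs (v w - v z) <= e.
Proof.
move=> [L LP] e e0; have [a a0 H] := LP 1 ltr01.
have c0 : 0 < 1 + cabs L by rewrite ltr_pwDl ?cabs_ge0.
exists (Num.min a (e / (1 + cabs L))); first by rewrite lt_min a0 divr_gt0.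
move=> w; rewrite lt_min => /andP[/H h]; rewrite ltr_pdivlMr// => h2.
have -> : v w - v z = (v w - v z - L * (w - z)) + L * (w - z) by ring.
apply: le_trans (cabsD _ _) _; rewrite cabsM.
have := cabs_ge0 (w - z); nra.
Qed.

Lemma cabs_lip (z w : C) : `|cabs z - cabs w| <= cabs (z - w).
Proof.
rewrite ler_norml; have := cabsD (z - w) w; have := cabsD (w - z) z.
rewrite !subrK -(cabsN (w - z)) opprB => h1 h2; apply/andP; split; lra.
Qed.

Lemma Re_lip (z w : C) : `|complex.Re z - complex.Re w| <= cabs (z - w).
Proof. by apply: le_trans (cabs_Re (z - w)); case: z w => [a b] [c d]. Qed.

Lemma Im_lip (z w : C) : `|complex.Im z - complex.Im w| <= cabs (z - w).
Proof. by apply: le_trans (cabs_Im (z - w)); case: z w => [a b] [c d]. Qed.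

Lemma cdiff_cvg (F : set_system R) {FF : Filter F} v (p q : R -> R) x y (g : C -> R) :
  cdiff v (Complex x y) -> (forall z w, `|g z - g w| <= cabs (z - w)) ->
  p t @[t --> F] --> x -> q t @[t --> F] --> y ->
  g (v (Complex (p t) (q t))) @[t --> F] --> g (v (Complex x y)).
Proof.
move=> dv gL px qy; apply/cvgrPdist_le => e e0.
have [eta eta0 H] := cdiff_cont dv e0.
have eta2 : 0 < eta / 2 by rewrite divr_gt0.
move/cvgrPdist_lt : px => /(_ _ eta2) px; move/cvgrPdist_lt : qy => /(_ _ eta2) qy.
near=> t.
rewrite distrC; apply: le_trans (gL _ _) _; apply: H.
apply: le_lt_trans (cabs_le _) _; rewrite /= [eta]splitr ltrD //.
- by rewrite distrC; near: t.
- by rewrite distrC; near: t.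
Unshelve. all: by end_near.
Qed.

Lemma itvint_ge (f : R -> R) (a b c : R) : a <= b -> {within `[a, b], continuous f} ->
  (forall x, a <= x <= b -> c <= f x) -> c * (b - a) <= itvint f a b.
Proof.
move=> ab cf H.
have cst : \int[leb]_(x in `[a, b]) c = c * (b - a) :> R.
  rewrite Rintegral_cst//= lebesgue_measure_itv /= lte_fin.
  by move: ab; rewrite le_eqVlt => /orP[/eqP ->|->]; rewrite ?ltxx ?subrr ?mulr0.
rewrite -cst; apply: le_Rintegral => //; last exact: itv_integrable.
by apply: itv_integrable => x; exact: cvg_cst.
Qed.

Lemma itvint_le (f g : R -> R) (a b : R) : {within `[a, b], continuous f} ->
  {within `[a, b], continuous g} -> (forall x, a <= x <= b -> f x <= g x) ->
  itvint f a b <= itvint g a b.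
Proof.
move=> cf cg H; by apply: le_Rintegral => //; exact: itv_integrable.
Qed.

Section Sector.
Context (v : C -> C) (del A0 : R) (del0 : 0 < del).
Hypothesis dv : forall x y, `|x| <= del -> `|y| <= del -> cdiff v (Complex x y).
Hypothesis v0 : v 0 = A0%:C%C.
Hypothesis vi : forall z, v (Complex 0 1 * z) = v z.

Let dvs s t : 0 < s <= del -> -1 <= t <= 1 -> cdiff v (Complex s (s * t)).
Proof.
move=> /andP[s0 sd] t1; apply: dv; first by rewrite gtr0_norm.
have tn : `|t| <= 1 by rewrite ler_norml.
by rewrite normrM gtr0_norm// (le_trans _ sd)// ler_piMr// ltW.
Qed.

Lemma sector_cont (g : C -> R) s : (forall z w, `|g z - g w| <= cabs (z - w)) -> 0 < s <= del ->
  {within `[-1, 1], continuous (fun t => g (v (Complex s (s * t))))}.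
Proof.
move=> gL sd; apply: continuous_in_subspaceT => t; rewrite in_setE /= in_itv /= => tI.
apply: (@cdiff_cvg (nbhs t) _ v (fun=> s) (fun t => s * t) s (s * t) g) => //; first exact: dvs.
- exact: cvg_cst.
- by apply: cvgM; [exact: cvg_cst|exact: cvg_id].
Qed.

(** In the coordinates [z = s (1 + i t)] of a sector, [P ds + Q dt] is the imaginary part of
    [v dz / z]. *)
Let P (s t : R) : R := complex.Im (v (Complex s (s * t))) / s.
Let Q (s t : R) : R :=
  (complex.Re (v (Complex s (s * t))) + t * complex.Im (v (Complex s (s * t)))) / (1 + t ^+ 2).

Let t20 (t : R) : 0 < 1 + t ^+ 2.
Proof. by rewrite ltr_pwDl ?sqr_ge0. Qed.

Let contP a b t : 0 < a -> b <= del -> -1 <= t <= 1 -> {within `[a, b], continuous (P^~ t)}.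
Proof.
move=> a0 bd tI; apply: continuous_in_subspaceT => s; rewrite in_setE /= in_itv /= => /andP[as_ sb].
have s0 : s != 0 by rewrite gt_eqF// (lt_le_trans a0).
apply: cvgM; last by apply: cvgV => //; exact: cvg_id.
apply: (@cdiff_cvg (nbhs s) _ v id (fun s => s * t) s (s * t) (@complex.Im R)) => //; last 2 first.
- exact: Im_lip.
- by apply: cvgM; [exact: cvg_id|exact: cvg_cst].
by apply: dvs => //; rewrite (lt_le_trans a0 as_) (le_trans sb bd).
Qed.

Let contQ s : 0 < s <= del -> {within `[-1, 1], continuous (Q s)}.
Proof.
move=> sd; apply: continuous_in_subspaceT => t; rewrite in_setE /= in_itv /= => tI.
have h (g : C -> R) : (forall z w, `|g z - g w| <= cabs (z - w)) ->
    g (v (Complex s (s * x))) @[x --> t] --> g (v (Complex s (s * t))).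
  move=> gL; apply: (@cdiff_cvg (nbhs t) _ v (fun=> s) (fun t => s * t) s (s * t) g) => //; first exact: dvs.
  - exact: cvg_cst.
  - by apply: cvgM; [exact: cvg_cst|exact: cvg_id].
apply: cvgM; last first.
  apply: cvgV; first by rewrite gt_eqF.
  by apply: cvgD; [exact: cvg_cst|apply: cvgM; exact: cvg_id].
apply: cvgD; first by apply: h; exact: Re_lip.
by apply: cvgM; [exact: cvg_id|apply: h; exact: Im_lip].
Qed.

(** Both mixed derivatives equal the real part of the complex derivative of [v], whence the common
    coefficient [L]. *)
Let closedPQ a b : 0 < a -> b <= del -> forall x y, a <= x <= b -> -1 <= y <= 1 ->
  exists L, forall e, 0 < e -> exists2 eta, 0 < eta & forall a' b' c d,
    a <= a' -> a' <= x <= b' -> b' <= b -> -1 <= c -> c <= y <= d -> d <= 1 ->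
    b' - a' < eta -> d - c < eta ->
    (forall s, a' <= s <= b' -> `|P s d - P s c - L * (d - c)| <= e * (b' - a' + (d - c))) /\
    (forall t, c <= t <= d -> `|Q b' t - Q a' t - L * (b' - a')| <= e * (b' - a' + (d - c))).
Proof.
move=> a0 bd x y /andP[ax xb] yI.
have [L LP] := @dvs x y (introT andP (conj (lt_le_trans a0 ax) (le_trans xb bd))) yI.
exists (complex.Re L) => e e0.
(* [K] compares distances of [s (1 + i t)] with distances in [(s, t)]; [m] is a lower bound for both
   denominators [s] and [1 + t^2]. *)
pose K := 2 + del; have K0 : 0 < K by rewrite /K addr_gt0.
pose m := Num.min 1 a; have m0 : 0 < m by rewrite lt_min ltr01.
have e'0 : 0 < e * m / (4 * K) by rewrite divr_gt0 ?mulr_gt0.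
have [eta eta0 H] := LP _ e'0; exists (eta / (2 * K)); first by rewrite divr_gt0 ?mulr_gt0.
move=> a' b' c d aa' /andP[a'x xb'] b'b c1 /andP[cy yd] d1 we he.
set S := b' - a' + (d - c).
have S0 : 0 <= S by rewrite /S; lra.
have near s t : a' <= s <= b' -> c <= t <= d ->
    cabs (Complex s (s * t) - Complex x (x * y)) <= K * S.
  move=> /andP[s1 s2] /andP[t1 t2]; apply: le_trans (cabs_le _) _ => /=.
  have h1 : `|s - x| <= b' - a' by rewrite ler_norml; apply/andP; split; lra.
  have h2 : `|t - y| <= d - c by rewrite ler_norml; apply/andP; split; lra.
  have -> : s * t - x * y = (s - x) * t + x * (t - y) by ring.
  have h3 := ler_normD ((s - x) * t) (x * (t - y)).
  rewrite !normrM in h3.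
  have tn : `|t| <= 1 by rewrite ler_norml; apply/andP; split; lra.
  have xn : `|x| <= del by rewrite ler_norml; apply/andP; split; lra.
  have := ler_pM (normr_ge0 _) (normr_ge0 _) h1 tn.
  have := ler_pM (normr_ge0 _) (normr_ge0 _) xn h2.
  have := normr_ge0 (t - y); have := normr_ge0 (s - x).
  rewrite /K /S; nra.
have KS : K * S < eta.
  move: we he; rewrite !ltr_pdivlMr ?mulr_gt0// => we he.
  by rewrite /S; lra.
have err s t s' t' : a' <= s <= b' -> c <= t <= d -> a' <= s' <= b' -> c <= t' <= d ->
    cabs (v (Complex s (s * t)) - v (Complex s' (s' * t')) -
      L * (Complex s (s * t) - Complex s' (s' * t'))) <= e * m / 2 * S.
  move=> sI tI s'I t'I; set z := Complex s _; set z' := Complex s' _; set z0 := Complex x (x * y).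
  have -> : v z - v z' - L * (z - z') = (v z - v z0 - L * (z - z0)) - (v z' - v z0 - L * (z' - z0)).
    by ring.
  apply: le_trans (cabsB _ _) _.
  have n1 := near _ _ sI tI; have n2 := near _ _ s'I t'I.
  have := H _ (le_lt_trans n1 KS); have := H _ (le_lt_trans n2 KS).
  have q : e * m / 2 * S = e * m / (4 * K) * (K * S) + e * m / (4 * K) * (K * S).
    by field; rewrite gt_eqF.
  rewrite q => g2 g1; apply: lerD.
    by apply: le_trans g1 _; rewrite ler_pM2l.
  by apply: le_trans g2 _; rewrite ler_pM2l.
have c' : c <= c <= d by lra.
have d' : c <= d <= d by lra.
have a'' : a' <= a' <= b' by lra.
have b'' : a' <= b' <= b' by lra.
split.
- move=> s sI; have s0 : 0 < s by case/andP: sI; lra.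
  have := err _ _ _ _ sI d' sI c'.
  set z := v (Complex s (s * d)); set z' := v (Complex s (s * c)) => h.
  have -> : P s d - P s c - complex.Re L * (d - c) =
      complex.Im (z - z' - L * (Complex s (s * d) - Complex s (s * c))) / s.
    rewrite /P -/z -/z'; case: z z' L {LP H err h} => [p q] [p' q'] [l l'] /=.
    by field; rewrite gt_eqF.
  rewrite normrM normfV (gtr0_norm s0) ler_pdivrMr//.
  apply: le_trans (cabs_Im _) _; apply: le_trans h _.
  have ms : m <= s by rewrite ge_min; apply/orP; right; case/andP: sI; lra.
  have eS : 0 <= e * S by rewrite mulr_ge0// ltW.
  have := ler_wpM2l eS ms; have := mulr_ge0 eS (ltW m0).
  nra.
- move=> t tI; have := err _ _ _ _ b'' tI a'' tI.
  set z := v (Complex b' (b' * t)); set z' := v (Complex a' (a' * t)) => h.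
  set r := z - z' - L * (Complex b' (b' * t) - Complex a' (a' * t)) in h.
  have -> : Q b' t - Q a' t - complex.Re L * (b' - a') =
      (complex.Re r + t * complex.Im r) / (1 + t ^+ 2).
    rewrite /Q /r -/z -/z'; case: z z' L {LP H err h r} => [p q] [p' q'] [l l'] /=.
    by field; rewrite gt_eqF.
  rewrite normrM normfV (gtr0_norm (t20 t)) ler_pdivrMr//.
  apply: le_trans (ler_normD _ _) _; rewrite normrM.
  have tn : `|t| <= 1 by case/andP: tI => *; rewrite ler_norml; apply/andP; split; lra.
  have r1 := cabs_Re r; have r2 := cabs_Im r.
  have t3 := ler_pM (normr_ge0 _) (normr_ge0 _) tn r2.
  have m1 : m <= 1 by rewrite ge_min lexx.
  have eS : 0 <= e * S by rewrite mulr_ge0// ltW.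
  have t2 := sqr_ge0 t.
  have := ler_wpM2l eS m1; have := ler_wpM2l eS t2; lra.
Qed.

(** Invariance under multiplication by [i] identifies the sides [t = -1] and [t = 1], whose
    contributions cancel, so the integral of [Q] over [t] is the same for all [s]. As [s] tends to 0
    it is at least about [A0], because [1 / (1 + t^2) >= 1/2] on an interval of length 2; and [Q] is
    at most [|v|] by Cauchy-Schwarz. *)
Lemma sector_mean s : 0 < s <= del ->
  A0 <= itvint (fun t => cabs (v (Complex s (s * t)))) (-1) 1.
Proof.
move=> /[dup] sdel /andP[s0 sd]; apply/ler_addgt0Pr => e e0.
have cv := sector_cont cabs_lip sdel.
have I0 : 0 <= itvint (fun t => cabs (v (Complex s (s * t)))) (-1) 1.
  have /= := itvint_ge _ cv (fun x _ => cabs_ge0 _); rewrite mul0r; apply; lra.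
have [Ae|Ae] := lerP A0 e; first by apply: le_trans Ae _; rewrite lerDr.
have d0 : cdiff v 0 by apply: dv; rewrite normr0 ltW.
have e2 : 0 < e / 2 by rewrite divr_gt0.
have [eta eta0 H] := cdiff_cont d0 e2.
(* The point [a (1 + i t)] has modulus at most [2 a], which is below [eta]. *)
pose a := Num.min s (eta / 3).
have a0 : 0 < a by rewrite lt_min s0 divr_gt0.
have as_ : a <= s by rewrite ge_min lexx.
have ad : 0 < a <= del by rewrite a0 (le_trans as_).
have xdel x : a <= x <= s -> 0 < x <= del.
  by move=> /andP[ax xs]; rewrite (lt_le_trans a0 ax) (le_trans xs sd).
have := @rect_form_eq0 R P Q a s (-1) 1 as_ (ltW (lt_trans (ltrN10 R) ltr01)) (fun y => @contP a s y a0 sd)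
  (fun x xI => @contQ x (xdel x xI)) (closedPQ a0 sd).
have Pe : P^~ (-1) = P^~ 1.
  apply/funext => x; rewrite /P -(vi (Complex x (x * -1))).
  congr (complex.Im (v _) / x); apply/eqP; rewrite eq_complex /=; apply/andP; split; apply/eqP; ring.
move=> E; have QQ : itvint (Q s) (-1) 1 = itvint (Q a) (-1) 1.
  by move: E; rewrite /rect_form Pe => E; lra.
have Qs : itvint (Q s) (-1) 1 <= itvint (fun t => cabs (v (Complex s (s * t)))) (-1) 1.
  apply: itvint_le => //; first exact: contQ.
  move=> t tI; rewrite /Q ler_pdivrMr//.
  set z := v _.
  apply: (@le_trans _ _ (Num.sqrt ((complex.Re z ^+ 2 + complex.Im z ^+ 2) * (1 + t ^+ 2)))).
    apply: le_trans (ler_norm _) _; rewrite -sqrtr_sqr ler_wsqrtr//.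
    by have := sqr_ge0 (complex.Re z * t - complex.Im z); nra.
  rewrite -cabs_sqr sqrtrM ?sqr_ge0// sqrtr_sqr ger0_norm ?cabs_ge0// ler_wpM2l ?cabs_ge0//.
  rewrite -[leRHS]gtr0_norm// -sqrtr_sqr ler_wsqrtr//.
  by have := t20 t; have := sqr_ge0 t; nra.
have Qa : A0 - e <= itvint (Q a) (-1) 1.
  have -> : A0 - e = (A0 - e) / 2 * (1 - -1) by field.
  apply: itvint_ge; [lra|exact: contQ|] => t /andP[t1 t2].
  have az : cabs (Complex a (a * t) - 0) < eta.
    rewrite subr0; apply: le_lt_trans (cabs_le _) _ => /=.
    rewrite normrM (gtr0_norm a0).
    have tn : `|t| <= 1 by rewrite ler_norml t1.
    have : a <= eta / 3 by rewrite ge_min lexx orbT.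
    nra.
  have := H _ az; rewrite v0 /Q; set z := v _ => h.
  have h1 := le_trans (Re_lip _ _) h; have h2 := le_trans (Im_lip _ _) h.
  move: h1 h2; case: (z) => p q /=; rewrite subr0 !ler_norml => /andP[p1 p2] /andP[q1 q2].
  rewrite ler_pdivlMr//.
  have : - (e / 2) <= t * q by nra.
  have : t ^+ 2 <= 1 by nra.
  nra.
by rewrite -lerBlDr (le_trans Qa)// -QQ.
Qed.

End Sector.

Local Open Scope ereal_scope.

Lemma I2D (h1 h2 : T * T -> \bar R) : measurable_fun setT h1 -> measurable_fun setT h2 ->
  (forall p, 0 <= h1 p) -> (forall p, 0 <= h2 p) -> I2 (fun p => h1 p + h2 p) = I2 h1 + I2 h2.
Proof.
move=> m1 m2 p1 p2; rewrite /I2.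
have ms (h : T * T -> \bar R) x : measurable_fun setT h -> measurable_fun setT (fun y => h (x, y)).
  by move=> mh; apply: (measurable_pair_comp (F := fun=> x) (G := id)) mh _ _.
rewrite -ge0_integralD//; last 4 first.
- by move=> x _; exact: integral_ge0.
- by apply: (measurable_integral_snd (k := fun x y => h1 (x, y))) => //; apply: eq_measurable_fun m1 => -[].
- by move=> x _; exact: integral_ge0.
- by apply: (measurable_integral_snd (k := fun x y => h2 (x, y))) => //; apply: eq_measurable_fun m2 => -[].
by apply: eq_integral => x _; rewrite ge0_integralD//; exact: ms.
Qed.

Lemma I2Z (h : T * T -> \bar R) (c : R) : (0 <= c)%R -> measurable_fun setT h ->
  (forall p, 0 <= h p) -> I2 (fun p => c%:E * h p) = c%:E * I2 h.
Proof.
move=> c0 mh p0; rewrite /I2.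
have ms x : measurable_fun setT (fun y => h (x, y)).
  by apply: (measurable_pair_comp (F := fun=> x) (G := id)) mh _ _.
rewrite -ge0_integralZl_EFin//; last 2 first.
- by move=> x _; exact: integral_ge0.
- by apply: (measurable_integral_snd (k := fun x y => h (x, y))) => //; apply: eq_measurable_fun mh => -[].
by apply: eq_integral => x _; rewrite ge0_integralZl_EFin.
Qed.

Definition on_square (del : R) (f : C -> R) (q : T * T) : \bar R :=
  if (`|q.1| <= del)%R && (`|q.2| <= del)%R then (f (Complex q.1 q.2))%:E else 0.

Lemma on_square_ge0 del f q : (forall z, 0 <= f z)%R -> 0 <= on_square del f q.
Proof. by move=> f0; rewrite /on_square; case: ifP; rewrite ?lee_fin. Qed.

Section SquareMean.
Context (u : C -> C) (del : R) (del0 : (0 < del)%R).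
Hypothesis du : forall x y, (`|x| <= del)%R -> (`|y| <= del)%R -> cdiff u (Complex x y).
Let G := on_square del (@cabs R \o u).
Hypothesis mG : measurable_fun setT G.

Let G0 q : 0 <= G q.
Proof. by apply: on_square_ge0 => z; exact: cabs_ge0. Qed.

Let rot (k : C) (q : T * T) : \bar R :=
  G (complex.Re k * q.1 - complex.Im k * q.2, complex.Im k * q.1 + complex.Re k * q.2)%R.

Let mrot k : measurable_fun setT (rot k).
Proof.
apply: (measurable_pair_comp mG).
- by apply: measurable_funB; apply: measurable_funM.
- by apply: measurable_funD; apply: measurable_funM.
Qed.

Let I2rot k : cabs k = 1%R -> I2 (rot k) = I2 G.
Proof.
move=> k1; have E : (complex.Re k ^+ 2 + complex.Im k ^+ 2)%R = 1%R by rewrite -cabs_sqr k1 expr1n.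
by rewrite -(I2_cmul mG G0 (a := complex.Re k) (b := complex.Im k)) E ?oner_neq0// mul1e.
Qed.

Let ii : C := Complex 0%R 1%R.
Let c1 : cabs (ii : C) = 1%R.
Proof.
apply/eqP; rewrite -(eqrXn2 (n := 2)) ?cabs_ge0//.
by rewrite cabs_sqr /= expr0n add0r expr1n.
Qed.
Let cN1 : cabs (-1 : C)%R = 1%R.
Proof. by rewrite cabsN cabs1. Qed.
Let c3 : cabs (- ii : C)%R = 1%R.
Proof. by rewrite cabsN c1. Qed.
Let iiE : (ii * ii = -1)%R.
Proof. by apply/eqP; rewrite eq_complex /=; apply/andP; split; apply/eqP; ring. Qed.

(** Averaging over the four rotations of the square, which preserve the integral, reduces the claim
    to the sector [|y| <= x]. There the slice at [s] has integral at least [s A0]. *)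
Lemma square_mean : (cabs (u 0) * (del ^+ 2 / 4))%R%:E <= I2 G.
Proof.
have [u0|u0] := eqVneq (u 0%R) (0%R : C).
  by rewrite u0 cabs0 mul0r /I2; apply: integral_ge0 => x _; apply: integral_ge0.
pose A0 := cabs (u 0%R).
have A00 : (0 < A0)%R by rewrite lt_neqAle cabs_ge0 eq_sym cabs_eq0 u0.
(* A unimodular constant that turns the value at the centre into the positive number [A0]. *)
pose w : C := (A0%:C%C / u 0%R)%R.
have w1 : cabs w = 1%R.
  apply: (mulIf (x := cabs (u 0%R))); first by rewrite cabs_eq0.
  by rewrite -cabsM /w divfK// cabs_real mul1r gtr0_norm.
pose c : C := (w / 4)%R.
have cc : cabs c = (4^-1)%R.
  apply: (mulIf (x := 4%R)) => //; have <- : cabs (4%R : C) = 4%R.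
    by have := cabs_real (4%R : R); rewrite rmorph_nat normr_nat.
  by rewrite -cabsM /c divfK ?pnatr_eq0// w1 mulVf ?cabs_eq0 ?pnatr_eq0.
pose v z := (c * u (1 * z) + c * u (ii * z) + c * u (-1 * z) + c * u (- ii * z))%R.
have dv x y : (`|x| <= del)%R -> (`|y| <= del)%R -> cdiff v (Complex x y).
  move=> hx hy.
  have sq k a b : (k * Complex x y = Complex a b)%R -> (`|a| <= del)%R -> (`|b| <= del)%R -> cdiff u (k * Complex x y)%R.
    by move=> ->; exact: du.
  apply: cdiffD; [apply: cdiffD; [apply: cdiffD|]|]; apply: cdiff_scale => //; rewrite ?cabs1//.
  - by rewrite mul1r; exact: du.
  - apply: (sq _ (- y)%R x) => //; last by rewrite normrN.
    by apply/eqP; rewrite eq_complex /=; apply/andP; split; apply/eqP; ring.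
  - apply: (sq _ (- x)%R (- y)%R); rewrite ?normrN//.
    by apply/eqP; rewrite eq_complex /=; apply/andP; split; apply/eqP; ring.
  - apply: (sq _ y (- x)%R) => //; last by rewrite normrN.
    by apply/eqP; rewrite eq_complex /=; apply/andP; split; apply/eqP; ring.
have v0 : (v 0 = A0%:C%C)%R.
  rewrite /v !mulr0; transitivity (w * u 0)%R; last by rewrite /w divfK.
  by rewrite /c; field.
have vi z : v (ii * z)%R = v z.
  have k1 : (ii * (ii * z) = - z)%R by rewrite mulrA iiE mulN1r.
  have k2 : (- ii * (ii * z) = z)%R by rewrite mulNr k1 opprK.
  have k3 : (- ii * z = - (ii * z))%R by rewrite mulNr.
  rewrite /v k1 k2 k3 !mul1r !mulN1r.
  by rewrite addrC !addrA.
pose H q := (4^-1)%:E * (rot 1%R q + rot ii q + rot (-1)%R q + rot (- ii)%R q).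
have mH : measurable_fun setT H.
  by apply: measurable_funeM; do 3 apply: emeasurable_funD => //.
have r0 k q : 0 <= rot k q by exact: G0.
have H0 q : 0 <= H q by rewrite mule_ge0// !adde_ge0.
have IH : I2 H = I2 G.
  rewrite /H I2Z//; last 2 first.
  - by do 3 apply: emeasurable_funD => //.
  - by move=> q; rewrite !adde_ge0.
  rewrite I2D//; last 2 first.
  - by do 2 apply: emeasurable_funD => //.
  - by move=> q; rewrite !adde_ge0.
  rewrite I2D//; last 2 first.
  - by apply: emeasurable_funD.
  - by move=> q; rewrite !adde_ge0.
  rewrite I2D// !I2rot ?cabs1//.
  have I0 : 0 <= I2 G by apply: integral_ge0 => x _; apply: integral_ge0.
  have -> : I2 G + I2 G + I2 G + I2 G = 4%:E * I2 G.
    have -> : 4%:E = 1 + 1 + 1 + 1 :> \bar R by rewrite -!EFinD; congr EFin; ring.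
    by rewrite !ge0_muleDl ?mul1e// ?adde_ge0.
  by rewrite muleA -EFinM mulVf ?mul1e.
have vH s t : (0 < s <= del)%R -> (-1 <= t <= 1)%R -> (cabs (v (Complex s (s * t))))%:E <= H (s, s * t)%R.
  clear IH H0 mH r0; move=> /andP[s0 sd] /[dup] tI /andP[t1 t2].
  have st : (`|s * t| <= del)%R.
    by rewrite normrM gtr0_norm// (le_trans _ sd)// ler_piMr ?(ltW s0)// ler_norml.
  have sd' : (`|s| <= del)%R by rewrite gtr0_norm.
  have rE k x y : (k * Complex s (s * t) = Complex x y)%R -> (`|x| <= del)%R -> (`|y| <= del)%R ->
      rot k (s, s * t)%R = (cabs (u (k * Complex s (s * t))%R))%:E.
    case: k => a b /= [<- e2]; rewrite addrC in e2; move=> hx hy.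
    by rewrite /rot /G /on_square /= e2 hx hy /= -e2 [in LHS]addrC.
  rewrite /H (rE 1%R s (s * t)%R) ?mul1r// (rE ii (- (s * t))%R s) ?normrN//; last first.
    by apply/eqP; rewrite eq_complex /=; apply/andP; split; apply/eqP; ring.
  rewrite (rE (-1)%R (- s)%R (- (s * t))%R) ?normrN//; last first.
    by apply/eqP; rewrite eq_complex /=; apply/andP; split; apply/eqP; ring.
  rewrite (rE (- ii)%R (s * t)%R (- s)%R) ?normrN//; last first.
    by apply/eqP; rewrite eq_complex /=; apply/andP; split; apply/eqP; ring.
  rewrite -!EFinD -EFinM lee_fin !mulrDr -cc -!cabsM /v mul1r.
  apply: le_trans (cabsD _ _) _; rewrite lerD2r.
  apply: le_trans (cabsD _ _) _; rewrite lerD2r.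
  exact: cabsD.
clearbody H.
have slice s : (0 < s <= del)%R -> (s * A0)%:E <= \int[leb]_y H (s, y).
  move=> /[dup] sI /andP[s0 sd].
  have mHs : measurable_fun setT (fun y => H (s, y)).
    by apply: (measurable_pair_comp (F := fun=> s) (G := id)) mH _ _.
  have mHst : measurable_fun setT (fun t => H (s, s * t)%R).
    by apply: (measurable_pair_comp (F := fun=> s) (G := fun t => s * t)%R) mH _ _ => //; apply: measurable_funM.
  rewrite -(integral_scale_pos mHs _ s0)// EFinM lee_pmul2l//.
  have Iv : leb.-integrable `[(-1)%R, 1%R] (EFin \o (fun t => cabs (v (Complex s (s * t)%R)))).
    apply: itv_integrable; exact: (sector_cont dv cabs_lip sI).
  have := sector_mean del0 dv v0 vi sI; rewrite -lee_fin => /le_trans; apply.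
  rewrite /itvint /Rintegral fineK; last exact: integrable_fin_num.
  apply: (@le_trans _ _ (\int[leb]_(t in `[(-1)%R, 1%R]) H (s, s * t)%R)).
    apply: ge0_le_integral => //.
    - by move=> t _; rewrite lee_fin cabs_ge0.
    - exact: (measurable_int _ Iv).
    - exact: measurable_funTS.
    - by move=> t /=; rewrite in_itv /= => tI; exact: vH.
  by apply: ge0_subset_integral => //; exact: measurable_itv.
rewrite -IH /I2.
(* Only slices with [s >= del / 2] are kept: a width of [del / 2] times a value of at least
   [del A0 / 2] gives the constant [del^2 / 4]. *)
apply: (@le_trans _ _ (\int[leb]_(x in `[(del / 2)%R, del]) (del / 2 * A0)%R%:E)).
  rewrite integral_cst//= lebesgue_measure_itv /= lte_fin.
  have -> : (del / 2 < del)%R by rewrite ltr_pdivrMr// ltr_pMr// ltr1n.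
  rewrite -EFinD -EFinM lee_fin le_eqVlt; apply/orP; left; apply/eqP.
  by rewrite /A0; field.
have mI : measurable_fun setT (fun x => \int[leb]_y H (x, y)).
  by apply: (measurable_integral_snd (k := fun x y => H (x, y))) => //; apply: eq_measurable_fun mH => -[].
apply: (@le_trans _ _ (\int[leb]_(x in `[(del / 2)%R, del]) \int[leb]_y H (x, y))).
  apply: ge0_le_integral => //.
  - by move=> x _; rewrite lee_fin mulr_ge0 ?cabs_ge0// ltW// divr_gt0.
  - exact: measurable_funTS.
  - move=> x /=; rewrite in_itv /= => /andP[x1 x2].
    have x0 : (0 < x)%R by apply: lt_le_trans x1; rewrite divr_gt0.
    apply: le_trans (slice x _); last by rewrite x0.
    by rewrite lee_fin ler_wpM2r ?cabs_ge0.
pose I x := \int[leb]_y H (x, y).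
have {}mI : measurable_fun setT I by exact: mI.
have I0 x : 0 <= I x by exact: integral_ge0.
change (\int[leb]_(x in `[(del / 2)%R, del]) I x <= \int[leb]_x I x).
clearbody I.
by apply: ge0_subset_integral => //; exact: measurable_itv.
Qed.

End SquareMean.
End MeanValue.

(** * Measurability of continuous and holomorphic functions in coordinates *)

Section CoordMeasurability.
Context (R : realType) (N : nat).
Local Notation T := (measurableTypeR R).
Local Notation coords := (N.-tuple T * N.-tuple T)%type.

Definition cnear (e : R) (p q : coords) := forall i : 'I_N,
  `|tnth q.1 i - tnth p.1 i| < e /\ `|tnth q.2 i - tnth p.2 i| < e.

Lemma measurable_coord1 i : measurable_fun setT (fun q : coords => tnth q.1 i : T).
Proof. exact: (measurableT_comp (measurable_tnth i)). Qed.

Lemma measurable_coord2 i : measurable_fun setT (fun q : coords => tnth q.2 i : T).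
Proof. exact: (measurableT_comp (measurable_tnth i)). Qed.

Lemma measurable_cnear e p : measurable [set q | cnear e p q].
Proof.
have -> : [set q | cnear e p q] =
    \bigcap_(i in [set: 'I_N]) ([set q : coords | `|tnth q.1 i - tnth p.1 i| < e] `&`
      [set q : coords | `|tnth q.2 i - tnth p.2 i| < e]).
  apply/seteqP; split => q /= H; first by move=> i _; have [] := H i.
  by move=> i; have [] := H i I.
apply: fin_bigcap_measurable => // i _.
have m (f : coords -> T) (c : R) : measurable_fun setT f -> measurable [set q : coords | `|f q - c| < e].
  move=> mf; have mh : measurable_fun setT (fun q => `|f q - c| : T).
    by apply: measurableT_comp => //; apply: measurable_funB.
  have := mh measurableT `]-oo, e[%classic (measurable_itv _).
  by rewrite setTI; congr measurable; apply/seteqP; split => q; rewrite /= in_itv.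
by apply: measurableI; apply: m; [exact: measurable_coord1|exact: measurable_coord2].
Qed.

(** An open set is the union of the boxes with rational centre and radius [1 / (k + 1)] that it
    contains, and these are countably many. *)
Lemma copen_measurable (U : set coords) :
  (forall p, U p -> exists2 e : R, 0 < e & forall q, cnear e p q -> U q) -> measurable U.
Proof.
move=> HU.
pose Ix := (N.-tuple rat * N.-tuple rat * nat)%type.
pose ctr (a : Ix) : coords := ([tuple (ratr (tnth a.1.1 i) : T) | i < N], [tuple (ratr (tnth a.1.2 i) : T) | i < N]).
pose bx (a : Ix) : set coords := [set q | cnear (a.2.+1%:R^-1) (ctr a) q].
pose B k : set coords := if unpickle k is Some a then (if `[< bx a `<=` U >] then bx a else set0) else set0.
have -> : U = \bigcup_k B k.
  apply/seteqP; split => [p Up|p [k _]]; last first.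
    by rewrite /B; case: unpickle => // a; case: ifP => // /asboolP; apply.
  have [e e0 He] := HU p Up.
  have e2 : 0 < e / 2 by rewrite divr_gt0.
  pose k := Num.bound (e / 2)^-1.
  have kP : k.+1%:R^-1 < e / 2 :> R.
    rewrite invf_plt ?posrE//; apply: lt_le_trans (archi_boundP _) _; first by rewrite invr_ge0 ltW.
    by rewrite ler_nat.
  have k0 : 0 < k.+1%:R^-1 :> R by rewrite invr_gt0.
  have rt (x : R) : exists q : rat, `|x - ratr q| < k.+1%:R^-1.
    have xx : x - k.+1%:R^-1 < x + k.+1%:R^-1 by rewrite ltrBlDr -addrA ltrDl addr_gt0.
    have [q] := rat_in_itvoo xx.
    by rewrite in_itv /= => /andP[h1 h2]; exists q; rewrite distrC ltr_distl h1 h2.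
  have [r rP] := choice rt.
  pose a : Ix := ([tuple r (tnth p.1 i) | i < N], [tuple r (tnth p.2 i) | i < N], k).
  exists (pickle a) => //; rewrite /B pickleK.
  have bp : bx a p by move=> i; rewrite /ctr /= !tnth_mktuple.
  case: ifPn => // /asboolPn[] q bq; apply: He => i.
  have [h1 h2] := bq i; have [h3 h4] := bp i.
  have tri (x y z : R) : `|x - y| < k.+1%:R^-1 -> `|z - y| < k.+1%:R^-1 -> `|x - z| < e.
    move=> g1 g2; have -> : x - z = (x - y) - (z - y) by ring.
    apply: le_lt_trans (ler_normB _ _) _; apply: lt_trans (ltrD g1 g2) _.
    by rewrite [ltRHS]splitr ltrD.
  by split; [exact: tri h1 h3|exact: tri h2 h4].
apply: bigcupT_measurable => k; rewrite /B; case: unpickle => // a.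
by case: ifP => // _; exact: measurable_cnear.
Qed.

Lemma copen_measurable_fun (U : set coords) (F : coords -> R) :
  (forall p, U p -> forall e : R, 0 < e -> exists2 eta : R, 0 < eta &
     forall q, cnear eta p q -> U q /\ `|F q - F p| < e) ->
  measurable_fun setT (fun p => (if `[< U p >] then F p else 0) : T).
Proof.
move=> H.
have mU : measurable U.
  by apply: copen_measurable => p Up; have [e e0 He] := H p Up 1 ltr01; exists e => // q /He[].
have mF : measurable_fun U (F : coords -> T).
  apply: (measurability _ (RGenOInfty.measurableE R)) => _ [_ [x ->] <-].
  apply: copen_measurable => p [Up]; rewrite /= in_itv /= andbT => xF.
  have [e e0 He] := H p Up (F p - x) (ltac:(lra)); exists e => // q /He[Uq].
  by rewrite ltr_norml => /andP[h1 h2]; split => //=; rewrite in_itv /= andbT; lra.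
have := (measurable_restrictT _ mU).1 mF.
by congr measurable_fun; apply/funext => p; rewrite patchE.
Qed.

End CoordMeasurability.

Lemma symmetrizeK (K : numFieldType) n (W : 'M[K]_n) : W^T = W -> symmetrize W = W.
Proof.
move=> WT; rewrite /symmetrize WT -mulr2n -(scaler_nat 2 W) scalerA mulVf ?scale1r//.
Qed.

Lemma differentiable_sym_cont (K : numFieldType) n (f : 'M[K]_n -> K) (Z : 'M[K]_n) :
  differentiable (fun W : 'M[K]_n => f (symmetrize W) : K^o) Z -> Z^T = Z ->
  forall e : K, 0 < e -> exists2 eta : K, 0 < eta & forall W, W^T = W ->
    (forall i j, `|W i j - Z i j| < eta) -> `|f W - f Z| < e.
Proof.
move=> /differentiable_continuous/cvgrPdist_lt H ZT e e0.
have /nbhs_ballP[eta /= eta0 L] := H _ e0.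
exists eta => // W WT WZ; have := L W; rewrite (symmetrizeK WT) (symmetrizeK ZT) distrC; apply.
by split=> // i j; rewrite /ball /= distrC; exact: WZ.
Qed.

Section HolMeasurable.
Context (R : realType) (n : nat).
Local Notation C := R[i].
Local Notation T := (measurableTypeR R).
Local Notation N := ((n * n.+1)./2).
Local Notation coords := (N.-tuple T * N.-tuple T)%type.
Implicit Types (Z W : 'M[C]_n).

(** Writing [Im Z = A A^T], a nearby symmetric matrix has imaginary part [A (1 + E) A^T] with [E]
    small, and [1 + E] is positive definite. *)
Lemma siegel_space_open Z : siegel_space Z -> exists2 eta : R, 0 < eta &
  forall W, W^T = W -> (forall i j, cabs (W i j - Z i j) < eta) -> siegel_space W.
Proof.
move=> [ZT ZP]; have [YT YP] := ZP; have [A Au YE] := cholesky YT YP.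
pose B := invmx A; pose k := nrm (toC B) ^+ 2 * (n ^ 2)%:R.
have k0 : 0 <= k by rewrite mulr_ge0// sqr_ge0.
have d0 : 0 < 1 + n%:R * k by rewrite ltr_pwDl// mulr_ge0.
exists (1 + n%:R * k)^-1; first by rewrite invr_gt0.
move=> W WT H; split => //.
pose D := ImM W - ImM Z; pose E := B *m D *m B^T.
have DT : D^T = D by rewrite /D linearB /= !ImM_tr ZT WT.
have WE : ImM W = A *m (1%:M + E) *m A^T.
  rewrite mulmxDr mulmx1 mulmxDl -YE /E !mulmxA mulmxV// mul1mx -mulmxA -trmx_mul mulmxV// trmx1 mulmx1.
  by rewrite /D addrC subrK.
rewrite WE; apply: posdef_cong => //.
apply: (@posdef1D _ _ _ (k / (1 + n%:R * k))).
- by rewrite /E !trmx_mul trmxK DT mulmxA.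
- move=> i j; rewrite -cabs_real.
  have -> : ((E i j)%:C%C : C) = toC E i j by rewrite [RHS]mxE.
  apply: le_trans (nrm_entry _ _ _) _.
  have BT : (toC B)^T = toC B^T by apply/matrixP => a b; rewrite !mxE.
  have -> : toC E = toC B *m toC D *m (toC B)^T by rewrite BT /toC -!map_mxM.
  apply: le_trans (nrmM _ _) _; rewrite nrm_tr.
  have h : nrm (toC D) <= (n ^ 2)%:R * (1 + n%:R * k)^-1.
    apply: nrm_le => a b; rewrite mxE cabs_real; apply: le_trans (ltW (H a b)).
    by rewrite !mxE; apply: le_trans (cabs_Im _); case: (W a b) (Z a b) => [? ?] [? ?].
  apply: (@le_trans _ _ (nrm (toC B) * ((n ^ 2)%:R * (1 + n%:R * k)^-1) * nrm (toC B))).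
    rewrite ler_wpM2r ?nrm_ge0//; apply: le_trans (nrmM _ _) _.
    by rewrite ler_wpM2l ?nrm_ge0.
  by rewrite le_eqVlt; apply/orP; left; apply/eqP; rewrite /k; ring.
- by rewrite mulrA ltr_pdivrMr// mul1r ltrDr.
Qed.

Lemma hol_cont (f : 'M[C]_n -> C) (D : set 'M[C]_n) Z : Z^T = Z ->
  @holomorphic_on n (C : numFieldType) D f -> D Z ->
  forall e : R, 0 < e -> exists2 eta : R, 0 < eta & forall W, W^T = W ->
    (forall i j, cabs (W i j - Z i j) < eta) -> cabs (f W - f Z) < e.
Proof.
move=> ZT hf DZ e e0.
have e0C : 0 < (e%:C%C : C) by rewrite (ltcR 0 e).
have [eta eta0 K] := differentiable_sym_cont (hf Z DZ) ZT e0C.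
have etaE : eta = (complex.Re eta)%:C%C by case: (eta) eta0 => a b /=; rewrite ltcE /= => /andP[/eqP -> _].
exists (complex.Re eta); first by move: eta0; rewrite {1}etaE (ltcR 0).
move=> W WT WZ; have := K W WT; rewrite -cabsE ltcR; apply => i j.
by rewrite -cabsE etaE ltcR.
Qed.

Definition res (D : set 'M[C]_n) (f : 'M[C]_n -> C) Z : C := if `[< D Z >] then f Z else 0.

(** Holomorphic functions are continuous on an open domain; the extension by zero is then measurable
    even though it may jump at the boundary. *)
Lemma mx_measC_hol (D : set 'M[C]_n) (f : 'M[C]_n -> C) :
  (forall Z, D Z -> Z^T = Z -> exists2 eta : R, 0 < eta &
    forall W, W^T = W -> (forall i j, cabs (W i j - Z i j) < eta) -> D W) ->
  @holomorphic_on n (C : numFieldType) D f -> mx_measC (res D f).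
Proof.
move=> Do hf.
have H (g : C -> R) : (forall z w, `|g z - g w| <= cabs (z - w)) -> g 0 = 0 ->
    measurable_fun setT (fun p : coords => g (res D f (siegel_pt p)) : T).
  move=> gL g0.
  have := @copen_measurable_fun R N [set p | D (siegel_pt p)] (fun p => g (f (siegel_pt p))).
  move=> /(_ _)/(eq_measurable_fun _ _); apply => [|p Hp e e0]; last first.
    have [a a0 Ha] := Do _ Hp (siegel_pt_sym p).
    have [b b0 Hb] := hol_cont (siegel_pt_sym p) hf Hp e0.
    have m0 : 0 < Num.min a b / 2 by rewrite divr_gt0// lt_min a0.
    exists (Num.min a b / 2) => // q pq.
    have near i j : cabs (siegel_pt q i j - siegel_pt p i j) < Num.min a b.
      rewrite !siegel_ptE; apply: le_lt_trans (cabs_le _) _ => /=.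
      by have [h1 h2] := pq (sidx i j); rewrite [ltRHS]splitr ltrD.
    split; first by apply: Ha; [exact: siegel_pt_sym|move=> i j; apply: lt_le_trans (near i j) _; rewrite ge_min lexx].
    apply: le_lt_trans (gL _ _) _; apply: Hb; first exact: siegel_pt_sym.
    by move=> i j; apply: lt_le_trans (near i j) _; rewrite ge_min lexx orbT.
  by move=> p _; rewrite /res; case: ifP.
by split; apply: H => //; [exact: Re_lip|exact: Im_lip].
Qed.

End HolMeasurable.

Section SetcDiff.
Context (K : numFieldType).

(** On a line of symmetric matrices the symmetrization is the identity, so holomorphy restricts to
    differentiability in one complex variable. *)
Lemma differentiable_line n (f : 'M[K]_n -> K) (A E : 'M[K]_n) (z : K) :
  A^T = A -> E^T = E ->
  differentiable (fun W : 'M[K]_n => f (symmetrize W) : K^o) (A + z *: E) ->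
  differentiable (fun w : K^o => f (A + w *: E) : K^o) z.
Proof.
move=> AT ET df.
have -> : (fun w : K^o => f (A + w *: E) : K^o) =
    (fun W : 'M[K]_n => f (symmetrize W) : K^o) \o (fun w : K^o => A + w *: E).
  by apply/funext => w /=; rewrite symmetrizeK// linearD linearZ /= AT ET.
apply: differentiable_comp; last exact: df.
apply: differentiableD; first exact: differentiable_cst.
exact: differentiableZl.
Qed.

Lemma differentiable_sqr (f : K -> K) (z : K) :
  differentiable (f : K^o -> K^o) z -> differentiable ((fun w => f w ^+ 2) : K^o -> K^o) z.
Proof.
move=> df; have -> : ((fun w => f w ^+ 2) : K^o -> K^o) = (f : K^o -> K^o) * (f : K^o -> K^o).
  by apply/funext => w; rewrite expr2.
exact: differentiableM.
Qed.

End SetcDiff.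

(** * The mean value inequality on a polydisc *)

Section PolydiscMean.
Context (R : realType) (n : nat).
Local Notation C := R[i].
Local Notation T := (measurableTypeR R).
Local Notation leb := (@lebesgue_measure R).
Local Notation lebn := (tuple_measure (@lebesgue_measure R)).
Local Notation N := ((n * n.+1)./2).
Local Notation coords := (N.-tuple T * N.-tuple T)%type.
Implicit Types (Z W : 'M[C]_n).
Local Open Scope ereal_scope.

Definition box (del : R) : set T := `[(- del)%R, del]%classic.

Lemma leb_box del : (0 < del)%R -> leb (box del) = (2 * del)%R%:E.
Proof.
move=> d0; rewrite /box lebesgue_measure_itv /= lte_fin gtrN// -EFinD opprK.
by congr EFin; ring.
Qed.

Definition tbox del M : set (M.-tuple T) := [set t | forall i, box del (tnth t i)].

Lemma measurable_tbox del M : measurable (@tbox del M).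
Proof.
have -> : @tbox del M = \bigcap_(i in [set: 'I_M]) ((fun t => tnth t i) @^-1` box del).
  by apply/seteqP; split => t H i; [move=> _; exact: H|exact: (H i I)].
apply: fin_bigcap_measurable => // i _.
by rewrite -[X in measurable X]setTI; apply: (measurable_tnth i) => //; exact: measurable_itv.
Qed.

Lemma leb_tbox del M : (0 < del)%R -> lebn M (@tbox del M) = ((2 * del) ^+ M)%R%:E.
Proof.
move=> d0; elim: M => [|M IH].
  rewrite /= diracE mem_set// => -[] //.
rewrite /= /cons_measure /pushforward.
have -> : (@tuple_cons _ T M) @^-1` @tbox del M.+1 = box del `*` @tbox del M.
  apply/seteqP; split => -[x t] /=.
    move=> H; split; first exact: (H ord0).
    by move=> i; have := H (lift ord0 i); rewrite tnthS.
  move=> [h1 h2] i; case: (unliftP ord0 i) => [j|] ->; last exact: h1.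
  by rewrite tnthS.
rewrite product_measure1E//; [|exact: measurable_itv|exact: measurable_tbox].
transitivity ((2 * del)%R%:E * ((2 * del) ^+ M)%R%:E); last by rewrite -EFinM exprS.
by congr (_ * _); [exact: leb_box|exact: IH].
Qed.

Lemma small_tbox del (p : coords) : small del (siegel_pt p) <-> @tbox del N p.1 /\ @tbox del N p.2.
Proof.
have bE x : box del x <-> (`|x| <= del)%R by rewrite /box /= in_itv /= ler_norml.
split=> [H|[H1 H2] i j].
  have h k : (`|tnth p.1 k| <= del)%R /\ (`|tnth p.2 k| <= del)%R.
    by have := H (sidx_inv k).1 (sidx_inv k).2; rewrite siegel_ptE sidx_invK.
  by split=> k; apply/bE; have [] := h k.
by rewrite siegel_ptE /=; split; apply/bE.
Qed.

Definition on_small (del : R) (h : 'M[C]_n -> \bar R) Z := if `[< small del Z >] then h Z else 0.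

Lemma measurable_small del : measurable [set p : coords | small del (siegel_pt p)].
Proof.
have -> : [set p : coords | small del (siegel_pt p)] = @tbox del N `*` @tbox del N.
  by apply/seteqP; split => p /= /small_tbox.
by apply: measurableX; exact: measurable_tbox.
Qed.

Lemma measurable_asbool (U : set coords) : measurable U -> measurable_fun setT (fun p => `[< U p >]).
Proof.
move=> mU; apply: (measurable_fun_bool true); rewrite setTI.
by congr measurable: mU; apply/seteqP; split => p /= /asboolP.
Qed.

Lemma mx_meas_on_small del h : mx_meas h -> mx_meas (on_small del h).
Proof.
move=> mh; apply: measurable_fun_ifT => //.
exact: (measurable_asbool (measurable_small del)).
Qed.

Lemma on_small_ge0 del h Z : (forall Z, 0 <= h Z) -> 0 <= on_small del h Z.
Proof. by move=> h0; rewrite /on_small; case: ifP. Qed.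

Lemma mx_int_small_cst del (c : R) : (0 < del)%R ->
  mx_int (on_small del (fun=> c%:E)) = (c * ((2 * del) ^+ N) ^+ 2)%R%:E.
Proof.
move=> d0; rewrite /mx_int /on_small.
have -> : (fun p : coords => if `[< small del (siegel_pt p) >] then c%:E else 0) =
    ((fun=> c%:E) \_ [set p : coords | small del (siegel_pt p)]).
  apply/funext => p; rewrite patchE.
  have -> : (p \in [set p : coords | small del (siegel_pt p)]) = `[< small del (siegel_pt p) >].
    by apply/idP/asboolP; rewrite in_setE.
  by case: ifP.
rewrite -integral_mkcond integral_cst; last exact: measurable_small.
have -> : [set p : coords | small del (siegel_pt p)] = @tbox del N `*` @tbox del N.
  by apply/seteqP; split => p /= /small_tbox.
transitivity (c%:E * (lebn N (@tbox del N) * lebn N (@tbox del N))).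
  by congr (_ * _); apply: product_measure1E; exact: measurable_tbox.
by rewrite !leb_tbox// -!EFinM expr2.
Qed.

Lemma I2_square_cst (del c : R) : (0 < del)%R -> (0 <= c)%R ->
  I2 (on_square del (fun=> c)) = (c * (2 * del) ^+ 2)%R%:E.
Proof.
move=> d0 c0; rewrite /I2.
have mk (a : R) : \int[leb]_x (if (`|x| <= del)%R then a%:E else 0) = (a * (2 * del))%R%:E.
  have -> : (fun x : T => if (`|x| <= del)%R then a%:E else 0) = ((fun=> a%:E) \_ (box del)).
    apply/funext => x; rewrite patchE.
    by have -> : (x \in box del) = (`|x| <= del)%R by rewrite /box mem_setE in_itv /= ler_norml.
  rewrite -integral_mkcond integral_cst; last exact: measurable_itv.
  transitivity (a%:E * (2 * del)%R%:E); last by rewrite -EFinM.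
  by congr (_ * _); exact: leb_box.
transitivity (\int[leb]_x (if (`|x| <= del)%R then (c * (2 * del))%R%:E else 0)).
  apply: eq_integral => x _; rewrite /on_square /=; case: ifP => hx; first by rewrite mk.
  by rewrite integral0.
by rewrite mk; congr EFin; ring.
Qed.

Definition zero_coords (s : seq 'I_N) Z : 'M[C]_n := \matrix_(i, j) if sidx i j \in s then 0%R else Z i j.

Section Polydisc.
Context (h : 'M[C]_n -> C) (del : R) (del0 : (0 < del)%R).
Hypothesis dh : @holomorphic_on n (C : numFieldType) [set Z | Z^T = Z /\ small del Z] h.
Let K := on_small del (fun Z => (cabs (h Z) ^+ 2)%R%:E).
Hypothesis mK : mx_meas K.

Let G s := on_small del (fun Z => K (zero_coords s Z)).

Let K0 Z : 0 <= K Z.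
Proof. by apply: on_small_ge0 => W; rewrite lee_fin sqr_ge0. Qed.

Let zero_sym s Z : Z^T = Z -> (zero_coords s Z)^T = zero_coords s Z.
Proof. by move=> ZT; apply/matrixP => i j; rewrite !mxE sidxC -{1}ZT mxE. Qed.

Let mG s : mx_meas (G s).
Proof.
apply: mx_meas_on_small; apply: mx_meas_comp => //; first exact: zero_sym.
move=> i j; under [fun Z => _]eq_fun do rewrite mxE.
case: (sidx i j \in s); [exact: (@mx_measC_cst R n (0%R : C))|exact: (@mx_measC_entry R n i j)].
Qed.

Let G0 s Z : 0 <= G s Z.
Proof. by apply: on_small_ge0. Qed.

Let small_zero s Z : small del Z -> small del (zero_coords s Z).
Proof. by move=> sZ i j; rewrite mxE; case: ifP => // _; rewrite /= normr0 ltW. Qed.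

Let GE s Z : G s Z = if `[< small del Z >] then (cabs (h (zero_coords s Z)) ^+ 2)%R%:E else 0.
Proof.
rewrite /G /on_small; case: ifPn => // /asboolP sZ.
by rewrite /K /on_small; case: ifPn => // /asboolPn []; exact: small_zero.
Qed.

(** Freezing one more entry at 0 costs a factor 16: the square has area [4 del^2], and [square_mean]
    gains [del^2 / 4]. It is applied to [h^2], holomorphic in that entry, whose modulus is
    [|h|^2]. *)
Let step m s : m \notin s -> mx_int (G (m :: s)) <= 16%:E * mx_int (G s).
Proof.
move=> ms; rewrite /mx_int -ge0_integralZl_EFin//; last exact: mG.
apply: (@mx_section_le R n m (G (m :: s)) (fun Z => 16%:E * G s Z)) => //.
- by apply: measurable_funeM; exact: mG.
- by move=> Z; rewrite mule_ge0.
move=> Z ZT.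
pose Z0 := setc Z m 0%R.
have Z0T : Z0^T = Z0 by exact: setc_sym.
have sm z : small del (setc Z m z) <-> [/\ small del Z0, (`|complex.Re z| <= del)%R & (`|complex.Im z| <= del)%R].
  split=> [H|[H h1 h2] i j].
    split; first by move=> i j; have := H i j; rewrite /Z0 !mxE; case: (sidx i j == m) => //= _; rewrite normr0; split; exact: ltW.
    - by have := H (sidx_inv m).1 (sidx_inv m).2; rewrite !mxE sidx_invK eqxx => -[].
    - by have := H (sidx_inv m).1 (sidx_inv m).2; rewrite !mxE sidx_invK eqxx => -[].
  by have := H i j; rewrite !mxE; case: ifP.
have z1 z : zero_coords (m :: s) (setc Z m z) = setc (zero_coords s Z) m 0%R.
  by apply/matrixP => i j; rewrite !mxE in_cons; case: eqP => //= _; case: ifP.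
have z2 z : zero_coords s (setc Z m z) = setc (zero_coords s Z) m z.
  apply/matrixP => i j; rewrite !mxE; case: eqP => [->|//]; by rewrite (negbTE ms).
pose u z := (h (setc (zero_coords s Z) m z) ^+ 2)%R.
have cu z : (cabs (h (setc (zero_coords s Z) m z)) ^+ 2 = cabs (u z))%R by rewrite /u cabsX.
have [sZ|nsZ] := pselect (small del Z0); last first.
  have G00 t q : G t (setc Z m q) = 0.
    by rewrite GE; case: ifPn => // /asboolP/sm[].
  have -> : I2 (fun q : T * T => G (m :: s) (setc Z m (Complex q.1 q.2))) = 0.
    by rewrite /I2 integral0_eq// => x _; rewrite integral0_eq// => y _; exact: G00.
  by apply: integral_ge0 => x _; apply: integral_ge0 => y _; rewrite mule_ge0.
have smE (q : T * T) : `[< small del (setc Z m (Complex q.1 q.2)) >] = (`|q.1| <= del)%R && (`|q.2| <= del)%R.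
  by apply/asboolP/andP => [/sm[]|[h1 h2]]; last exact/sm.
have E1 : (fun q : T * T => G (m :: s) (setc Z m (Complex q.1 q.2))) = on_square del (fun=> cabs (u 0%R)).
  by apply/funext => q; rewrite GE smE z1 cu.
have E2 : (fun q : T * T => G s (setc Z m (Complex q.1 q.2))) = on_square del (@cabs R \o u).
  by apply/funext => q; rewrite GE smE z2 cu.
have mu : measurable_fun setT (on_square del (@cabs R \o u)).
  by rewrite -E2; apply: mx_section_meas => //; exact: mG.
rewrite E1 I2_square_cst ?cabs_ge0//.
have -> : I2 (fun q : T * T => 16%:E * G s (setc Z m (Complex q.1 q.2))) = 16%:E * I2 (on_square del (@cabs R \o u)).
  rewrite -E2 I2Z ?E2// => p; exact: G0.
have du x y : (`|x| <= del)%R -> (`|y| <= del)%R -> cdiff u (Complex x y).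
  move=> hx hy; apply: differentiable_cdiff; apply: differentiable_sqr.
  pose A := setc (zero_coords s Z) m 0%R.
  pose E : 'M[C]_n := \matrix_(i, j) (sidx i j == m)%:R%R.
  have AE z : (setc (zero_coords s Z) m z = A + z *: E)%R.
    by apply/matrixP => i j; rewrite !mxE; case: eqP => _; rewrite ?mulr1 ?mulr0 ?add0r ?addr0.
  have AT : A^T = A by apply: setc_sym; exact: zero_sym.
  have ET : E^T = E by apply/matrixP => i j; rewrite !mxE sidxC.
  have -> : (fun w : C => h (setc (zero_coords s Z) m w)) = (fun w => h (A + w *: E)%R).
    by apply/funext => w; rewrite AE.
  apply: differentiable_line => //; apply: dh; split.
    by rewrite linearD linearZ /= AT ET.
  rewrite -AE -z2; apply: small_zero; exact/sm.
have := square_mean del0 du mu; rewrite -(@lee_pmul2l _ 16%:E)//.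
move/(le_trans _); apply; rewrite -EFinM lee_fin le_eqVlt; apply/orP; left; apply/eqP.
by field.
Qed.

Lemma polydisc_mean : (cabs (h 0) ^+ 2 * ((2 * del) ^+ N) ^+ 2)%R%:E <= (16 ^+ N)%R%:E * mx_int K.
Proof.
have H s : uniq s -> mx_int (G s) <= (16 ^+ size s)%R%:E * mx_int (G [::]).
  elim: s => [_|m s IH /= /andP[ms us]]; first by rewrite expr0 mul1e.
  apply: le_trans (step ms) _; rewrite exprS EFinM -muleA lee_pmul2l//; exact: IH.
have := H _ (enum_uniq 'I_N); rewrite size_enum_ord.
have -> : mx_int (G (enum 'I_N)) = mx_int (on_small del (fun=> (cabs (h 0%R) ^+ 2)%R%:E)).
  apply: eq_integral => p _; rewrite GE /on_small.
  have -> : zero_coords (enum 'I_N) (siegel_pt p) = 0%R by apply/matrixP => i j; rewrite !mxE mem_enum.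
  by [].
have -> : mx_int (G [::]) = mx_int K.
  apply: eq_integral => p _; rewrite GE /K /on_small.
  by have -> : zero_coords [::] (siegel_pt p) = siegel_pt p by apply/matrixP => i j; rewrite !mxE.
by rewrite mx_int_small_cst.
Qed.

End Polydisc.
End PolydiscMean.

Section AffineDiff.
Context (K : numFieldType) (n : nat).

Lemma differentiable_linear_mx (f : {linear 'M[K]_n -> 'M[K]_n}) (Z : 'M[K]_n) : differentiable f Z.
Proof.
have -> : (f : 'M[K]_n -> 'M[K]_n) =
    \sum_(i < n) \sum_(j < n) (fun W : 'M[K]_n => W i j *: f (delta_mx i j)).
  apply/funext => W; rewrite {1}(matrix_sum_delta W) linear_sum fct_sumE; apply: eq_bigr => i _.
  by rewrite linear_sum fct_sumE; apply: eq_bigr => j _; rewrite linearZ.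
apply: differentiable_sum => i; apply: differentiable_sum => j.
by apply: differentiableZl; exact: differentiable_coord.
Qed.

Lemma differentiable_symmetrize (Z : 'M[K]_n) : differentiable (@symmetrize n K) Z.
Proof.
apply: differentiableZ; apply: differentiableD; first exact: (differentiable_linear_mx (idfun : {linear 'M[K]_n -> 'M[K]_n})).
exact: (differentiable_linear_mx (trmx : {linear 'M[K]_n -> 'M[K]_n})).
Qed.

Lemma differentiable_expn (V : normedModType K) (f : V -> K^o) k x :
  differentiable f x -> differentiable (fun w => f w ^+ k : K^o) x.
Proof.
move=> df; elim: k => [|k IH].
  have -> : (fun w => f w ^+ 0 : K^o) = cst 1 by apply/funext => w; rewrite expr0.
  exact: differentiable_cst.
have -> : (fun w => f w ^+ k.+1 : K^o) = f * (fun w => f w ^+ k : K^o).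
  by apply/funext => w; rewrite exprS.
exact: differentiableM.
Qed.

Lemma differentiable_affine_weight (h : 'M[K]_n -> K) (P Q B S : 'M[K]_n) (c : K) k Z :
  (forall W : 'M[K]_n, W^T = W -> (P *m (B + W) *m Q + S)^T = P *m (B + W) *m Q + S) ->
  differentiable (fun W : 'M[K]_n => h (symmetrize W) : K^o) (P *m (B + symmetrize Z) *m Q + S) ->
  differentiable (fun W : 'M[K]_n => h (P *m (B + symmetrize W) *m Q + S) *
    (1 + c * \tr (symmetrize W)) ^+ k : K^o) Z.
Proof.
move=> sym dh.
have symsym (W : 'M[K]_n) : (symmetrize W)^T = symmetrize W.
  by rewrite /symmetrize; apply/matrixP => i j; rewrite !mxE addrC.
have -> : (fun W : 'M[K]_n => h (P *m (B + symmetrize W) *m Q + S) * (1 + c * \tr (symmetrize W)) ^+ k : K^o) =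
    ((fun W : 'M[K]_n => h (symmetrize W) : K^o) \o (fun W => P *m (B + symmetrize W) *m Q + S)) *
    (fun W => (1 + c * \tr (symmetrize W)) ^+ k : K^o).
  apply/funext => W.
  transitivity (h (symmetrize (P *m (B + symmetrize W) *m Q + S)) * (1 + c * \tr (symmetrize W)) ^+ k) => //.
  by rewrite (symmetrizeK (sym _ (symsym W))).
apply: differentiableM.
  apply: differentiable_comp => //.
  apply: differentiableD; last exact: differentiable_cst.
  have -> : (fun W => P *m (B + symmetrize W) *m Q) = (mulmxr Q : 'M[K]_n -> 'M[K]_n) \o ((mulmx P : 'M[K]_n -> 'M[K]_n) \o (fun W => B + symmetrize W)) by [].
  apply: differentiable_comp; last exact: (differentiable_linear_mx (mulmxr Q : {linear 'M[K]_n -> 'M[K]_n})).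
  apply: differentiable_comp; last exact: (differentiable_linear_mx (mulmx P : {linear 'M[K]_n -> 'M[K]_n})).
  apply: differentiableD; first exact: differentiable_cst.
  exact: differentiable_symmetrize.
apply: differentiable_expn; apply: differentiableD; first exact: differentiable_cst.
have -> : (fun W : 'M[K]_n => c * \tr (symmetrize W) : K^o) =
    (fun W : 'M[K]_n => c * \tr W : K^o) \o (@symmetrize n K) by [].
apply: differentiable_comp; first exact: differentiable_symmetrize.
have -> : (fun W : 'M[K]_n => c * \tr W : K^o) = \sum_(i < n) (fun W : 'M[K]_n => W i i *: (c : K^o)).
  by apply/funext => W; rewrite fct_sumE /mxtrace mulr_sumr; apply: eq_bigr => i _; rewrite /GRing.scale /= mulrC.
by apply: differentiable_sum => i; apply: differentiableZl; exact: differentiable_coord.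
Qed.

End AffineDiff.

(** * The local bound at an arbitrary point *)

Section Local.
Context (R : realType) (n : nat).
Local Notation C := R[i].
Local Notation T := (measurableTypeR R).
Local Notation N := ((n * n.+1)./2).
Local Notation coords := (N.-tuple T * N.-tuple T)%type.
Implicit Types (Z W : 'M[C]_n) (g : 'M[R]_(n + n)).
Local Notation iM := ((Complex 0 1)%:M : 'M[C]_n).

Definition sp_aff (X A : 'M[R]_n) := sp_trans X *m sp_levi A.

Lemma symplectic_aff X A : X^T = X -> A \in unitmx -> symplectic (sp_aff X A).
Proof.
by move=> XT Au; apply: spgen_symplectic; apply: spgen_mul; [exact: spgen_trans|exact: spgen_levi].
Qed.

Lemma siegel_act_aff X A W : X^T = X -> A \in unitmx -> siegel_space W ->
  siegel_act (sp_aff X A) W = toC A *m W *m toC A^T + toC X.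
Proof.
move=> XT Au WH; rewrite siegel_act_mul ?siegel_act_trans ?siegel_act_levi//.
- exact: symplectic_trans.
- by apply: spgen_symplectic; exact: spgen_levi.
Qed.

(** The lower left block of an affine map vanishes, so its automorphy factor does not depend on the
    point. *)
Lemma autfactor_aff X A W W' : autfactor (sp_aff X A) W = autfactor (sp_aff X A) W'.
Proof.
rewrite /autfactor /sp_aff /sp_trans /sp_levi mulmx_block block_mxKdl block_mxKdr.
by rewrite mul0mx mulmx0 addr0 /toC map_mx0 !mul0mx.
Qed.

(** Take [X] the real part of [Z] and [A] a Cholesky factor of the imaginary part. *)
Lemma siegel_base Z : siegel_space Z -> exists X A, [/\ A \in unitmx, X^T = X & siegel_act (sp_aff X A) iM = Z].
Proof.
move=> [ZT [YT YP]]; have [A Au YE] := cholesky YT YP.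
pose X : 'M[R]_n := map_mx (@complex.Re R) Z.
have XT : X^T = X by apply/matrixP => i j; rewrite !mxE -[in LHS]ZT mxE.
exists X, A; split => //; rewrite siegel_act_aff//; last exact: siegel_i.
rewrite mul_mx_scalar -scalemxAl /toC -map_mxM -YE.
by apply/matrixP => i j; rewrite !mxE; case: (Z i j) => a b; apply/eqP; rewrite eq_complex /=; apply/andP; split; apply/eqP; ring.
Qed.

Lemma detIm_aff X A W : X^T = X -> A \in unitmx -> siegel_space W ->
  \det (ImM (siegel_act (sp_aff X A) W)) = \det (ImM (siegel_act (sp_aff X A) iM)) * \det (ImM W).
Proof.
move=> XT Au WH; have gS := symplectic_aff XT Au.
have h1 := det_siegel_act_Im gS WH; have h2 := det_siegel_act_Im gS (siegel_i R n).
rewrite (autfactor_aff X A W iM) in h1; set c := cabs _ ^+ 2 in h1 h2.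
have Ii : ImM iM = 1%:M by rewrite -[iM]addr0 ImM_iD; apply/matrixP => i j; rewrite !mxE /= addr0.
rewrite Ii det1 in h2.
have c0 : c != 0 by apply/eqP => c0; move: h2; rewrite c0 mul0r => /eqP; rewrite eq_sym oner_eq0.
by apply: (mulfI c0); rewrite h1 mulrA h2 mul1r.
Qed.

(** Its modulus squared is [(1 + tr(Im Z) / 2)^2 + (tr(Re Z) / 2)^2], which agrees with
    [det(1 + Im Z)] to first order. *)
Definition weight (Z : 'M[C]_n) : C := 1 + Complex 0 (- 2^-1) * \tr Z.

(** The quadratic errors of the determinant and of the weight, doubled because they are compared
    with a determinant that is only known to be at least 1/2. *)
Definition wcst : R := 2 * (det_cst R n + n%:R ^+ 2).

Lemma trIm (Z : 'M[C]_n) : complex.Im (\tr Z) = \tr (ImM Z).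
Proof.
rewrite /mxtrace (big_morph (@complex.Im R) (id1 := 0) (op1 := +%R))//.
  by apply: eq_bigr => i _; rewrite mxE.
exact: complex_ImD.
Qed.

Lemma trRe_le e (Z : 'M[C]_n) : small e Z -> `|complex.Re (\tr Z)| <= n%:R * e.
Proof.
move=> sZ; rewrite /mxtrace (big_morph (@complex.Re R) (id1 := 0) (op1 := +%R))//; last exact: complex_ReD.
apply: le_trans (ler_norm_sum _ _ _) _; apply: (@le_trans _ _ (\sum_(i < n) e)).
  by apply: ler_sum => i _; have [] := sZ i i.
by rewrite sumr_const card_ord mulr_natl.
Qed.

Lemma trIm_le e (Z : 'M[C]_n) : small e Z -> `|\tr (ImM Z)| <= n%:R * e.
Proof.
move=> sZ; apply: le_trans (ler_norm_sum _ _ _) _; apply: (@le_trans _ _ (\sum_(i < n) e)).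
  by apply: ler_sum => i _; rewrite mxE; have [] := sZ i i.
by rewrite sumr_const card_ord mulr_natl.
Qed.

Lemma small_weight e Z : small e Z -> 0 <= e <= 1 -> n%:R * e <= 4^-1 -> det_cst R n * e ^+ 2 <= 4^-1 ->
  [/\ cabs (weight Z) ^+ 2 <= (1 + wcst * e ^+ 2) * \det (1%:M + ImM Z),
      2^-1 <= \det (1%:M + ImM Z) & \det (1%:M + ImM Z) <= 2].
Proof.
move=> sZ /[dup] e01 /andP[e0 e1] ne de.
have HE i j : `|ImM Z i j| <= e by rewrite mxE; have [] := sZ i j.
have := det1D_bound e01 HE; set D := \det _ => HD.
have hb := trIm_le sZ; have ha := trRe_le sZ.
have LE : cabs (weight Z) ^+ 2 = (1 + \tr (ImM Z) / 2) ^+ 2 + (complex.Re (\tr Z) / 2) ^+ 2.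
  rewrite cabs_sqr /weight -trIm; case: (\tr Z) => a b /=; ring.
rewrite LE; move: hb ha; set b := \tr (ImM Z) in HD *; set a := complex.Re _ => hb ha.
have b2 : b ^+ 2 <= (n%:R * e) ^+ 2 by rewrite -[leLHS]real_normK ?num_real// ler_pXn2r ?nnegrE// mulr_ge0.
have a2 : a ^+ 2 <= (n%:R * e) ^+ 2 by rewrite -[leLHS]real_normK ?num_real// ler_pXn2r ?nnegrE// mulr_ge0.
move: HD; rewrite ler_norml => /andP[HD1 HD2].
move: hb; rewrite ler_norml => /andP[hb1 hb2].
have D2 : 2^-1 <= D by lra.
split => //; last by lra.
have d0 : 0 <= det_cst R n * e ^+ 2 by rewrite mulr_ge0 ?sqr_ge0// (le_trans ler01) ?det_cst_ge1.
have n0 : 0 <= (n%:R * e) ^+ 2 :> R by exact: sqr_ge0.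
have w0 : wcst * e ^+ 2 = 2 * (det_cst R n * e ^+ 2) + 2 * (n%:R * e) ^+ 2 by rewrite /wcst; ring.
have w1 : 0 <= wcst * e ^+ 2 by rewrite w0; lra.
have := ler_wpM2l w1 D2; rewrite w0 => w2.
have -> : (1 + b / 2) ^+ 2 + (a / 2) ^+ 2 = 1 + b + b ^+ 2 / 4 + a ^+ 2 / 4 by field.
rewrite mulrDl mul1r; lra.
Qed.

Definition phi (h : 'M[C]_n -> C) k Z : R := \det (ImM Z) ^+ k * cabs (h Z) ^+ 2.

Lemma phi_ge0 h k Z : siegel_space Z -> 0 <= phi h k Z.
Proof. by move=> ZH; rewrite mulr_ge0 ?sqr_ge0// exprn_ge0// ltW// detIm_gt0. Qed.

Local Open Scope ereal_scope.

Lemma mx_meas_cabs_sqr (f : 'M[C]_n -> C) : mx_measC f -> mx_meas (fun Z => (cabs (f Z) ^+ 2)%R%:E).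
Proof.
move=> [mr mi]; apply/measurable_EFinP.
under eq_fun do rewrite cabs_sqr.
by apply: measurable_funD; apply: measurable_funX.
Qed.

Lemma mx_meas_phi h k : @holomorphic_on n (C : numFieldType) (@siegel_space R n) h ->
  mx_meas (mxH (fun Z => (phi h k Z)%:E)).
Proof.
move=> hh; have mh := mx_measC_hol (fun Z ZH _ => siegel_space_open ZH) hh.
have m1 := mx_meas_mulR (mx_meas_cabs_sqr mh) (mx_measR_X k (@mx_measR_detIm R n)).
apply: eq_mx_meas m1 => Z ZT; rewrite /mxH /res /phi; case: ifP => // _.
  by rewrite -EFinM mulrC.
by rewrite cabs0 expr0n mul0e.
Qed.

Definition near_i e Z : Prop := small e (Z - iM)%R.

Lemma mx_meas_near_i e : mx_meas (mxH (fun Z => (`[< near_i e Z >]%:R)%R%:E)).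
Proof.
pose one (_ : 'M[C]_n) : \bar R := 1.
have mH : mx_meas (mxH one).
  have hol1 : @holomorphic_on n (C : numFieldType) (@siegel_space R n) (fun=> 1%R).
    by move=> Z _; exact: differentiable_cst.
  apply: eq_mx_meas (mx_meas_phi 0 hol1) => Z ZT; rewrite /mxH; case: ifP => // _.
  by rewrite /phi expr0 cabs1 expr1n mulr1.
have mS : mx_meas (fun Z => on_small e one (Z - iM)%R).
  apply: (@mx_meas_comp R n (on_small e one) (fun Z => Z - iM)%R).
  - by apply: mx_meas_on_small; exact: measurable_cst.
  - by move=> Z ZT; rewrite linearB /= ZT tr_scalar_mx.
  - move=> i j; under [fun Z => _]eq_fun do rewrite 2!mxE.
    apply: mx_measCD; first exact: (@mx_measC_entry R n i j).
    exact: (@mx_measC_cst R n).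
have m2 : mx_meas (fun Z => mxH one Z * on_small e one (Z - iM)%R) by exact: emeasurable_funM.
apply: eq_mx_meas m2 => Z ZT; rewrite /mxH; case: ifP => _; last by rewrite mul0e.
by rewrite mul1e /on_small /near_i; case: ifP.
Qed.

Lemma mx_int_shift (B : 'M[C]_n) (h : 'M[C]_n -> \bar R) : B^T = B -> mx_meas h ->
  (forall Z, 0 <= h Z) -> mx_int (fun Z => h (B + Z)%R) = mx_int h.
Proof.
move=> BT mh h0.
have e0 : uniq (enum 'I_N) := enum_uniq _.
have := @mx_int_taff R n (fun _ _ => 1%R) (fun _ m => B (sidx_inv m).1 (sidx_inv m).2)
  (fun _ _ => oner_neq0 _) (fun _ => @mx_measC_cst R n _) (fun _ => @mx_measC_cst R n _) (enum 'I_N) h e0.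
move=> /(_ _ mh h0) <- //; apply: eq_mx_int => Z ZT.
rewrite /tjac big1 ?mul1e; last by move=> m _; rewrite cabs1 expr1n.
congr h; apply/matrixP => i j; rewrite !mxE mem_enum mul1r addrC; congr (_ + _)%R.
by apply: sym_sidx => //; rewrite sidx_invK.
Qed.

(** The factor [16^N] is that of the polydisc inequality, [(1 + wcst e^2)^k] compares the weight
    with the determinant, and [2^(n+1)] undoes the density of the measure, since the determinant is
    at most 2 on the polydisc. Under the affine map [det(Im)] is multiplied by its value at the
    image of the base point. *)
Lemma local_mean h k (X A : 'M[R]_n) (e : R) :
  @holomorphic_on n (C : numFieldType) (@siegel_space R n) h -> X^T = X -> A \in unitmx ->
  (0 < e <= 1)%R -> (n%:R * e <= 4^-1)%R -> (det_cst R n * e ^+ 2 <= 4^-1)%R ->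
  let g := sp_aff X A in
  (phi h k (siegel_act g iM) * ((2 * e) ^+ N) ^+ 2)%R%:E <=
  (16 ^+ N * (1 + wcst * e ^+ 2) ^+ k * 2 ^+ n.+1)%R%:E *
    sint (fun W => if `[< near_i e (siegel_act (invmx g) W) >] then (phi h k W)%:E else 0).
Proof.
move=> hh XT Au /andP[e0 e1] ne de /=; set g := sp_aff X A.
have gS : symplectic g := symplectic_aff XT Au.
have iH := siegel_i R n.
have e01 : (0 <= e <= 1)%R by rewrite ltW.
have ne1 : (n%:R * e < 1)%R by apply: le_lt_trans ne _; rewrite invf_lt1// ltr1n.
pose Q := (toC A)^T.
have QE : toC A^T = Q by apply/matrixP => i j; rewrite !mxE.
pose F Z := (toC A *m (iM + Z) *m Q + toC X)%R.
have Fsym Z : (Z^T = Z -> (F Z)^T = F Z)%R.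
  move=> ZT; rewrite /F linearD /= !trmx_mul /Q trmxK linearD /= tr_scalar_mx ZT mulmxA.
  by rewrite (toC_sym XT).
pose D : set 'M[C]_n := [set Z | siegel_space (iM + Z)%R].
have Dopen Z : D Z -> Z^T = Z -> exists2 eta : R, (0 < eta)%R &
    forall W, W^T = W -> (forall i j, (cabs (W i j - Z i j) < eta)%R) -> D W.
  move=> DZ ZT; have [eta eta0 H] := siegel_space_open DZ; exists eta => // W WT WZ.
  apply: H; first by rewrite linearD /= tr_scalar_mx WT.
  by move=> i j; have := WZ i j; rewrite !mxE opprD addrACA subrr add0r.
pose hF Z : C := (h (F Z) * weight Z ^+ k)%R.
have hol : @holomorphic_on n (C : numFieldType) D hF.
  move=> Z DZ; apply: differentiable_affine_weight.
    by move=> W WT; exact: Fsym.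
  have ZT : Z^T = Z.
    by have [h1 _] := DZ; move: h1; rewrite linearD /= tr_scalar_mx => /addrI.
  apply: hh; rewrite symmetrizeK//.
  have -> : (toC A *m (iM + Z) *m Q + toC X)%R = siegel_act g (iM + Z)%R by rewrite siegel_act_aff// QE.
  exact: siegel_act_space.
have FE Z : D Z -> F Z = siegel_act g (iM + Z)%R by move=> DZ; rewrite /F siegel_act_aff// QE.
have smD Z : Z^T = Z -> small e Z -> D Z by move=> ZT sZ; exact: (siegel_iD ZT sZ).
have hol' : @holomorphic_on n (C : numFieldType) [set Z | Z^T = Z /\ small e Z] hF.
  by move=> Z [ZT sZ]; apply: hol; exact: smD.
have mh := mx_measC_hol Dopen hol.
have mK : mx_meas (on_small e (fun Z => (cabs (hF Z) ^+ 2)%R%:E)).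
  have m1 : mx_meas (on_small e (fun Z => (cabs (res D hF Z) ^+ 2)%R%:E)).
    by apply: mx_meas_on_small; exact: mx_meas_cabs_sqr.
  apply: eq_mx_meas m1 => Z ZT; rewrite /on_small; case: ifPn => // /asboolP sZ.
  by rewrite /res asboolT//; exact: smD.
have := polydisc_mean e0 hol' mK.
have hF0 : hF 0%R = h (siegel_act g iM).
  by rewrite /hF /weight mxtrace0 mulr0 addr0 expr1n mulr1 FE ?addr0// /D /= addr0.
rewrite hF0 => PM.
pose d0 := \det (ImM (siegel_act g iM)).
have d0p : (0 < d0)%R by apply: detIm_gt0; exact: siegel_act_space.
pose psi W := if `[< near_i e (siegel_act (invmx g) W) >] then (phi h k W)%:E else 0.
pose w := ((1 + wcst * e ^+ 2) ^+ k)%R.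
have wc0 : (0 <= wcst)%R by rewrite /wcst mulr_ge0// addr_ge0 ?sqr_ge0// (le_trans ler01) ?det_cst_ge1.
have w0 : (0 <= w)%R by rewrite exprn_ge0// addr_ge0// mulr_ge0// sqr_ge0.
have psi0 Z : siegel_space Z -> 0 <= psi Z.
  by move=> ZH; rewrite /psi; case: ifP => // _; rewrite lee_fin phi_ge0.
have mpsi : mx_meas (mxH psi).
  have [m1 _] := symplectic_invariant (symplecticV gS) (h := fun Z => (`[< near_i e Z >]%:R)%R%:E)
    (fun _ _ => ltac:(by rewrite lee_fin)) (mx_meas_near_i e).
  have m2 : mx_meas (fun Z => mxH ((fun Z => (`[< near_i e Z >]%:R)%R%:E) \o siegel_act (invmx g)) Z * mxH (fun Z => (phi h k Z)%:E) Z).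
    by apply: emeasurable_funM => //; exact: mx_meas_phi.
  apply: eq_mx_meas m2 => Z ZT; rewrite /mxH /psi /=; case: ifP => _; last by rewrite mul0e.
  by case: ifP => _; rewrite ?mul1e ?mul0e.
have [mpg sE] := symplectic_invariant gS psi0 mpsi.
rewrite -sE.
pose I1 W := mxH (psi \o siegel_act g) W * (sdens W)%:E.
have I10 W : 0 <= I1 W by apply: mxH_dens_ge0 => Z ZH; apply: psi0; exact: siegel_act_space.
have mI1 : mx_meas I1 by exact: mx_meas_dens.
have key Z : Z^T = Z -> (d0 ^+ k)%:E * on_small e (fun Z => (cabs (hF Z) ^+ 2)%R%:E) Z <=
    (w * 2 ^+ n.+1)%R%:E * I1 (iM + Z)%R.
  move=> ZT; rewrite /on_small; case: ifPn => [/asboolP sZ|_]; last first.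
    by rewrite mule0 mule_ge0// lee_fin mulr_ge0// exprn_ge0.
  have DZ := smD Z ZT sZ.
  rewrite /I1 /mxH asboolT//= /psi siegel_actK//.
  have -> : `[< near_i e (iM + Z)%R >] by apply/asboolP; rewrite /near_i addrC addKr.
  have [wt dlo dhi] := small_weight sZ e01 ne de.
  rewrite /phi detIm_aff// -/d0 ImM_iD /sdens ImM_iD -FE// /hF cabsM cabsX.
  move: wt dlo dhi; set d := \det (1%:M + ImM Z)%R => wt dlo dhi.
  have dp : (0 < d)%R by apply: lt_le_trans dlo; rewrite invr_gt0.
  rewrite -!EFinM lee_fin exprMn -exprM mulnC exprM.
  have wk : ((cabs (weight Z) ^+ 2) ^+ k <= w * d ^+ k)%R.
    by rewrite /w -exprMn; apply: lerXn2r; rewrite ?nnegrE ?sqr_ge0// mulr_ge0 ?(ltW dp)// addr_ge0// mulr_ge0// sqr_ge0.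
  have dd : (1 <= 2 ^+ n.+1 * d ^- n.+1)%R.
    rewrite -exprVn -exprMn exprn_ege1// -ler_pdivrMr ?invr_gt0// invrK mul1r //.
  apply: (@le_trans _ _ (d0 ^+ k * (cabs (h (F Z)) ^+ 2 * (w * d ^+ k)))%R).
    by rewrite ler_wpM2l ?exprn_ge0 ?(ltW d0p)// ler_wpM2l ?sqr_ge0.
  rewrite exprMn.
  have -> : (w * 2 ^+ n.+1 * (d0 ^+ k * d ^+ k * cabs (h (F Z)) ^+ 2 * d ^- n.+1) =
    d0 ^+ k * (cabs (h (F Z)) ^+ 2 * (w * d ^+ k)) * (2 ^+ n.+1 * d ^- n.+1))%R by ring.
  rewrite ler_peMr// mulr_ge0 ?exprn_ge0 ?(ltW d0p)// mulr_ge0 ?sqr_ge0//.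
  by rewrite mulr_ge0// exprn_ge0// ltW.
have K0 Z : 0 <= on_small e (fun Z => (cabs (hF Z) ^+ 2)%R%:E) Z.
  by apply: on_small_ge0 => W; rewrite lee_fin sqr_ge0.
have step : (d0 ^+ k)%:E * mx_int (on_small e (fun Z => (cabs (hF Z) ^+ 2)%R%:E)) <=
    (w * 2 ^+ n.+1)%R%:E * sint (psi \o siegel_act g).
  have -> : sint (psi \o siegel_act g) = mx_int (fun Z => I1 (iM + Z)%R).
    by rewrite mx_int_shift// tr_scalar_mx.
  have mI2 : mx_meas (fun Z => I1 (iM + Z)%R).
    apply: (@mx_meas_comp R n I1 (fun Z => iM + Z)%R) => //.
      by move=> Z ZT; rewrite linearD /= tr_scalar_mx ZT.
    move=> i j; under [fun Z => _]eq_fun do rewrite mxE.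
    by apply: mx_measCD; [exact: (@mx_measC_cst R n)|exact: (@mx_measC_entry R n i j)].
  rewrite /mx_int -ge0_integralZl_EFin ?exprn_ge0 ?(ltW d0p)//.
  have w2 : (0 <= w * 2 ^+ n.+1)%R by rewrite mulr_ge0// exprn_ge0.
  rewrite -ge0_integralZl_EFin//.
  apply: ge0_le_integral => //.
  - by move=> p _; rewrite mule_ge0// lee_fin exprn_ge0// ltW.
  - exact: measurable_funeM.
  - exact: measurable_funeM.
  - by move=> p _; apply: key; exact: siegel_pt_sym.
have -> : (phi h k (siegel_act g iM) * ((2 * e) ^+ N) ^+ 2)%R%:E =
    (d0 ^+ k)%:E * (cabs (h (siegel_act g iM)) ^+ 2 * ((2 * e) ^+ N) ^+ 2)%R%:E.
  by rewrite -EFinM; congr EFin; apply/esym; exact: mulrA.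
apply: (@le_trans _ _ ((d0 ^+ k)%:E * ((16 ^+ N)%R%:E * mx_int (on_small e (fun Z => (cabs (hF Z) ^+ 2)%R%:E))))).
  by apply: lee_wpmul2l => //; rewrite lee_fin exprn_ge0// ltW.
rewrite muleCA -mulrA EFinM -muleA; apply: lee_wpmul2l => //.
Qed.

End Local.

Section SintSeries.
Context (R : realType) (n : nat).
Local Notation C := R[i].
Local Notation T := (measurableTypeR R).
Local Notation N := ((n * n.+1)./2).
Local Notation coords := (N.-tuple T * N.-tuple T)%type.
Implicit Types (Z W : 'M[C]_n) (g : 'M[R]_(n + n)).
Local Open Scope ereal_scope.

Lemma sint_le (h1 h2 : 'M[C]_n -> \bar R) :
  (forall Z, siegel_space Z -> 0 <= h1 Z) -> (forall Z, siegel_space Z -> h1 Z <= h2 Z) ->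
  mx_meas (mxH h1) -> mx_meas (mxH h2) -> sint h1 <= sint h2.
Proof.
move=> h0 h12 m1 m2.
have h20 Z : siegel_space Z -> 0 <= h2 Z by move=> ZH; apply: le_trans (h0 Z ZH) (h12 Z ZH).
apply: ge0_le_integral => //.
- by move=> p _; exact: mxH_dens_ge0.
- exact: mx_meas_dens.
- exact: mx_meas_dens.
move=> p _; rewrite /mxH; case: ifPn => [/asboolP pH|_]; last by rewrite mul0e.
by apply: lee_wpmul2r; [rewrite lee_fin invr_ge0 exprn_ge0// ltW// detIm_gt0|exact: h12].
Qed.

Lemma mxH_series (b : nat -> 'M[C]_n -> \bar R) Z :
  mxH (fun W => \sum_(k <oo) b k W) Z = \sum_(k <oo) mxH (b k) Z.
Proof. by rewrite /mxH; case: ifP => // _; rewrite eseries0. Qed.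

Lemma mx_meas_series (b : nat -> 'M[C]_n -> \bar R) :
  (forall k Z, siegel_space Z -> 0 <= b k Z) -> (forall k, mx_meas (mxH (b k))) ->
  mx_meas (mxH (fun W => \sum_(k <oo) b k W)).
Proof.
move=> b0 mb; rewrite /mx_meas; under eq_fun do rewrite mxH_series.
apply: (@ge0_emeasurable_sum _ _ R setT (fun k (p : coords) => mxH (b k) (siegel_pt p)) xpredT) => k.
  by move=> p _ _; apply: mxH_ge0; exact: b0.
by move=> _; exact: mb.
Qed.

Lemma sint_series (b : nat -> 'M[C]_n -> \bar R) :
  (forall k Z, siegel_space Z -> 0 <= b k Z) -> (forall k, mx_meas (mxH (b k))) ->
  sint (fun W => \sum_(k <oo) b k W) = \sum_(k <oo) sint (b k).
Proof.
move=> b0 mb; rewrite /sint /mx_int.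
rewrite -(@integral_nneseries _ _ _ _ setT measurableT (fun k (p : coords) => mxH (b k) (siegel_pt p) * (sdens (siegel_pt p : 'M[C]_n))%:E)) //; last 2 first.
- by move=> k; exact: mx_meas_dens.
- by move=> k p _; apply: mxH_dens_ge0; exact: b0.
apply: eq_integral => p _; rewrite mxH_series muleC -nneseriesZl; last by move=> k _; apply: mxH_ge0; exact: b0.
by apply: eq_eseriesr => k _; rewrite muleC.
Qed.

End SintSeries.

(** * Unfolding and counting *)

Section Unfold.
Context (R : realType) (n : nat).
Local Notation C := R[i].
Local Notation T := (measurableTypeR R).
Local Notation N := ((n * n.+1)./2).
Local Notation coords := (N.-tuple T * N.-tuple T)%type.
Implicit Types (Z W : 'M[C]_n) (g : 'M[R]_(n + n)).
Context (G : set 'M[R]_(n + n)) (GG : is_subgroup G).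
Context (e : nat -> 'M[R]_(n + n)) (code : 'M[R]_(n + n) -> nat).
Hypothesis eK : forall g, G g -> e (code g) = g.
Local Open Scope ereal_scope.

(** Selects one index for each element of the group, so that sums over the group become series and
    monotone convergence applies. *)
Let P k : bool := `[< G (e k) /\ code (e k) = k >].

Lemma esum_code (a : 'M[R]_(n + n) -> \bar R) : (forall g, G g -> 0 <= a g) ->
  \esum_(g in G) a g = \sum_(k <oo) (if P k then a (e k) else 0).
Proof.
move=> a0; rewrite -eseries_mkcond nneseries_esum; last by move=> k /asboolP[Gk _]; exact: a0.
apply: reindex_esum; split.
- by move=> k /asboolP[].
- move=> k l; rewrite !in_setE => /asboolP[_ hk] /asboolP[_ hl] kl.
  by rewrite -hk kl hl.
- by move=> g Gg; exists (code g); [apply/asboolP; rewrite eK|exact: eK].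
Qed.

Lemma esum_codeZ (a : 'M[R]_(n + n) -> \bar R) (c : R) : (0 <= c)%R -> (forall g, G g -> 0 <= a g) ->
  \esum_(g in G) (c%:E * a g) = c%:E * \esum_(g in G) a g.
Proof.
move=> c0 a0; rewrite !esum_code//; last by move=> g Gg; rewrite mule_ge0// a0.
rewrite -nneseriesZl; last by move=> k _; case: ifP => // /asboolP[Gk _]; exact: a0.
by apply: eq_eseriesr => k _; case: ifP => // _; rewrite mule0.
Qed.

Lemma esum_translate (a : 'M[R]_(n + n) -> \bar R) g : G g ->
  \esum_(s in G) a (s *m invmx g) = \esum_(s in G) a s.
Proof.
have [GS _ GM GV] := GG; move=> Gg.
have gu := symplectic_unit (GS g Gg).
apply/esym; apply: reindex_esum; split.
- by move=> s Gs; apply: GM => //; exact: GV.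
- by move=> s t _ _ /(congr1 (mulmx^~ g)); rewrite !mulmxKV.
- by move=> s Gs; exists (s *m g); [exact: GM|rewrite mulmxK].
Qed.

Variables (F : set 'M[C]_n) (FD : fundamental_domain G F).

Definition indF W : \bar R := if `[< F W >] then 1 else 0.

Lemma mx_meas_indF : mx_meas indF.
Proof.
have [_ mF _] := FD.
apply: measurable_fun_ifT; [|exact: measurable_cst|exact: measurable_cst].
exact: (measurable_asbool mF).
Qed.

Variables (Phi X : 'M[C]_n -> \bar R).
Hypotheses (Phi0 : forall W, siegel_space W -> 0 <= Phi W) (mPhi : mx_meas (mxH Phi)).
Hypotheses (X0 : forall W, siegel_space W -> 0 <= X W) (mX : mx_meas (mxH X)).
Hypothesis PhiG : forall g W, G g -> siegel_space W -> Phi (siegel_act g W) = Phi W.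

Lemma mxH_mul (h1 h2 : 'M[C]_n -> \bar R) Z : mxH (fun W => h1 W * h2 W) Z = mxH h1 Z * mxH h2 Z.
Proof. by rewrite /mxH; case: ifP => // _; rewrite mul0e. Qed.

Lemma mx_meas_mxHM (h1 h2 : 'M[C]_n -> \bar R) : mx_meas (mxH h1) -> mx_meas (mxH h2) ->
  mx_meas (mxH (fun W => h1 W * h2 W)).
Proof.
move=> m1 m2; rewrite /mx_meas; under eq_fun do rewrite mxH_mul.
exact: emeasurable_funM.
Qed.

Lemma indF_ge0 W : 0 <= indF W.
Proof. by rewrite /indF; case: ifP. Qed.

Lemma mx_meas_mxH_indF : mx_meas (mxH indF).
Proof.
have [FH _ _] := FD.
apply: eq_mx_meas mx_meas_indF => Z _; rewrite /mxH /indF.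
have [FZ|FZ] := pselect (F Z); first by rewrite (asboolT FZ) (asboolT (FH _ FZ)).
by rewrite (asboolF FZ) if_same.
Qed.

(** Every point has a translate in [F], so [1 <= \sum 1_F(g^-1 W)] may be inserted. Substituting
    [W -> g W] in each term moves the sum onto [X], where the pointwise bound by [S] applies. *)
Lemma unfold_le (S : R) : (0 <= S)%R ->
  (forall W, siegel_space W -> \esum_(g in G) X (siegel_act g W) <= S%:E) ->
  sint (fun W => X W * Phi W) <= S%:E * sint (fun W => indF W * Phi W).
Proof.
have [GS G1 GM GV] := GG; have [FH _ FU] := FD.
move=> S0 HS.
pose b k W := if P k then indF (siegel_act (invmx (e k)) W) * (X W * Phi W) else 0.
pose c k W := if P k then indF W * (X (siegel_act (e k) W) * Phi W) else 0.
have mXP := mx_meas_mxHM mX mPhi.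
have XP0 W : siegel_space W -> 0 <= X W * Phi W by move=> WH; rewrite mule_ge0 ?X0 ?Phi0.
have b0 k W : siegel_space W -> 0 <= b k W.
  by move=> WH; rewrite /b; case: ifP => // _; rewrite mule_ge0 ?indF_ge0 ?XP0.
have c0 k W : siegel_space W -> 0 <= c k W.
  move=> WH; rewrite /c; case: ifP => // /asboolP[Gk _].
  by rewrite mule_ge0 ?indF_ge0// mule_ge0 ?Phi0// X0//; apply: siegel_act_space => //; exact: GS.
have mxH0 : mx_meas (mxH (fun _ : 'M[C]_n => 0 : \bar R)).
  by rewrite /mx_meas; under eq_fun do rewrite /mxH if_same; exact: measurable_cst.
have mb k : mx_meas (mxH (b k)).
  rewrite /b; case: (boolP (P k)) => [/asboolP[Gk _]|_]; last exact: mxH0.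
  apply: mx_meas_mxHM => //.
  have [m _] := symplectic_invariant (GS _ (GV _ Gk)) (fun W _ => indF_ge0 W) mx_meas_mxH_indF.
  exact: m.
have bc k : sint (b k) = sint (c k) /\ mx_meas (mxH (c k)).
  rewrite /b /c; case: (boolP (P k)) => [Pk|_]; last by [].
  have [Gk _] : G (e k) /\ code (e k) = k by exact/asboolP.
  have mbk := mb k; rewrite /b Pk in mbk.
  have bk0 W : siegel_space W -> 0 <= indF (siegel_act (invmx (e k)) W) * (X W * Phi W).
    by move=> WH; rewrite mule_ge0 ?indF_ge0 ?XP0.
  have [m E] := symplectic_invariant (GS _ Gk) bk0 mbk.
  have EE : forall W, siegel_space W ->
      ((fun W => indF (siegel_act (invmx (e k)) W) * (X W * Phi W)) \o siegel_act (e k)) W =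
      indF W * (X (siegel_act (e k) W) * Phi W).
    by move=> W WH /=; rewrite siegel_actK ?PhiG//; exact: GS.
  by rewrite -E /sint -(eq_mxH EE); split => //; exact: m.
have le1 W : siegel_space W -> X W * Phi W <= \sum_(k <oo) b k W.
  move=> WH.
  have [W' [[FW' [g Gg W'E]] _]] := FU W WH.
  have bE : \sum_(k <oo) b k W = \esum_(s in G) (indF (siegel_act (invmx s) W) * (X W * Phi W)).
    by rewrite esum_code// => s Gs; rewrite mule_ge0 ?indF_ge0 ?XP0.
  rewrite bE; apply: esum_ge; exists [set invmx g].
    by split; [exact: finite_set1|move=> _ ->; exact: GV].
  rewrite fsbig_set1 invmxK -W'E /indF asboolT// mul1e.
  exact: lexx.
apply: (@le_trans _ _ (sint (fun W => \sum_(k <oo) b k W))).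
  by apply: sint_le => //; exact: mx_meas_series.
rewrite sint_series//; under eq_eseriesr do rewrite (bc _).1.
have mc k : mx_meas (mxH (c k)) by have [] := bc k.
rewrite -sint_series//.
have IP0 W : siegel_space W -> 0 <= indF W * Phi W by move=> WH; rewrite mule_ge0 ?indF_ge0 ?Phi0.
have mIP : mx_meas (mxH (fun W => indF W * Phi W)) by apply: mx_meas_mxHM => //; exact: mx_meas_mxH_indF.
have SE : S%:E * sint (fun W => indF W * Phi W) = sint (fun W => S%:E * (indF W * Phi W)).
  rewrite /sint /mx_int -ge0_integralZl_EFin//.
  - apply: eq_integral => p _; rewrite /mxH; case: ifP => _; first by rewrite muleA.
    by rewrite !mul0e mule0.
  - by move=> p _; exact: mxH_dens_ge0.
  - exact: mx_meas_dens.
rewrite SE; apply: sint_le.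
- by move=> W WH; apply: nneseries_ge0 => k _ _; exact: c0.
- move=> W WH.
  have -> : \sum_(k <oo) c k W = \esum_(s in G) (indF W * (X (siegel_act s W) * Phi W)).
    rewrite esum_code// => s Gs; rewrite mule_ge0 ?indF_ge0// mule_ge0 ?Phi0// X0//.
    by apply: siegel_act_space => //; exact: GS.
  rewrite /indF; case: ifP => _; last first.
    under eq_esum do rewrite mul0e.
    by rewrite esum1// mul0e mule0.
  under eq_esum do rewrite mul1e muleC; rewrite mul1e.
  have XG0 s : G s -> 0 <= X (siegel_act s W) by move=> Gs; rewrite X0//; apply: siegel_act_space => //; exact: GS.
  have [->|/negbTE PhiN0] := eqVneq (Phi W) 0.
    by under eq_esum do rewrite mul0e; rewrite esum1// mule0.
  have := Phi0 WH; case E : (Phi W) => [r| |] // r0.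
    rewrite esum_codeZ//; rewrite muleC; apply: lee_wpmul2r; rewrite ?lee_fin//; exact: HS.
  (* Here [Phi W] is infinite. For [S = 0] the right side is 0 by convention, and then every term of
     the sum vanishes too. *)
  have [S00|S00] := eqVneq S 0%R.
    rewrite S00 mul0e; have XZ s : G s -> X (siegel_act s W) = 0.
      move=> Gs; apply/eqP; rewrite eq_le XG0// andbT.
      have HS0 := HS W WH; rewrite S00 in HS0; apply: le_trans HS0; apply: esum_ge; exists [set s]; last by rewrite fsbig_set1.
      by split; [exact: finite_set1|move=> _ ->].
    by rewrite esum1// => s Gs; rewrite XZ// mule0.
  by rewrite gt0_muley ?leey// lte_fin lt_neqAle eq_sym S00 S0.
- exact: mx_meas_series.
- have -> : mxH (fun W => S%:E * (indF W * Phi W)) = (fun W => S%:E * mxH (fun W => indF W * Phi W) W).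
    by apply/funext => W; rewrite /mxH; case: ifP => // _; rewrite mule0.
  exact: measurable_funeM.
Qed.

End Unfold.

Section Count.
Context (R : realType) (n : nat).
Local Notation C := R[i].
Implicit Types (Z W : 'M[C]_n) (g : 'M[R]_(n + n)).
Local Notation iM := ((Complex 0 1)%:M : 'M[C]_n).

(** The conjugate [t] of [s] by [g] maps one point near [i] to another, so by [act_close] it moves
    [i] by O(e). The cross ratio is then at most [y] with [y k <= 1]; each [ch^k] is at most
    [exp 1], and the product at most [exp n]. *)
Lemma count_term (X A : 'M[R]_n) (e : R) (k : nat) (s : 'M[R]_(n + n)) W :
  X^T = X -> A \in unitmx -> symplectic s -> siegel_space W ->
  e <= 1 -> n%:R * e <= 2^-1 -> (n ^ 2)%:R * e <= 2^-1 ->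
  (2 * ((n ^ 2)%:R * (2 * n%:R))) ^+ 2 * ((n ^ 2)%:R * (2 * e)) <= 2^-1 ->
  count_cst R n * e <= 1 -> ((2 * n%:R + 1) * (count_cst R n * e)) ^+ 2 <= 2^-1 ->
  ((2 * n%:R + 1) * (count_cst R n * e)) ^+ 2 * k%:R <= 1 ->
  let g := sp_aff X A in
  near_i e (siegel_act (invmx g) W) -> near_i e (siegel_act (invmx g) (siegel_act s W)) ->
  1 <= expR n%:R * (\prod_(j < n) cosh (r_fun (siegel_act g iM) (siegel_act s (siegel_act g iM)) j) ^+ k)^-1.
Proof.
move=> XT Au sS WH e1 ne n2e Ke c1 c2 ck /=; set g := sp_aff X A => N2 N1.
have gS : symplectic g := symplectic_aff XT Au.
have iH := siegel_i R n.
have giS := symplecticV gS.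
have H2 := siegel_act_space giS WH.
have sWH := siegel_act_space sS WH.
have H1 := siegel_act_space giS sWH.
pose t := invmx g *m s *m g.
have tS : symplectic t by apply: symplecticM => //; exact: symplecticM.
have tE Z : siegel_space Z -> siegel_act t Z = siegel_act (invmx g) (siegel_act s (siegel_act g Z)).
  move=> ZH; rewrite /t (siegel_act_mul (symplecticM giS sS) gS ZH).
  by rewrite (siegel_act_mul giS sS (siegel_act_space gS ZH)).
pose Z2 := siegel_act (invmx g) W - iM; pose Z1 := siegel_act (invmx g) (siegel_act s W) - iM.
have E2 : iM + Z2 = siegel_act (invmx g) W by rewrite addrC subrK.
have E1 : iM + Z1 = siegel_act (invmx g) (siegel_act s W) by rewrite addrC subrK.
have Z2T : Z2^T = Z2 by rewrite /Z2 linearB /= tr_scalar_mx; have [-> _] := H2.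
have Z1T : Z1^T = Z1 by rewrite /Z1 linearB /= tr_scalar_mx; have [-> _] := H1.
have tZ : siegel_act t (iM + Z2) = iM + Z1 by rewrite E2 (tE _ H2) (siegel_actKV gS WH) E1.
have close := act_close tS Z1T Z2T N1 N2 e1 ne n2e Ke tZ.
have tiH := siegel_act_space tS iH.
have gt : siegel_act s (siegel_act g iM) = siegel_act g (siegel_act t iM).
  by rewrite (tE _ iH) (siegel_actKV gS (siegel_act_space sS (siegel_act_space gS iH))).
set y := ((2 * n%:R + 1) * (count_cst R n * e)) ^+ 2 in c2 ck.
have cr : nrm (cross_ratio iM (siegel_act t iM)) <= y.
  apply: le_trans (cross_ratio_close (le_trans close c1)) _.
  have n0 : 0 <= 2 * n%:R + 1 :> R by rewrite addr_ge0// mulr_ge0.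
  have t0 := nrm_ge0 (siegel_act t iM - iM).
  have h := ler_wpM2l n0 close.
  by apply: lerXn2r => //; rewrite nnegrE ?(le_trans _ h) ?mulr_ge0.
have rE j : r_fun (siegel_act g iM) (siegel_act s (siegel_act g iM)) j = r_fun iM (siegel_act t iM) j.
  by rewrite gt (siegel_act_aff XT Au iH) (siegel_act_aff XT Au tiH) /r_fun /eigenvals (cross_ratio_affine X Au iH tiH).
have ch j : cosh (r_fun (siegel_act g iM) (siegel_act s (siegel_act g iM)) j) <= expR y.
  by rewrite rE; exact: cosh_r_fun_le.
have chp (x : R) : 0 < cosh x by rewrite /cosh divr_gt0// addr_gt0// expR_gt0.
rewrite ler_pdivlMr ?mul1r; last by apply: prodr_gt0 => j _; rewrite exprn_gt0.
apply: (@le_trans _ _ (\prod_(j < n) expR 1)); last first.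
  by rewrite prodr_const card_ord -expRM_natl mulr1.
apply: ler_prod => j _; rewrite exprn_ge0 ?(ltW (chp _))//=.
apply: (@le_trans _ _ (expR y ^+ k)).
  by apply: lerXn2r; rewrite ?nnegrE ?expR_ge0// ltW.
by rewrite -expRM_natl ler_expR mulrC.
Qed.

End Count.

(** * Orthonormal bases *)

Section Orthonormal.
Context (R : realType) (n : nat).
Local Notation C := R[i].
Local Notation T := (measurableTypeR R).
Local Notation N := ((n * n.+1)./2).
Local Notation coords := (N.-tuple T * N.-tuple T)%type.
Implicit Types (Z W : 'M[C]_n).
Context (G : set 'M[R]_(n + n)) (F : set 'M[C]_n) (FD : fundamental_domain G F).
Context (k d : nat) (f : 'I_d -> 'M[C]_n -> C).
Hypothesis hol : forall j, @holomorphic_on n (C : numFieldType) (@siegel_space R n) (f j).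
Hypothesis orth : forall i j, petersson F k (f i) (f j) = (i == j)%:R.

Let D : set coords := [set p | F (siegel_pt p)].
Let ure i j Z : R := \det (ImM Z) ^+ k * complex.Re (f i Z * Num.conj (f j Z)).
Let uim i j Z : R := \det (ImM Z) ^+ k * complex.Im (f i Z * Num.conj (f j Z)).
Let q (u : 'M[C]_n -> R) (p : coords) : R := u (siegel_pt p) / \det (ImM (siegel_pt p)) ^+ n.+1.

Let mD : measurable D.
Proof. by have [_ h _] := FD. Qed.

Let DH p : D p -> siegel_space (siegel_pt p).
Proof. by have [h _ _] := FD; exact: h. Qed.

Let RePet i j : fine (siegel_integral F (ure i j)) = (i == j)%:R.
Proof.
have := congr1 (@complex.Re R) (orth i j); rewrite /petersson /= => ->.
by case: (i == j).
Qed.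

Let ImPet i j : fine (siegel_integral F (uim i j)) = 0.
Proof.
have := congr1 (@complex.Im R) (orth i j); rewrite /petersson /= => ->.
by case: (i == j).
Qed.

Let Re_conj (z w : C) : complex.Re (z * Num.conj w) = complex.Re z * complex.Re w + complex.Im z * complex.Im w.
Proof. by case: z w => [a b] [c e]; rewrite conjC_complex /= mulrN opprK. Qed.

Let Im_conj (z w : C) : complex.Im (z * Num.conj w) = complex.Im z * complex.Re w - complex.Re z * complex.Im w.
Proof. by case: z w => [a b] [c e]; rewrite conjC_complex /=; ring. Qed.

Let mres j : mx_measC (res (@siegel_space R n) (f j)).
Proof. by apply: mx_measC_hol (hol j) => Z ZH _; exact: siegel_space_open. Qed.

Let measurable_q (u v : 'M[C]_n -> R) : mx_measR v ->
  (forall Z, siegel_space Z -> u Z = \det (ImM Z) ^+ k * v Z) ->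
  measurable_fun D (EFin \o q u).
Proof.
move=> mv uv; apply/measurable_EFinP.
have m1 : measurable_fun setT (fun p : coords => (\det (ImM (siegel_pt p)) ^+ k * v (siegel_pt p)) * (\det (ImM (siegel_pt p)) ^+ n.+1)^-1 : T).
  apply: measurable_funM; last by apply: (@mx_measR_inv R n (fun Z => \det (ImM Z) ^+ n.+1)); apply: mx_measR_X; exact: mx_measR_detIm.
  apply: measurable_funM; last exact: mv.
  exact: (mx_measR_X k (@mx_measR_detIm R n)).
apply: eq_measurable_fun (measurable_funTS m1) => p; rewrite in_setE => Dp.
by rewrite /q uv//; exact: DH.
Qed.

Let mre i j : measurable_fun D (EFin \o q (ure i j)).
Proof.
pose v Z : R := complex.Re (res (@siegel_space R n) (f i) Z) * complex.Re (res (@siegel_space R n) (f j) Z) +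
  complex.Im (res (@siegel_space R n) (f i) Z) * complex.Im (res (@siegel_space R n) (f j) Z).
apply: (@measurable_q _ v).
  apply: measurable_funD; apply: measurable_funM.
  - exact: (mres i).1. - exact: (mres j).1. - exact: (mres i).2. - exact: (mres j).2.
by move=> Z ZH; rewrite /ure /v Re_conj /res (asboolT ZH).
Qed.

Let mim i j : measurable_fun D (EFin \o q (uim i j)).
Proof.
pose v Z : R := complex.Im (res (@siegel_space R n) (f i) Z) * complex.Re (res (@siegel_space R n) (f j) Z) -
  complex.Re (res (@siegel_space R n) (f i) Z) * complex.Im (res (@siegel_space R n) (f j) Z).
apply: (@measurable_q _ v).
  apply: measurable_funB; apply: measurable_funM.
  - exact: (mres i).2. - exact: (mres j).1. - exact: (mres i).1. - exact: (mres j).2.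
by move=> Z ZH; rewrite /uim /v Im_conj /res (asboolT ZH).
Qed.

Let den_ge0 p : D p -> 0 <= \det (ImM (siegel_pt p)) ^+ k / \det (ImM (siegel_pt p)) ^+ n.+1.
Proof.
by move=> Dp; have dp := detIm_gt0 (DH Dp); rewrite divr_ge0 ?exprn_ge0// ltW.
Qed.

Let qE (u : 'M[C]_n -> R) (v : 'M[C]_n -> R) p : (forall Z, u Z = \det (ImM Z) ^+ k * v Z) ->
  q u p = \det (ImM (siegel_pt p)) ^+ k / \det (ImM (siegel_pt p)) ^+ n.+1 * v (siegel_pt p).
Proof. by move=> uv; rewrite /q uv mulrAC. Qed.

Let q_diag_ge0 j p : D p -> 0 <= q (ure j j) p.
Proof.
move=> Dp; rewrite (@qE _ (fun Z => complex.Re (f j Z * Num.conj (f j Z))))//.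
apply: mulr_ge0; first exact: den_ge0.
by rewrite Re_conj -!expr2 addr_ge0 ?sqr_ge0.
Qed.

Let int_diag j : (@lebc R N).-integrable D (EFin \o q (ure j j)).
Proof.
apply/integrableP; split; first exact: mre.
have -> : (\int[@lebc R N]_(p in D) `|(EFin \o q (ure j j)) p| = siegel_integral F (ure j j))%E.
  by apply: eq_integral => p; rewrite in_setE => Dp /=; rewrite ger0_norm// q_diag_ge0.
(* [fine] sends infinite values to 0, so the value 1 forces the integral to be finite. *)
have := RePet j j; rewrite eqxx; case: (siegel_integral _ _) => [r| |] //=.
- by rewrite ltry.
- by move/eqP; rewrite eq_sym oner_eq0.
Qed.

(** Off-diagonal products are dominated by [|f_i|^2 + |f_j|^2]. Their integrability is needed since
    [fine] in [petersson] would hide a divergent integral. *)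
Let int_dom i j (u : 'M[C]_n -> R) (v : 'M[C]_n -> R) : measurable_fun D (EFin \o q u) ->
  (forall Z, u Z = \det (ImM Z) ^+ k * v Z) -> (forall Z, `|v Z| <= cabs (f i Z * Num.conj (f j Z))) ->
  (@lebc R N).-integrable D (EFin \o q u).
Proof.
move=> mu uv vb.
have Is := integrableD mD (int_diag i) (int_diag j).
apply: (le_integrable mD mu _ Is) => p Dp.
change (`|q u p|%:E <= `|q (ure i i) p + q (ure j j) p|%:E)%E; rewrite lee_fin.
rewrite [leRHS]ger0_norm ?addr_ge0 ?q_diag_ge0// (qE p uv).
rewrite (@qE (ure i i) (fun Z => complex.Re (f i Z * Num.conj (f i Z))) p (fun=> erefl)).
rewrite (@qE (ure j j) (fun Z => complex.Re (f j Z * Num.conj (f j Z))) p (fun=> erefl)).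
rewrite -mulrDr normrM (ger0_norm (den_ge0 Dp)) ler_wpM2l ?den_ge0//.
apply: le_trans (vb _) _; rewrite cabsM cabs_conj !Re_conj -!expr2 -!cabs_sqr.
have a0 := cabs_ge0 (f i (siegel_pt p)); have b0 := cabs_ge0 (f j (siegel_pt p)).
have := sqr_ge0 (cabs (f i (siegel_pt p)) - cabs (f j (siegel_pt p))); nra.
Qed.

Let int_re i j : (@lebc R N).-integrable D (EFin \o q (ure i j)).
Proof. by apply: (@int_dom i j _ (fun Z => complex.Re (f i Z * Num.conj (f j Z)))) => // Z; exact: cabs_Re. Qed.

Let int_im i j : (@lebc R N).-integrable D (EFin \o q (uim i j)).
Proof. by apply: (@int_dom i j _ (fun Z => complex.Im (f i Z * Num.conj (f j Z)))) => // Z; exact: cabs_Im. Qed.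

Let Re_sum (I : Type) (s : seq I) (H : I -> C) : complex.Re (\sum_(i <- s) H i) = \sum_(i <- s) complex.Re (H i).
Proof. by rewrite (big_morph (@complex.Re R) (id1 := 0) (op1 := +%R))//; exact: complex_ReD. Qed.

Variable c : 'I_d -> C.
Let h Z : C := \sum_j c j * f j Z.
Let cre i j := complex.Re (c i * Num.conj (c j)).
Let cim i j := complex.Im (c i * Num.conj (c j)).

Let h_expand Z : cabs (h Z) ^+ 2 = \sum_(x : 'I_d * 'I_d)
  (cre x.1 x.2 * complex.Re (f x.1 Z * Num.conj (f x.2 Z)) - cim x.1 x.2 * complex.Im (f x.1 Z * Num.conj (f x.2 Z))).
Proof.
have -> : cabs (h Z) ^+ 2 = complex.Re (h Z * Num.conj (h Z)) by rewrite Re_conj -!expr2 cabs_sqr.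
rewrite /h rmorph_sum /= mulr_suml Re_sum.
rewrite -(pair_bigA _ (fun i j => cre i j * complex.Re (f i Z * Num.conj (f j Z)) - cim i j * complex.Im (f i Z * Num.conj (f j Z)))) /=.
apply: eq_bigr => i _; rewrite mulr_sumr Re_sum; apply: eq_bigr => j _.
rewrite rmorphM /= mulrACA complex_ReM //.
Qed.

(** Expanding [|h|^2] into pairs, all integrals converge absolutely and orthonormality leaves the
    diagonal. *)
Lemma orthonormal_norm : sint (fun W => (indF F W * (phi h k W)%:E)%E) = (\sum_j cabs (c j) ^+ 2)%:E.
Proof.
pose g (x : 'I_d * 'I_d) (p : coords) : \bar R :=
  ((cre x.1 x.2)%:E * (q (ure x.1 x.2) p)%:E - (cim x.1 x.2)%:E * (q (uim x.1 x.2) p)%:E)%E.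
have Ig x : (@lebc R N).-integrable D (g x).
  by apply: (integrableB mD); apply: (integrableZl mD); [exact: int_re|exact: int_im].
have -> : sint (fun W => (indF F W * (phi h k W)%:E)%E) = (\int[@lebc R N]_(p in D) \sum_(x : 'I_d * 'I_d) g x p)%E.
  rewrite integral_mkcond; apply: eq_integral => p _; rewrite patchE /mxH /indF.
  have [Dp|nDp] := pselect (D p); last first.
    have -> : (p \in D) = false by apply/negbTE; rewrite notin_setE.
    by rewrite (asboolF nDp) mul0e if_same mul0e.
  have -> : p \in D by rewrite in_setE.
  rewrite (asboolT Dp) (asboolT (DH Dp)) mul1e -EFinM.
  rewrite (eq_bigr (fun x => (cre x.1 x.2 * q (ure x.1 x.2) p - cim x.1 x.2 * q (uim x.1 x.2) p)%:E)); last first.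
    by move=> x _; rewrite /g EFinB !EFinM.
  rewrite sumEFin; congr EFin; rewrite /phi h_expand mulr_sumr mulr_suml; apply: eq_bigr => x _.
  by rewrite /q /ure /uim /sdens; ring.
rewrite integral_sum//.
rewrite (eq_bigr (fun x : 'I_d * 'I_d => (cre x.1 x.2 * (x.1 == x.2)%:R)%:E)); last first.
  move=> x _; rewrite /g integralB//; [|by apply: (integrableZl mD); exact: int_re|by apply: (integrableZl mD); exact: int_im].
  rewrite !integralZl//; [|exact: int_im|exact: int_re].
  have -> : (\int[@lebc R N]_(p in D) (q (ure x.1 x.2) p)%:E = (x.1 == x.2)%:R%:E)%E.
    by rewrite -RePet /siegel_integral fineK//; exact: (integrable_fin_num mD (int_re _ _)).
  have -> : (\int[@lebc R N]_(p in D) (q (uim x.1 x.2) p)%:E = 0%:E)%E.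
    by rewrite -(ImPet x.1 x.2) /siegel_integral fineK//; exact: (integrable_fin_num mD (int_im _ _)).
  by rewrite mule0 sube0 -EFinM.
rewrite sumEFin; congr EFin.
rewrite -(pair_bigA _ (fun i j => cre i j * (i == j)%:R)) /=; apply: eq_bigr => i _.
rewrite (bigD1 i)//= eqxx mulr1 big1 ?addr0; first by rewrite /cre Re_conj -!expr2 cabs_sqr.
by move=> j ji; rewrite eq_sym (negbTE ji) mulr0.
Qed.

End Orthonormal.

(** * Countability of the group *)

Section Countability.
Context (R : realType) (n : nat).

(** The group is a finite union of cosets of its integral part, and a pair of a coset index and an
    integer matrix can be encoded by a natural number. *)
Lemma arithmetic_enum (G : set 'M[R]_(n + n)) : arithmetic_subgroup G ->
  exists (e : nat -> 'M[R]_(n + n)) (code : 'M[R]_(n + n) -> nat), forall g, G g -> e (code g) = g.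
Proof.
move=> [GG [_ [s Hs]] _]; have [GS _ _ _] := GG.
pose e (k : nat) : 'M[R]_(n + n) :=
  if (unpickle k : option (nat * 'M[int]_(n + n))) is Some im
  then nth 0 s im.1 *m map_mx (fun z : int => z%:~R) im.2 else 0.
have H g : exists k, G g -> e k = g.
  have [Gg|] := pselect (G g); last by exists 0%N.
  have [x xs [Gx [_ [_ hint]]]] := Hs g Gg.
  pose m : 'M[int]_(n + n) := \matrix_(i, j) Num.floor ((invmx x *m g) i j).
  exists (pickle (index x s, m)) => _; rewrite /e pickleK /= nth_index//.
  have -> : map_mx (fun z : int => z%:~R) m = invmx x *m g.
    apply/matrixP => i j; have /floorK := hint i j.
    by rewrite !mxE.
  by rewrite mulKVmx//; apply: symplectic_unit; exact: GS.
by have [code Hc] := choice H; exists e, code.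
Qed.

End Countability.

Lemma differentiable_lincomb (K : numFieldType) n d (f : 'I_d -> 'M[K]_n -> K) (c : 'I_d -> K) (Z : 'M[K]_n) :
  (forall j, differentiable (fun W : 'M[K]_n => f j (symmetrize W) : K^o) Z) ->
  differentiable (fun W : 'M[K]_n => \sum_j c j * f j (symmetrize W) : K^o) Z.
Proof.
move=> df.
have -> : (fun W : 'M[K]_n => \sum_j c j * f j (symmetrize W) : K^o) =
    \sum_(j < d) (fun W : 'M[K]_n => c j *: (f j (symmetrize W) : K^o)).
  by apply/funext => W; rewrite fct_sumE.
by apply: differentiable_sum => j; apply: differentiableZ; exact: df.
Qed.

(** * Choice of the constants and the counting bound *)

Section Final.
Context (R : realType) (n : nat).
Local Notation C := R[i].
Local Notation N := ((n * n.+1)./2).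
Implicit Types (Z W : 'M[C]_n) (g : 'M[R]_(n + n)).
Local Notation iM := ((Complex 0 1)%:M : 'M[C]_n).

Lemma phi_invariant (h : 'M[C]_n -> C) k g W : symplectic g -> siegel_space W ->
  h (siegel_act g W) = \det (autfactor g W) ^+ k * h W -> phi h k (siegel_act g W) = phi h k W.
Proof.
move=> gS WH E; rewrite /phi E cabsM cabsX -(det_siegel_act_Im gS WH).
set x := cabs (\det (autfactor g W)); set y := cabs (h W); set D := \det _.
have -> : (x ^+ 2 * D) ^+ k = x ^+ k * x ^+ k * D ^+ k.
  by rewrite (exprMn k (x ^+ 2) D) exprAC expr2.
by ring.
Qed.

(* reciprocal of the polydisc radius at weight 1 *)
Definition Bcst : R := 4 + 4 * n%:R + 4 * (n ^ 2)%:R +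
  4 * ((2 * ((n ^ 2)%:R * (2 * n%:R))) ^+ 2 * (n ^ 2)%:R) + 4 * det_cst R n + 4 * count_cst R n +
  4 * ((2 * n%:R + 1) * count_cst R n) + 4 * wcst R n.

Lemma count_cst_ge0 : 0 <= count_cst R n.
Proof. by rewrite /count_cst mulr_ge0// addr_ge0// mulr_ge0// sqr_ge0. Qed.

Lemma wcst_ge0 : 0 <= wcst R n.
Proof. by rewrite /wcst mulr_ge0// addr_ge0 ?sqr_ge0// (le_trans ler01) ?det_cst_ge1. Qed.

Lemma Bcst_ge4 : 4 <= Bcst.
Proof.
have h1 := count_cst_ge0; have h2 := wcst_ge0; have h3 := det_cst_ge1 R n.
have h4 : 0 <= (2 * ((n ^ 2)%:R * (2 * n%:R))) ^+ 2 * (n ^ 2)%:R :> R by rewrite mulr_ge0// sqr_ge0.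
have h5 : 0 <= (2 * n%:R + 1) * count_cst R n by rewrite mulr_ge0// addr_ge0// mulr_ge0.
have h6 : 0 <= n%:R :> R by []. have h7 : 0 <= (n ^ 2)%:R :> R by [].
rewrite /Bcst; lra.
Qed.

(** All summands of [Bcst] are nonnegative and carry a factor 4, so each of them times [e] is
    controlled on its own. *)
Lemma radius_bounds (e : R) : 0 < e -> Bcst * e <= 1 ->
  [/\ e <= 1, n%:R * e <= 4^-1, (n ^ 2)%:R * e <= 2^-1,
      (2 * ((n ^ 2)%:R * (2 * n%:R))) ^+ 2 * ((n ^ 2)%:R * (2 * e)) <= 2^-1 & det_cst R n * e ^+ 2 <= 4^-1] /\
  [/\ count_cst R n * e <= 1, 0 <= (2 * n%:R + 1) * (count_cst R n * e) <= 4^-1 & wcst R n * e <= 1].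
Proof.
move=> e0.
have h1 := mulr_ge0 count_cst_ge0 (ltW e0); have h2 := mulr_ge0 wcst_ge0 (ltW e0).
have h3 := mulr_ge0 (le_trans ler01 (det_cst_ge1 R n)) (ltW e0).
have h4 : 0 <= (2 * ((n ^ 2)%:R * (2 * n%:R))) ^+ 2 * (n ^ 2)%:R :> R by rewrite mulr_ge0// sqr_ge0.
have {}h4 := mulr_ge0 h4 (ltW e0).
have h5 : 0 <= 2 * n%:R + 1 :> R by rewrite addr_ge0// mulr_ge0.
have {}h5 := mulr_ge0 h5 h1.
have h6 : 0 <= n%:R * e :> R by rewrite mulr_ge0// ltW.
have h7 : 0 <= (n ^ 2)%:R * e :> R by rewrite mulr_ge0// ltW.
have -> : Bcst * e = 4 * e + 4 * (n%:R * e) + 4 * ((n ^ 2)%:R * e) +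
  4 * ((2 * ((n ^ 2)%:R * (2 * n%:R))) ^+ 2 * (n ^ 2)%:R * e) + 4 * (det_cst R n * e) + 4 * (count_cst R n * e) +
  4 * ((2 * n%:R + 1) * (count_cst R n * e)) + 4 * (wcst R n * e) by rewrite /Bcst; ring.
move=> H.
have e1 : e <= 1 by lra.
have -> : (2 * ((n ^ 2)%:R * (2 * n%:R))) ^+ 2 * ((n ^ 2)%:R * (2 * e)) =
  2 * ((2 * ((n ^ 2)%:R * (2 * n%:R))) ^+ 2 * (n ^ 2)%:R * e) by ring.
have de : det_cst R n * e ^+ 2 <= det_cst R n * e by rewrite expr2 mulrA ler_piMr.
by split; split; try lra; apply/andP; split; lra.
Qed.

Local Open Scope ereal_scope.

(** The count is compared at an arbitrary [W], which need not be close to the base point. Replacing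
    [W] by one translate that is close only reindexes the sum over the group, and the terms can then
    be compared one by one. *)
Lemma count_sum (G : set 'M[R]_(n + n)) (c : nat -> 'M[R]_(n + n)) (code : 'M[R]_(n + n) -> nat)
    (X A : 'M[R]_n) (e : R) (k : nat) W :
  is_subgroup G -> (forall g, G g -> c (code g) = g) ->
  X^T = X -> A \in unitmx -> siegel_space W -> (0 < e)%R -> (Bcst * e <= 1)%R -> (Bcst ^+ 2 * (e ^+ 2 * k%:R) <= 1)%R ->
  let g := sp_aff X A in
  \esum_(s in G) ((`[< near_i e (siegel_act (invmx g) (siegel_act s W)) >])%:R)%R%:E <=
  (expR n%:R)%:E * \esum_(s in G) ((\prod_(j < n) cosh (r_fun (siegel_act g iM) (siegel_act s (siegel_act g iM)) j) ^+ k)^-1)%R%:E.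
Proof.
move=> GG cK XT Au WH e0 Be Bk /=; set g := sp_aff X A.
have [GS _ GM GV] := GG.
have [[e1 ne n2e Ke de] [c1 c2 we]] := radius_bounds e0 Be.
have ch (x : R) : (0 < cosh x)%R by rewrite /cosh divr_gt0// addr_gt0// expR_gt0.
pose a (s : 'M[R]_(n + n)) : \bar R :=
  ((\prod_(j < n) cosh (r_fun (siegel_act g iM) (siegel_act s (siegel_act g iM)) j) ^+ k)^-1)%R%:E.
have a0 s : 0 <= a s.
  by rewrite lee_fin invr_ge0; apply: prodr_ge0 => j _; rewrite exprn_ge0// ltW.
rewrite -/(a _).
(* If no translate of [W] is close, the left side is zero. *)
have [[s0 [Gs0 N0]]|none] := pselect (exists s, G s /\ near_i e (siegel_act (invmx g) (siegel_act s W))); last first.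
  rewrite esum1; first by rewrite mule_ge0 ?lee_fin ?expR_ge0//; apply: esum_ge0 => s _; exact: a0.
  by move=> s Gs; rewrite asboolF// => Ns; apply: none; exists s.
rewrite -(esum_translate GG a Gs0) -(esum_codeZ cK (expR_ge0 _)); last by move=> s _; exact: a0.
apply: le_esum => s Gs.
have [Ns|Ns] := pselect (near_i e (siegel_act (invmx g) (siegel_act s W))); last first.
  rewrite (asboolF Ns); apply: mule_ge0; last exact: a0.
  by rewrite lee_fin expR_ge0.
rewrite (asboolT Ns) /a -EFinM lee_fin.
have s0S := GS _ Gs0; have sS := GS _ Gs.
have s0W := siegel_act_space s0S WH.
have sE : siegel_act (s *m invmx s0) (siegel_act s0 W) = siegel_act s W.
  by rewrite (siegel_act_mul sS (symplecticV s0S) s0W) (siegel_actK s0S WH).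
have tS : symplectic (s *m invmx s0) := symplecticM sS (symplecticV s0S).
case/andP: c2 => c20 c21.
have ne2 : (n%:R * e <= 2^-1)%R by apply: le_trans ne _; lra.
have h5 : (0 <= 2 * n%:R + 1 :> R)%R by rewrite addr_ge0// mulr_ge0.
have c22 : (((2 * n%:R + 1) * (count_cst R n * e)) ^+ 2 <= 2^-1)%R.
  by set x := (_ * (_ * e))%R in c20 c21 *; nra.
have ck : (((2 * n%:R + 1) * (count_cst R n * e)) ^+ 2 * k%:R <= 1)%R.
  apply: le_trans Bk.
  have -> : (((2 * n%:R + 1) * (count_cst R n * e)) ^+ 2 * k%:R =
    ((2 * n%:R + 1) * count_cst R n) ^+ 2 * (e ^+ 2 * k%:R))%R by ring.
  apply: ler_wpM2r; first by rewrite mulr_ge0 ?sqr_ge0.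
  have L0 := mulr_ge0 h5 count_cst_ge0.
  have B0 : (0 <= Bcst)%R by apply: le_trans Bcst_ge4.
  apply: lerXn2r; rewrite ?nnegrE//.
  have h1 := count_cst_ge0; have h2 := wcst_ge0; have h3 := det_cst_ge1 R n.
  have h4 : (0 <= (2 * ((n ^ 2)%:R * (2 * n%:R))) ^+ 2 * (n ^ 2)%:R :> R)%R by rewrite mulr_ge0// sqr_ge0.
  have h6 : (0 <= n%:R :> R)%R by []. have h7 : (0 <= (n ^ 2)%:R :> R)%R by [].
  by rewrite /Bcst; lra.
have N1 : near_i e (siegel_act (invmx g) (siegel_act (s *m invmx s0) (siegel_act s0 W))) by rewrite sE.
exact: (count_term XT Au tS s0W e1 ne2 n2e Ke c1 c22 ck N0 N1).
Qed.

End Final.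

Section Bound.
Context (R : realType) (n : nat).
Local Notation C := R[i].
Local Notation N := ((n * n.+1)./2).
Implicit Types (Z W : 'M[C]_n) (g : 'M[R]_(n + n)).
Local Notation iM := ((Complex 0 1)%:M : 'M[C]_n).
Local Open Scope ereal_scope.

Lemma weight_pow_le (e : R) k : (0 < e)%R -> (wcst R n * (e ^+ 2 * k%:R) <= 1)%R ->
  ((1 + wcst R n * e ^+ 2) ^+ k <= expR 1)%R.
Proof.
move=> e0 H; apply: (@le_trans _ _ (expR (wcst R n * e ^+ 2) ^+ k)%R).
  by apply: lerXn2r; rewrite ?nnegrE ?expR_ge0 ?expR_ge1Dx// addr_ge0// mulr_ge0 ?wcst_ge0// sqr_ge0.
by rewrite -expRM_natl ler_expR mulrC -mulrA.
Qed.

(** The first three factors come from the local mean value bound, with [exp 1] for the weight;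
    [exp n] comes from the count, and [Bcst^(2N)] from the reciprocal volume of the polydisc. *)
Definition main_cst : R := (16 ^+ N * expR 1 * 2 ^+ n.+1 * expR n%:R * (Bcst R n ^+ 2) ^+ N)%R.

Lemma main_cst_gt0 : (0 < main_cst)%R.
Proof.
have B0 : (0 < Bcst R n)%R by apply: lt_le_trans (Bcst_ge4 R n).
by rewrite /main_cst !mulr_gt0 ?expR_gt0// ?exprn_gt0.
Qed.

Lemma S_fun_le (G : set 'M[R]_(n + n)) (F : set 'M[C]_n) (k d : nat) (f : 'I_d -> 'M[C]_n -> C) Z
    (e : nat -> 'M[R]_(n + n)) (code : 'M[R]_(n + n) -> nat) :
  is_subgroup G -> (forall g, G g -> e (code g) = g) -> fundamental_domain G F -> (0 < k)%N ->
  (forall j, siegel_modular_form G k (f j)) ->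
  (forall i j, petersson F k (f i) (f j) = (i == j)%:R) -> siegel_space Z ->
  (S_fun k f Z)%:E <= (main_cst * k%:R ^+ N)%R%:E *
    \esum_(g in G) ((\prod_(j < n) cosh (r_fun Z (siegel_act g Z) j) ^+ k)^-1)%R%:E.
Proof.
move=> GG eK FD k0 mf orth ZH.
have [GS _ _ _] := GG.
have kR : (0 < k%:R :> R)%R by rewrite ltr0n.
have ch (x : R) : (0 < cosh x)%R by rewrite /cosh divr_gt0// addr_gt0// expR_gt0.
set Sm := \esum_(g in G) _.
have Sm0 : 0 <= Sm.
  by apply: esum_ge0 => s _; rewrite lee_fin invr_ge0; apply: prodr_ge0 => j _; rewrite exprn_ge0// ltW.
have cp : (0 < main_cst * k%:R ^+ N)%R by rewrite mulr_gt0 ?main_cst_gt0// exprn_gt0.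
(* An infinite sum makes the bound trivial; otherwise it is a real number and may serve as the
   constant of the unfolding. *)
have [SmE|SmF] := eqVneq Sm +oo; first by rewrite SmE gt0_muley ?lte_fin// leey.
pose r := fine Sm.
have SmE : Sm = r%:E by rewrite fineK// ge0_fin_numE// lt_neqAle SmF leey.
have r0 : (0 <= r)%R by rewrite -lee_fin -SmE.
rewrite SmE -EFinM lee_fin.
have B4 := Bcst_ge4 R n.
have B0 : (0 < Bcst R n)%R by apply: lt_le_trans B4.
(* Normalized so that [Bcst^2 del^2 k = 1]: the exponents in the weight and in the hyperbolic
   cosines then stay bounded in [k]. *)
pose del := ((Bcst R n * Num.sqrt k%:R)^-1)%R.
have sk0 : (0 < Num.sqrt (k%:R : R))%R by rewrite sqrtr_gt0.
have sk1 : (1 <= Num.sqrt (k%:R : R))%R by have k1 : (1 <= k%:R :> R)%R := ltac:(by rewrite ler1n); have := ler_wsqrtr k1; rewrite sqrtr1.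
have del0 : (0 < del)%R by rewrite invr_gt0 mulr_gt0.
have Bd : (Bcst R n * del <= 1)%R.
  by rewrite /del invfM mulVKf ?gt_eqF// invf_le1.
have d2k : (Bcst R n ^+ 2 * (del ^+ 2 * k%:R) = 1)%R.
  rewrite /del exprVn exprMn sqr_sqrtr ?(ltW kR)//; field.
  by rewrite !gt_eqF.
have [[e1 ne n2e Ke de] [c1 c2 we]] := radius_bounds del0 Bd.
have [X [A [Au XT gE]]] := siegel_base ZH.
set g := sp_aff X A in gE.
have gS : symplectic g := symplectic_aff XT Au.
(* With these coefficients both [h(Z)] and the squared norm of [h] equal [s]. The local bound
   becomes [D s^2 <= const s], and cancelling one [s] leaves the bound for [S_fun], which is
   [D s]. *)
pose c j : C := Num.conj (f j Z).
pose h W : C := (\sum_j c j * f j W)%R.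
have hh : @holomorphic_on n (C : numFieldType) (@siegel_space R n) h.
  by move=> W WH; apply: differentiable_lincomb => j; exact: (smf_holomorphic (mf j)).
have hG s W : G s -> siegel_space W -> h (siegel_act s W) = (\det (autfactor s W) ^+ k * h W)%R.
  move=> Gs WH; rewrite /h mulr_sumr; apply: eq_bigr => j _.
  by rewrite (smf_modular (mf j) Gs WH) mulrCA.
pose s := (\sum_j cabs (f j Z) ^+ 2)%R.
have s0 : (0 <= s)%R by apply: sumr_ge0 => j _; exact: sqr_ge0.
have hZ : cabs (h Z) = s.
  have -> : h Z = (s%:C)%C.
    rewrite /s rmorph_sum /=; apply: eq_bigr => j _; rewrite /c.
    case: (f j Z) => a b; rewrite cabs_sqr conjC_complex; apply/eqP.
    by rewrite eq_complex /=; apply/andP; split; apply/eqP; ring.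
  by rewrite cabs_real ger0_norm.
have normE : sint (fun W => indF F W * (phi h k W)%:E) = s%:E.
  rewrite (orthonormal_norm FD (fun j => smf_holomorphic (mf j)) orth c).
  by congr EFin; apply: eq_bigr => j _; rewrite /c cabs_conj.
pose D := (\det (ImM Z) ^+ k)%R.
have D0 : (0 <= D)%R by rewrite exprn_ge0// ltW// detIm_gt0.
have SE : S_fun k f Z = (D * s)%R by rewrite /S_fun /s mulr_sumr.
pose Xi W : \bar R := ((`[< near_i del (siegel_act (invmx g) W) >])%:R)%R%:E.
have mXi : mx_meas (mxH Xi).
  have [m _] := symplectic_invariant (symplecticV gS) (h := fun Z => ((`[< near_i del Z >])%:R)%R%:E)
    (fun _ _ => ltac:(by rewrite lee_fin)) (@mx_meas_near_i R n del).
  exact: m.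
have Xi0 W : siegel_space W -> 0 <= Xi W by move=> _; rewrite lee_fin.
have Phi0 W : siegel_space W -> 0 <= (phi h k W)%:E by move=> WH; rewrite lee_fin phi_ge0.
have PhiG t W : G t -> siegel_space W -> (phi h k (siegel_act t W))%:E = (phi h k W)%:E.
  by move=> Gt WH; congr EFin; apply: phi_invariant => //; [exact: GS|exact: hG].
have S0 : (0 <= expR n%:R * r)%R by rewrite mulr_ge0// expR_ge0.
have HS W : siegel_space W -> \esum_(t in G) Xi (siegel_act t W) <= (expR n%:R * r)%R%:E.
  move=> WH; have Bk : (Bcst R n ^+ 2 * (del ^+ 2 * k%:R) <= 1)%R by rewrite d2k.
  have := count_sum GG eK XT Au WH del0 Bd Bk.
  by rewrite /= -/g gE -/Sm SmE -EFinM.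
have U := unfold_le GG eK FD Phi0 (mx_meas_phi k hh) Xi0 mXi PhiG S0 HS.
rewrite normE in U.
have L := local_mean k hh XT Au (introT andP (conj del0 e1)) ne de.
rewrite /= -/g gE in L.
have XE : sint (fun W => if `[< near_i del (siegel_act (invmx g) W) >] then (phi h k W)%:E else 0) =
    sint (fun W => Xi W * (phi h k W)%:E).
  by congr sint; apply/funext => W; rewrite /Xi; case: ifP => _; rewrite ?mul1e ?mul0e.
rewrite XE in L.
have w0 : (0 <= 16 ^+ N * (1 + wcst R n * del ^+ 2) ^+ k * 2 ^+ n.+1)%R.
  by rewrite !mulr_ge0 ?exprn_ge0// addr_ge0// mulr_ge0 ?wcst_ge0// sqr_ge0.
have {}L := le_trans L (lee_wpmul2l _ U).
have := L; rewrite lee_fin => /(_ w0).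
rewrite -!EFinM lee_fin /phi hZ -/D => {L U} L.
have wk : ((1 + wcst R n * del ^+ 2) ^+ k <= expR 1)%R.
  apply: weight_pow_le => //.
  apply: (@le_trans _ _ (Bcst R n ^+ 2 * (del ^+ 2 * k%:R))%R); last by rewrite d2k.
  apply: ler_wpM2r; first by rewrite mulr_ge0 ?sqr_ge0.
  have h1 := count_cst_ge0 R n; have h2 := wcst_ge0 R n; have h3 := det_cst_ge1 R n.
  have h4 : (0 <= (2 * ((n ^ 2)%:R * (2 * n%:R))) ^+ 2 * (n ^ 2)%:R :> R)%R by rewrite mulr_ge0// sqr_ge0.
  have h5 : (0 <= (2 * n%:R + 1) * count_cst R n)%R by rewrite mulr_ge0// addr_ge0// mulr_ge0.
  have h6 : (0 <= n%:R :> R)%R by []. have h7 : (0 <= (n ^ 2)%:R :> R)%R by [].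
  apply: (@le_trans _ _ (Bcst R n)); first by rewrite /Bcst; lra.
  by rewrite expr2 ler_peMr// ?ltW//; lra.
have L2 : (D * s ^+ 2 * ((2 * del) ^+ N) ^+ 2 <= 16 ^+ N * expR 1 * 2 ^+ n.+1 * (expR n%:R * r * s))%R.
  apply: le_trans L _; apply: ler_wpM2r; first by rewrite mulr_ge0.
  by rewrite ler_wpM2r ?exprn_ge0// ler_wpM2l ?exprn_ge0.
rewrite SE; have [->|sn0] := eqVneq s 0%R; first by rewrite mulr0 mulr_ge0// ltW.
have sp : (0 < s)%R by rewrite lt_neqAle eq_sym sn0.
(* The volume [(2 del)^(2N)] is [4^N / (Bcst^2 k)^N]; this is the source of [k^N]. The spare factor
   [4^N] is at least 1 and is dropped at the end. *)
have volE : (((2 * del) ^+ N) ^+ 2 * ((Bcst R n ^+ 2) ^+ N * k%:R ^+ N) = 4 ^+ N)%R.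
  rewrite exprAC -!exprMn; congr (_ ^+ _)%R.
  transitivity (4 * (Bcst R n ^+ 2 * (del ^+ 2 * k%:R)))%R; first by ring.
  by rewrite d2k mulr1.
have P0 : (0 < (Bcst R n ^+ 2) ^+ N * k%:R ^+ N)%R by rewrite mulr_gt0 ?exprn_gt0.
have L3 : (D * s * 4 ^+ N <= main_cst * k%:R ^+ N * r)%R.
  rewrite -(ler_pM2r sp); have := ler_wpM2r (ltW P0) L2.
  have -> : (D * s ^+ 2 * ((2 * del) ^+ N) ^+ 2 * ((Bcst R n ^+ 2) ^+ N * k%:R ^+ N) = D * s * 4 ^+ N * s)%R.
    by rewrite -mulrA volE; ring.
  by move/le_trans; apply; rewrite le_eqVlt; apply/orP; left; apply/eqP; rewrite /main_cst; ring.
apply: le_trans L3; rewrite ler_peMr ?mulr_ge0//.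
by rewrite exprn_ege1// ler1n.
Qed.

End Bound.

Theorem theorem4p4 (R : realType) (n : nat) (hn : (0 < n)%N)
    (Gamma : set 'M[R]_(n + n))
    (Gamma_arith : arithmetic_subgroup Gamma)
    (Gamma_proper : Gamma `<` @symplectic R n)
    (Gamma_vol : finite_covolume Gamma) :
  exists c : R, 0 < c /\
    forall (F : set 'M[R[i]]_n) (k d : nat) (f : 'I_d -> 'M[R[i]]_n -> R[i])
           (Z : 'M[R[i]]_n),
      fundamental_domain Gamma F ->
      (n.+1 <= k)%N ->
      orthonormal_basis Gamma F k f ->
      siegel_space Z ->
      ((S_fun k f Z)%:E <=
       (c * k%:R ^+ (n * n.+1)./2)%:E *
       \esum_(g in Gamma)
         ((\prod_(j < n) cosh (r_fun Z (siegel_act g Z) j) ^+ k)^-1)%:E)%E.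
Proof.
have [e [code eK]] := arithmetic_enum Gamma_arith.
have [GG _ _] := Gamma_arith.
exists (main_cst R n); split; first exact: main_cst_gt0.
move=> F k d f Z FD nk [cusp orth _] ZH.
apply: (S_fun_le GG eK FD) => //; first exact: leq_trans nk.
by move=> j; exact: scf_modular (cusp j).
Qed.
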